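(* For $\alpha\in(0,1)$ let $$\mathscr{P}_\alpha(x)=\frac12\,\frac{\sin(\pi\alpha)}{\cosh(\pi x)-\cos(\pi\alpha)},\qquad x\in\mathbb{R}.$$ Then for every $\alpha\in(0,1)$, $$\log H_{1,\infty}(\alpha)=\int_{\mathbb{R}}\mathscr{P}_\alpha(x)\log\Big(\frac{\mathscr{P}_\alpha(x)}{1-\alpha}\Big)\,dx.$$ Moreover, for any $1\le p,q\le\infty$, $$\log H_{p,q}(\alpha)=\frac1p\int_{\mathbb{R}}\mathscr{P}_\alpha(x)\log\Big(\frac{\mathscr{P}_\alpha(x)}{1-\alpha}\Big)\,dx+\frac1q\int_{\mathbb{R}}\mathscr{P}_{1-\alpha}(x)\log\Big(\frac{\mathscr{P}_{1-\alpha}(x)}{\alpha}\Big)\,dx$$ (with $1/\infty=0$).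
   Context: $S=\{x+iy\in\mathbb{C}:0<y<1\}$. For a function $h$ on $S$ and $0<y<1$, $h_y$ denotes the function $x\mapsto h(x+iy)$ on $\mathbb{R}$. For $1\le p,q\le\infty$, $\mathbb{H}^{p,q}(S)$ is the space of holomorphic $h:S\to\mathbb{C}$ with $$\|h\|_{\mathbb{H}^{p,q}}=\sup_{0<y<1}\ \inf_{f+g=h_y}\big\{(1-y)^{-1}\|f\|_{L^p(\mathbb{R})}+y^{-1}\|g\|_{L^q(\mathbb{R})}\big\}<\infty.$$ For $h\in\mathbb{H}^{p,q}(S)$, the boundary values $h_0\in L^p(\mathbb{R})$ and $h_1\in L^q(\mathbb{R})$ are the limits of $h_y$, in the sense of tempered distributions, as $y\downarrow0$ and $y\uparrow1$ respectively (these exist). For $0<\alpha<1$, $$H_{p,q}(\alpha)=\sup_{h\in\mathbb{H}^{p,q}(S)}\frac{\|h_\alpha\|_{L^\infty(\mathbb{R})}}{\|h_0\|_{L^p(\mathbb{R})}^{1-\alpha}\|h_1\|_{L^q(\mathbb{R})}^{\alpha}},$$ the supremum being over $h$ not identically zero. *)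

(* Defs.v *)
From HB Require Import structures.
From mathcomp Require Import all_boot all_order all_algebra.
From mathcomp Require Import all_classical all_reals all_analysis.
From mathcomp Require Import complex.

Set Implicit Arguments.
Unset Strict Implicit.
Unset Printing Implicit Defensive.

Import Order.TTheory GRing.Theory Num.Theory.
Import numFieldNormedType.Exports.

Local Open Scope classical_set_scope.
Local Open Scope ring_scope.
Local Open Scope complex_scope.

Definition strip (R : realType) : set R[i] :=
  [set z : R[i] | 0 < complex.Im z < 1].

(* Functions on the strip are total functions on R[i] whose values outside the
   strip are never used.  The derivative is the complex one: the scalars of
   [R[i]^o] are R[i]. *)
Definition holomorphic_on_strip (R : realType) (h : R[i] -> R[i]) : Prop :=
  forall z : R[i], strip z -> derivable (h : R[i]^o -> R[i]^o) z 1.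

Definition hline (R : realType) (h : R[i] -> R[i]) (y : R) : R -> R[i] :=
  fun x => h (x +i* y).

Definition cmeasurable (R : realType) (f : R -> R[i]) : Prop :=
  measurable_fun [set: R] (fun x => complex.Re (f x)) /\
  measurable_fun [set: R] (fun x => complex.Im (f x)).

Definition cLnorm (R : realType) (p : \bar R) (f : R -> R[i]) : \bar R :=
  Lnorm lebesgue_measure p (fun x => (Normc.normc (f x))%:E).

Definition in_cLp (R : realType) (p : \bar R) (f : R -> R[i]) : Prop :=
  cmeasurable f /\ (cLnorm p f < +oo)%E.

Definition cintegral (R : realType) (f : R -> R[i]) : R[i] :=
  (\int[lebesgue_measure]_x complex.Re (f x))%R +i*
  (\int[lebesgue_measure]_x complex.Im (f x))%R.

Definition split_norm (R : realType) (p q : \bar R) (y : R) (u : R -> R[i])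
    : \bar R :=
  ereal_inf [set r | exists f g : R -> R[i],
    [/\ in_cLp p f, in_cLp q g, (forall x, f x + g x = u x) &
        r = ((1 - y)^-1%:E * cLnorm p f + y^-1%:E * cLnorm q g)%E]].

Definition Hpq_norm (R : realType) (p q : \bar R) (h : R[i] -> R[i])
    : \bar R :=
  ereal_sup [set split_norm p q y (hline h y) | y in [set y : R | 0 < y < 1]].

Definition in_Hpq (R : realType) (p q : \bar R) (h : R[i] -> R[i]) : Prop :=
  holomorphic_on_strip h /\ (Hpq_norm p q h < +oo)%E.

Definition rschwartz (R : realType) (f : R -> R) : Prop :=
  (forall (n : nat) (x : R), derivable (derive1n n f) x 1) /\
  (forall k n : nat, exists M : R, forall x : R, `|x ^+ k * derive1n n f x| <= M).

(* A complex-valued function is Schwartz iff its real and imaginary parts are;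
   the derivatives are taken componentwise because R[i] is not equipped with a
   normed module structure over R. *)
Definition schwartz (R : realType) (phi : R -> R[i]) : Prop :=
  rschwartz (fun x => complex.Re (phi x)) /\
  rschwartz (fun x => complex.Im (phi x)).

(* [u y] tends to [v], as [y] follows the filter [F], in the sense of tempered
   distributions. *)
Definition tempered_cvg (R : realType) (u : R -> R -> R[i])
    (F : set_system R) (v : R -> R[i]) : Prop :=
  forall phi : R -> R[i], schwartz phi ->
    (fun y : R => cintegral (fun x => u y x * phi x) : R[i]^o) @ F -->
    (cintegral (fun x => v x * phi x) : R[i]^o).

Definition boundary_values (R : realType) (p q : \bar R) (h : R[i] -> R[i])
    (h0 h1 : R -> R[i]) : Prop :=
  [/\ in_cLp p h0, in_cLp q h1,
      tempered_cvg (hline h) 0^'+ h0 & tempered_cvg (hline h) 1^'- h1].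

(* For h in H^{p,q} the boundary values exist and are unique up to null sets,
   so quantifying over h0 and h1 amounts to taking the supremum over h. *)
Definition Hconst (R : realType) (p q : \bar R) (alpha : R) : \bar R :=
  ereal_sup [set r | exists (h : R[i] -> R[i]) (h0 h1 : R -> R[i]),
    [/\ in_Hpq p q h, (exists2 z, strip z & h z != 0),
        boundary_values p q h h0 h1 &
        r = (cLnorm +oo (hline h alpha) /
             (cLnorm p h0 `^ (1 - alpha) * cLnorm q h1 `^ alpha))%E]].

Definition cosh (R : realType) (x : R) : R := (expR x + expR (- x)) / 2.

Definition poisson (R : realType) (alpha x : R) : R :=
  2^-1 * (sin (pi * alpha) / (cosh (pi * x) - cos (pi * alpha))).

(* Main.v *)
(** With D(z) = cosh(pi z) - cos(pi alpha), the kernel sin(pi alpha) / (2 D(z))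
    has a single pole in the closed strip, at i alpha, with residue 1/(2 pi i);
    it equals P_alpha on the line y = 0 and - P_(1 - alpha) on the line y = 1.
    Let Psi be a holomorphic function whose real part is
    (1/p) ln P_alpha + b0 on y = 0 and (1/q) ln P_(1 - alpha) + b1 on y = 1;
    Cauchy's formula for Psi times the kernel gives Re Psi(i alpha).

    Upper bound: apply Cauchy's formula to h exp(- Psi - eps z^2) times the
    kernel on lines inside the strip, and move to the boundary, where the
    damped kernel is a Schwartz function.  With
    b0 = ln |h_0|_p - (1/p) ln (1 - alpha) the inequality
    t^(1/p) <= t/p + 1 - 1/p, applied pointwise, bounds the lower integral by
    1 - alpha, and likewise the upper one by alpha, so that
    |h(i alpha)| <= exp(Re Psi(i alpha)).

    Lower bound: exp(Psi - eps z^2) turns these inequalities into equalities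
    as eps tends to 0. *)
Require Import Defs.
From HB Require Import structures.
From mathcomp Require Import all_boot all_order all_algebra.
From mathcomp Require Import all_classical all_reals all_analysis.
From mathcomp Require Import measurable_realfun complex.
From mathcomp Require Import ring lra.

Import Order.TTheory GRing.Theory Num.Theory.
Import numFieldNormedType.Exports.
Local Open Scope classical_set_scope.
Local Open Scope ring_scope.

Set Implicit Arguments.
Unset Strict Implicit.
Unset Printing Implicit Defensive.

(** On y = 0 the kernel times exp(- Psi) has modulus proportional to P_alpha^(1 - 1/p), which does
    not decay for p = 1, while boundary values are limits against Schwartz functions only: hence the
    Gaussian. When the lines move to the boundary the kernel moves with h_y; its Lipschitz
    dependence on y, weighted by 1 / (1 + x^2), is set against a weighted L^1 bound of h_y uniform
    in y. That bound comes from the splitting f + g, since 1 / (1 - y) and 1 / y are at least 1.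
    Inside the strip h is controlled only in the mean on horizontal lines, so vertical sides go
    through a primitive of h.

    Psi is not found by solving a Dirichlet problem. Its derivative is explicit: the logarithmic
    derivative of 1 / D times an affine function interpolating 1/p and 1/q, plus a multiple of the
    kernel that cancels the pole at i alpha.

    No residue is computed: the numerator is made to vanish at the pole, and Cauchy's theorem is
    proved with one point of mere continuity.

    The estimate is made at i alpha and translated along y = alpha. It takes any positive upper
    bounds of the two boundary norms, so it also shows that neither norm vanishes unless h does. *)

Notation nc := Normc.normc.
(* [Num.Theory] and [complex] declare two competing notations for the
   imaginary unit. *)
Notation ci := (Complex 0 1).

(** * Complex derivatives *)

Section ComplexNorm.
Variable R : realType.
Implicit Types (x y : R) (z w : R[i]).
Local Open Scope complex_scope.

Lemma ncE z : `|z| = (nc z)%:C. Proof. by []. Qed.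

Lemma lecR x y : (x%:C <= y%:C) = (x <= y).
Proof. by rewrite lecE/= eqxx. Qed.

Lemma ltcR x y : (x%:C < y%:C) = (x < y).
Proof. by rewrite ltcE/= eqxx. Qed.

Lemma nc_ge0 z : 0 <= nc z.
Proof. by rewrite -lecR -ncE normr_ge0. Qed.

Lemma ncD z w : nc (z + w) <= nc z + nc w.
Proof. by rewrite -lecR rmorphD/= -!ncE ler_normD. Qed.

Lemma ncN z : nc (- z) = nc z.
Proof. by case: z => a b /=; rewrite !sqrrN. Qed.

Lemma ncB z w : nc (z - w) <= nc z + nc w.
Proof. by rewrite (le_trans (ncD _ _))// ncN. Qed.

Lemma ncM z w : nc (z * w) = nc z * nc w. Proof. exact: Normc.normcM. Qed.

Lemma ncV z : nc z^-1 = (nc z)^-1. Proof. exact: Normc.normcV. Qed.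

Lemma ncX z n : nc (z ^+ n) = nc z ^+ n.
Proof.
elim: n => [|n IH]; first exact: Normc.normc1.
by rewrite !exprS ncM IH.
Qed.

Lemma nc_eq0 z : (nc z == 0) = (z == 0).
Proof. by apply/eqP/eqP => [/Normc.eq0_normc//|->]; rewrite Normc.normc0. Qed.

Lemma nc_gt0 z : (0 < nc z) = (z != 0).
Proof. by rewrite lt_neqAle nc_ge0 andbT eq_sym nc_eq0. Qed.

Lemma nc_real x : nc x%:C = `|x|.
Proof. by rewrite /= expr0n addr0 sqrtr_sqr. Qed.

Lemma Re_le_nc z : `|complex.Re z| <= nc z.
Proof.
case: z => a b /=; rewrite -[`|a|]sqrtr_sqr ler_wsqrtr// lerDl sqr_ge0//.
Qed.

Lemma Im_le_nc z : `|complex.Im z| <= nc z.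
Proof.
case: z => a b /=; rewrite -[`|b|]sqrtr_sqr ler_wsqrtr// lerDr sqr_ge0//.
Qed.

Lemma nc_le_ReIm z : nc z <= `|complex.Re z| + `|complex.Im z|.
Proof.
case: z => a b /=.
have E : a +i* b = a%:C + ci * b%:C :> R[i].
  exact: complexE.
rewrite -[Num.sqrt _]/(nc (a +i* b)) E.
rewrite (le_trans (ncD _ _))// ncM !nc_real.
by rewrite /= expr0n expr1n add0r sqrtr1 mul1r.
Qed.

Lemma nc_i : nc (ci : R[i]) = 1.
Proof. by rewrite /= expr0n expr1n add0r sqrtr1. Qed.

Lemma Re_add z w : complex.Re (z + w) = complex.Re z + complex.Re w.
Proof. by case: z; case: w. Qed.
Lemma Im_add z w : complex.Im (z + w) = complex.Im z + complex.Im w.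
Proof. by case: z; case: w. Qed.
Lemma Re_sub z w : complex.Re (z - w) = complex.Re z - complex.Re w.
Proof. by case: z; case: w. Qed.
Lemma Im_sub z w : complex.Im (z - w) = complex.Im z - complex.Im w.
Proof. by case: z; case: w. Qed.

End ComplexNorm.

Section Derivatives.
Variable R : realType.
Local Open Scope complex_scope.
Implicit Types (f g : R[i] -> R[i]) (z l : R[i]).

(** The difference quotient is cleared of its denominator. In this form, over [R] and over [R[i]]
    alike, restricting a complex derivative to a line only means choosing a real or an imaginary
    increment. *)
Lemma is_deriveP (K : numFieldType) (f : K^o -> K^o) (x l : K) :
  is_derive x 1 f l <-> forall e, 0 < e -> exists2 d, 0 < d &
    forall w, `|w| < d -> `|f (x + w) - f x - l * w| <= e * `|w|.
Proof.
split.
- move=> /[dup] fx [df fl] e e0.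
  have : (fun h => h^-1 *: ((f \o shift x) (h *: (1 : K)) - f x)) @ 0^' --> (l : K^o).
    by have := df; rewrite /derivable => /cvg_ex[l' Hl'];
      rewrite -fl /derive; move/cvgP : Hl'; exact.
  move/cvgrPdist_le => /(_ e e0).
  rewrite near_withinE => /nbhs_normP[d/= d0 H]; exists d => // w wd.
  have [->|w0] := eqVneq w 0; first by rewrite addr0 subrr sub0r mulr0 oppr0 !normr0 mulr0.
  have := H w; rewrite /ball_/= sub0r normrN => /(_ wd w0).
  rewrite [w *: 1]mulr1 -[in X in X -> _](ler_pM2r (_ : 0 < `|w|)) ?normr_gt0// -normrM.
  rewrite mulrBl [w^-1 *: _]mulrC -mulrA mulVf// mulr1 distrC.
  by rewrite [w + x]addrC.
- move=> H.
  have cv : (fun h => h^-1 *: ((f \o shift x) (h *: (1 : K)) - f x)) @ 0^' --> (l : K^o).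
    apply/cvgrPdist_le => e e0; have [d d0 Hd] := H e e0.
    rewrite near_withinE; apply/nbhs_normP; exists d => //= w.
    rewrite /ball_/= sub0r normrN => wd w0.
    rewrite [w *: 1]mulr1 -(ler_pM2r (_ : 0 < `|w|)) ?normr_gt0// -normrM.
    rewrite mulrBl [w^-1 *: _]mulrC -mulrA mulVf// mulr1 distrC [w + x]addrC.
    exact: Hd.
  split; first by apply/cvg_ex; exists l.
  exact/cvg_lim.
Qed.

(** Real tolerances and [nc] replace the [R[i]]-valued norm, so that all estimates are inequalities
    in [R]; [cderivP] gives the link with [is_derive]. *)
Definition cderiv f z l := forall e : R, 0 < e -> exists2 d, 0 < d &
  forall w, nc w < d -> nc (f (z + w) - f z - l * w) <= e * nc w.

Definition ccont f z := forall e : R, 0 < e -> exists2 d, 0 < d &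
  forall w, nc w < d -> nc (f (z + w) - f z) <= e.

Lemma cderivP f z l : is_derive (z : R[i]^o) 1 (f : R[i]^o -> R[i]^o) l <-> cderiv f z l.
Proof.
rewrite is_deriveP; split=> H e e0.
- have [|d d0 Hd] := H e%:C; first by rewrite ltcR.
  move: d0 Hd; case: d => d d'; rewrite ltcE/= => /andP[/eqP-> d0] Hd.
  exists d => // w wd.
  by rewrite -lecR rmorphM/= -!ncE; apply: Hd; rewrite ncE ltcR.
- move: e0; case: e => e e'; rewrite ltcE/= => /andP[/eqP-> e0].
  have [d d0 Hd] := H e e0; exists d%:C; first by rewrite ltcR.
  move=> w; rewrite ncE ltcR => /Hd.
  by rewrite -lecR rmorphM/=.
Qed.

Lemma cderiv_derivable f z l : cderiv f z l -> derivable (f : R[i]^o -> R[i]^o) (z : R[i]^o) 1.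
Proof. by move=> /cderivP[]. Qed.

Lemma derivable_cderiv f z : derivable (f : R[i]^o -> R[i]^o) (z : R[i]^o) 1 ->
  exists l, cderiv f z l.
Proof. by move=> /derivableP /cderivP; eexists; eauto. Qed.

Lemma cderiv_cont f z l : cderiv f z l -> ccont f z.
Proof.
move=> H e e0; have [d d0 Hd] := H 1 ltr01.
have K0 : 0 < 1 + nc l by rewrite ltr_pwDl// nc_ge0.
exists (Num.min d (e / (1 + nc l))).
  by rewrite lt_min d0 divr_gt0.
move=> w; rewrite lt_min => /andP[/Hd {}Hd we].
have -> : f (z + w) - f z = (f (z + w) - f z - l * w) + l * w by rewrite subrK.
rewrite (le_trans (ncD _ _))// (le_trans (lerD Hd (lexx _)))//.
rewrite ncM -mulrDl.
by move/ltW : we; rewrite ler_pdivlMr// mulrC.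
Qed.

Lemma cderiv_cst c z : cderiv (fun=> c) z 0.
Proof. by apply/cderivP; exact: is_derive_cst. Qed.

Lemma cderiv_id z : cderiv (fun w => w) z 1.
Proof. by apply/cderivP; exact: is_derive_id. Qed.

Lemma cderivD f g z l m : cderiv f z l -> cderiv g z m ->
  cderiv (fun w => f w + g w) z (l + m).
Proof. by move=> /cderivP ? /cderivP ?; apply/cderivP; exact: is_deriveD. Qed.

Lemma cderivN f z l : cderiv f z l -> cderiv (fun w => - f w) z (- l).
Proof. by move=> /cderivP ?; apply/cderivP; exact: is_deriveN. Qed.

Lemma cderivB f g z l m : cderiv f z l -> cderiv g z m ->
  cderiv (fun w => f w - g w) z (l - m).
Proof. by move=> fl gm; apply: cderivD => //; exact: cderivN. Qed.

Lemma cderivM f g z l m : cderiv f z l -> cderiv g z m ->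
  cderiv (fun w => f w * g w) z (l * g z + f z * m).
Proof.
move=> fl gm.
have /cderivP := is_deriveM (proj2 (cderivP _ _ _) fl) (proj2 (cderivP _ _ _) gm).
by rewrite addrC [l * _]mulrC.
Qed.

Lemma cderivMl c f z l : cderiv f z l -> cderiv (fun w => c * f w) z (c * l).
Proof.
by move=> fl; have := cderivM (cderiv_cst c z) fl; rewrite mul0r add0r.
Qed.

Lemma cderiv_comp f g z l m : cderiv g z m -> cderiv f (g z) l ->
  cderiv (fun w => f (g w)) z (l * m).
Proof.
move=> Hg Hf e e0.
have K0 : 0 < 1 + nc m by rewrite ltr_pwDl// nc_ge0.
have L0 : 0 < 1 + nc l by rewrite ltr_pwDl// nc_ge0.
pose e1 := e / 2 / (1 + nc m).
have e10 : 0 < e1 by rewrite !divr_gt0.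
have [d d0 Hd] := Hf _ e10.
pose e2 := Num.min 1 (e / 2 / (1 + nc l)).
have e20 : 0 < e2 by rewrite lt_min ltr01 !divr_gt0.
have [d' d'0 Hd'] := Hg _ e20.
exists (Num.min d' (d / (1 + nc m))); first by rewrite lt_min d'0 divr_gt0.
move=> w; rewrite lt_min => /andP[/Hd' {}Hd' wd].
pose v := g (z + w) - g z.
have vw : nc v <= (1 + nc m) * nc w.
  have -> : v = (v - m * w) + m * w by rewrite subrK.
  rewrite (le_trans (ncD _ _))// ncM mulrDl lerD2r (le_trans Hd')//.
  by rewrite ler_wpM2r ?nc_ge0// ge_min lexx.
have vd : nc v < d by rewrite (le_lt_trans vw)// mulrC -ltr_pdivlMr.
have := Hd _ vd; rewrite {1}/v addrCA subrr addr0 => H1.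
have -> : f (g (z + w)) - f (g z) - l * m * w =
   (f (g (z + w)) - f (g z) - l * v) + l * (v - m * w) by ring.
rewrite (le_trans (ncD _ _))// ncM.
rewrite (splitr e) mulrDl lerD//.
  rewrite (le_trans H1)// /e1 (le_trans (ler_wpM2l (ltW e10) vw))// /e1.
  by rewrite mulrA divfK// gt_eqF.
rewrite (le_trans (ler_wpM2l (nc_ge0 _) Hd'))// mulrA ler_wpM2r ?nc_ge0//.
rewrite (@le_trans _ _ ((1 + nc l) * e2))// ?ler_wpM2r ?(ltW e20)// ?lerDr//.
by rewrite mulrC -ler_pdivlMr// ge_min lexx orbT.
Qed.

Lemma cderiv_inv z : z != 0 -> cderiv (fun w => w^-1) z (- (z ^+ 2)^-1).
Proof.
rewrite -nc_gt0 => z0 e e0.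
exists (Num.min (nc z / 2) (e * nc z ^+ 3 / 2)).
  by rewrite lt_min divr_gt0//= divr_gt0// mulr_gt0// exprn_gt0.
move=> w; rewrite lt_min => /andP[wz we].
have zw : nc z / 2 <= nc (z + w).
  have := ncB (z + w) w; rewrite addrK => h.
  lra.
have zw0 : 0 < nc (z + w) by rewrite (lt_le_trans _ zw)// divr_gt0.
have -> : (z + w)^-1 - z^-1 - (- (z ^+ 2)^-1) * w = w ^+ 2 / (z ^+ 2 * (z + w)).
  by field; rewrite -!nc_gt0 zw0.
rewrite !(ncX, ncM, ncV) expr2 -mulrA mulrC.
rewrite ler_wpM2r ?nc_ge0//.
rewrite ler_pdivrMr ?mulr_gt0//.
apply: (le_trans (ltW we)).
rewrite !exprS expr0 mulr1 -!mulrA ler_wpM2l ?(ltW e0)// !ler_wpM2l ?nc_ge0//.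
Qed.

Lemma cderivV f z l : f z != 0 -> cderiv f z l ->
  cderiv (fun w => (f w)^-1) z (- l / f z ^+ 2).
Proof.
move=> fz0 fl; have := cderiv_comp fl (cderiv_inv fz0).
by rewrite mulNr mulrC mulNr.
Qed.

Lemma cderiv_eq f g z l (d : R) : 0 < d ->
  (forall w, nc w < d -> f (z + w) = g (z + w)) -> cderiv f z l -> cderiv g z l.
Proof.
move=> d0 fg H e /H[d' d'0 Hd'].
exists (Num.min d d'); rewrite ?lt_min ?d0// => w; rewrite lt_min => /andP[wd wd'].
rewrite -fg// -[z in g z]addr0 -fg ?Normc.normc0// addr0; exact: Hd'.
Qed.

End Derivatives.

Section RealLines.
Variable R : realType.
Local Open Scope complex_scope.
Implicit Types (f g : R -> R[i]) (F L : R[i] -> R[i]) (z l : R[i]) (x y : R).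

Lemma complex_eqE z w : complex.Re z = complex.Re w -> complex.Im z = complex.Im w -> z = w.
Proof. by case: z w => [a b] [c d] /= -> ->. Qed.

Definition rderiv f x l :=
  is_derive x 1 (fun t => complex.Re (f t)) (complex.Re l) /\
  is_derive x 1 (fun t => complex.Im (f t)) (complex.Im l).

Lemma rderivD f g x l m : rderiv f x l -> rderiv g x m ->
  rderiv (fun t => f t + g t) x (l + m).
Proof.
move=> [f1 f2] [g1 g2]; split; rewrite ?Re_add ?Im_add.
  by under eq_fun do rewrite Re_add; exact: is_deriveD.
by under eq_fun do rewrite Im_add; exact: is_deriveD.
Qed.

Lemma rderivB f g x l m : rderiv f x l -> rderiv g x m ->
  rderiv (fun t => f t - g t) x (l - m).
Proof.
move=> [f1 f2] [g1 g2]; split; rewrite ?Re_sub ?Im_sub.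
  by under eq_fun do rewrite Re_sub; exact: is_deriveB.
by under eq_fun do rewrite Im_sub; exact: is_deriveB.
Qed.

Lemma rderivZ c f x l : rderiv f x l -> rderiv (fun t => c * f t) x (c * l).
Proof.
case: c => a b [f1 f2].
have d1 (u v : R -> R) (m n c d : R) : is_derive x 1 u m -> is_derive x 1 v n ->
    is_derive x 1 (fun t => c * u t + d * v t) (c * m + d * n).
  by move=> du dv; apply: is_deriveD; exact: is_deriveZ.
split => /=.
  have -> : (fun t => complex.Re ((a +i* b) * f t)) =
    (fun t => a * complex.Re (f t) + (- b) * complex.Im (f t)).
    by apply/funext => t; case: (f t) => p q /=; ring.
  have -> : complex.Re ((a +i* b) * l) = a * complex.Re l + (- b) * complex.Im l.
    by case: (l) => p q /=; ring.
  exact: d1.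
have -> : (fun t => complex.Im ((a +i* b) * f t)) =
  (fun t => a * complex.Im (f t) + b * complex.Re (f t)).
  by apply/funext => t; case: (f t) => p q /=; ring.
have -> : complex.Im ((a +i* b) * l) = a * complex.Im l + b * complex.Re l.
  by case: (l) => p q /=; ring.
exact: d1.
Qed.

Lemma rderiv_cst c x : rderiv (fun=> c) x 0.
Proof. by split; exact: is_derive_cst. Qed.

Lemma addc_x x y t : (x +i* y) + t%:C = (x + t) +i* y.
Proof. by apply: complex_eqE => //=; rewrite addr0. Qed.

Lemma addc_y x y t : (x +i* y) + ci * t%:C = x +i* (y + t).
Proof. by apply: complex_eqE => /=; ring. Qed.

Lemma nc_iM z : nc (ci * z) = nc z.
Proof. by rewrite ncM nc_i mul1r. Qed.

Lemma cderiv_x F x y l : cderiv F (x +i* y) l -> rderiv (fun t => F (t +i* y)) x l.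
Proof.
move=> H; split; apply/is_deriveP => e e0; have [d d0 Hd] := H e e0;
  exists d => // w wd; move: (Hd w%:C); rewrite nc_real => /(_ wd); rewrite addc_x => H1.
  by apply: le_trans H1; apply: le_trans (Re_le_nc _);
    rewrite !Re_sub /=; case: (l) => a b /=; rewrite mulr0 subr0.
by apply: le_trans H1; apply: le_trans (Im_le_nc _);
  rewrite !Im_sub /=; case: (l) => a b /=; rewrite mulr0 add0r.
Qed.

Lemma cderiv_y F x y l : cderiv F (x +i* y) l ->
  rderiv (fun t => F (x +i* t)) y (ci * l).
Proof.
move=> H; split; apply/is_deriveP => e e0; have [d d0 Hd] := H e e0;
  exists d => // w wd; move: (Hd (ci * w%:C)); rewrite nc_iM nc_real => /(_ wd); rewrite addc_y => H1.
  apply: le_trans H1; apply: le_trans (Re_le_nc _).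
  rewrite !Re_sub; rewrite (_ : complex.Re (l * _) = complex.Re (ci * l) * w)//; case: (l) => a b /=; ring.
apply: le_trans H1; apply: le_trans (Im_le_nc _).
rewrite !Im_sub; rewrite (_ : complex.Im (l * _) = complex.Im (ci * l) * w)//; case: (l) => a b /=; ring.
Qed.

Lemma MVT_le (h dh : R -> R) (a b K : R) : a <= b ->
  (forall x, a <= x <= b -> is_derive x 1 h (dh x)) ->
  (forall x, a <= x <= b -> `|dh x| <= K) -> `|h b - h a| <= K * (b - a).
Proof.
rewrite le_eqVlt => /orP[/eqP<-|ab] dhP dhK.
  by rewrite !subrr normr0 mulr0.
have sub x : x \in `]a, b[ -> a <= x <= b.
  by rewrite in_itv/= => /andP[/ltW-> /ltW->].
have [|c cab ->] := @MVT R h dh a b ab (fun x xab => dhP x (sub x xab)).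
  by apply: derivable_within_continuous => x; rewrite in_itv/= => /dhP[].
rewrite normrM [`|b - a|]gtr0_norm ?subr_gt0//.
by rewrite ler_wpM2r ?subr_ge0 ?(ltW ab)// dhK ?sub.
Qed.

(** The mean value theorem fails for complex values. Applied to the real and the imaginary part
    separately, it costs the factor 2 that recurs in later estimates. *)
Lemma rMVT f f' a b K : a <= b ->
  (forall x, a <= x <= b -> rderiv f x (f' x)) ->
  (forall x, a <= x <= b -> nc (f' x) <= K) -> nc (f b - f a) <= 2 * K * (b - a).
Proof.
move=> ab df fK.
have H1 : `|complex.Re (f b) - complex.Re (f a)| <= K * (b - a).
  apply: (@MVT_le (fun t => complex.Re (f t)) (fun t => complex.Re (f' t))) => // x xab.
    exact: (df x xab).1.
  exact: le_trans (Re_le_nc _) (fK _ _).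
have H2 : `|complex.Im (f b) - complex.Im (f a)| <= K * (b - a).
  apply: (@MVT_le (fun t => complex.Im (f t)) (fun t => complex.Im (f' t))) => // x xab.
    exact: (df x xab).2.
  exact: le_trans (Im_le_nc _) (fK _ _).
rewrite (le_trans (nc_le_ReIm _))// Re_sub Im_sub (le_trans (lerD H1 H2))//.
by rewrite -mulrA mulr_natl mulr2n.
Qed.

Lemma rMVT_abs f f' a b K :
  (forall x, `|x - a| <= `|b - a| -> rderiv f x (f' x)) ->
  (forall x, `|x - a| <= `|b - a| -> nc (f' x) <= K) ->
  nc (f b - f a) <= 2 * K * `|b - a|.
Proof.
move=> df fK; have [ab|/ltW ba] := leP a b.
  rewrite ger0_norm ?subr_ge0//; apply: (@rMVT _ f') => // x /andP[ax xb].
    by apply: df; rewrite !ger0_norm ?subr_ge0// lerB.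
  by apply: fK; rewrite !ger0_norm ?subr_ge0// lerB.
rewrite distrC ger0_norm ?subr_ge0// -ncN opprB; apply: (@rMVT _ f') => // x /andP[ax xb].
  by apply: df; rewrite distrC [`|b - a|]distrC !ger0_norm ?subr_ge0// lerB.
by apply: fK; rewrite distrC [`|b - a|]distrC !ger0_norm ?subr_ge0// lerB.
Qed.

Lemma cabs_parts (s t e : R) : `|s| < e -> `|t| < e -> nc (s +i* t) < 2 * e.
Proof. by move=> se te; rewrite (le_lt_trans (nc_le_ReIm _))//=; lra. Qed.

(** The Cauchy-Riemann equations sit in the hypothesis: both partial derivatives come from one [L].
    After subtraction of the linear map of slope [c] they are small near the point, by continuity of
    [L], and the mean value estimate applies along a horizontal and a vertical leg. *)
Lemma partial_cderiv F L x0 y0 (d0 : R) : 0 < d0 ->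
  (forall x y, `|x - x0| < d0 -> `|y - y0| < d0 ->
    rderiv (fun t => F (t +i* y)) x (L (x +i* y)) /\
    rderiv (fun t => F (x +i* t)) y (ci * L (x +i* y))) ->
  ccont L (x0 +i* y0) -> cderiv F (x0 +i* y0) (L (x0 +i* y0)).
Proof.
move=> d00 HF HL e e0.
have e4 : 0 < e / 4 by rewrite divr_gt0.
have [d1 d10 Hd] := HL _ e4.
exists (Num.min d0 (d1 / 2)); first by rewrite lt_min d00 divr_gt0.
case=> s t; rewrite lt_min => /andP[wd0 wd1].
have sw : `|s| <= nc (s +i* t) := Re_le_nc (s +i* t).
have tw : `|t| <= nc (s +i* t) := Im_le_nc (s +i* t).
set c := L (x0 +i* y0).
have cl z : cderiv (fun w => c * w) z c.
  by have := cderivMl c (cderiv_id z); rewrite mulr1.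
have HLe s' t' : `|s'| <= `|s| -> `|t'| <= `|t| ->
    nc (L ((x0 + s') +i* (y0 + t')) - c) <= e / 4.
  move=> ss tt.
  have -> : (x0 + s') +i* (y0 + t') = (x0 +i* y0) + (s' +i* t') by [].
  by apply: Hd; rewrite -[d1](divfK (_ : 2 != 0))// mulrC cabs_parts// ?(le_lt_trans ss) ?(le_lt_trans tt)// (le_lt_trans _ wd1).
have H1 : nc ((F ((x0 + s) +i* (y0 + t)) - c * ((x0 + s) +i* (y0 + t)))
     - (F (x0 +i* (y0 + t)) - c * (x0 +i* (y0 + t)))) <= 2 * (e / 4) * `|(x0 + s) - x0|.
  apply: (@rMVT_abs (fun u => F (u +i* (y0 + t)) - c * (u +i* (y0 + t)))
     (fun u => L (u +i* (y0 + t)) - c)) => x; rewrite [x0 + s]addrC addrK => xs.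
    apply: rderivB; last exact: cderiv_x.
    by apply: (HF x (y0 + t) _ _).1;
      rewrite ?(le_lt_trans xs)// ?(le_lt_trans sw)// addrC addKr (le_lt_trans tw).
  by rewrite -[x in L (x +i* _)](subrKC x0); apply: HLe.
have H2 : nc ((F (x0 +i* (y0 + t)) - c * (x0 +i* (y0 + t)))
     - (F (x0 +i* y0) - c * (x0 +i* y0))) <= 2 * (e / 4) * `|(y0 + t) - y0|.
  apply: (@rMVT_abs (fun u => F (x0 +i* u) - c * (x0 +i* u))
     (fun u => ci * L (x0 +i* u) - ci * c)) => y; rewrite [y0 + t]addrC addrK => yt.
    apply: rderivB; last exact: cderiv_y.
    by apply: (HF x0 y _ _).2; rewrite ?subrr ?normr0// (le_lt_trans yt)// (le_lt_trans tw).
  rewrite -mulrBr nc_iM.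
  by rewrite -[y in L (_ +i* y)](subrKC y0) -[x in L (x +i* _)]addr0; apply: HLe; rewrite ?normr0.
have -> : F (x0 +i* y0 + (s +i* t)) - F (x0 +i* y0) - c * (s +i* t) =
  ((F ((x0 + s) +i* (y0 + t)) - c * ((x0 + s) +i* (y0 + t)))
     - (F (x0 +i* (y0 + t)) - c * (x0 +i* (y0 + t)))) +
  ((F (x0 +i* (y0 + t)) - c * (x0 +i* (y0 + t)))
     - (F (x0 +i* y0) - c * (x0 +i* y0))).
  rewrite -[(x0 + s) +i* (y0 + t)]/((x0 +i* y0) + (s +i* t)).
  ring.
rewrite (le_trans (ncD _ _))// (le_trans (lerD H1 H2))//.
rewrite [x0 + s]addrC [y0 + t]addrC !addrK.
have -> : e * nc (s +i* t) = 2 * (e / 4) * nc (s +i* t) + 2 * (e / 4) * nc (s +i* t).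
  by field.
by rewrite lerD// ler_wpM2l// mulr_ge0// ltW.
Qed.

End RealLines.

(** * The complex exponential *)

Section ComplexExp.
Variable R : realType.
Local Open Scope complex_scope.
Implicit Types (z w : R[i]).

Definition cexp z : R[i] :=
  (expR (complex.Re z) * cos (complex.Im z)) +i* (expR (complex.Re z) * sin (complex.Im z)).

Lemma cexpD z w : cexp (z + w) = cexp z * cexp w.
Proof.
case: z w => [a b] [c d]; rewrite /cexp/= expRD cosD sinD.
by apply: complex_eqE => /=; ring.
Qed.

Lemma nc_cexp z : nc (cexp z) = expR (complex.Re z).
Proof.
rewrite /cexp /= !exprMn -mulrDr cos2Dsin2 mulr1 sqrtr_sqr ger0_norm// expR_ge0.
Qed.

Lemma cexp_neq0 z : cexp z != 0.
Proof. by rewrite -nc_gt0 nc_cexp expR_gt0. Qed.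

Lemma cexp_partials (x y : R) :
  rderiv (fun t => cexp (t +i* y)) x (cexp (x +i* y)) /\
  rderiv (fun t => cexp (x +i* t)) y (ci * cexp (x +i* y)).
Proof.
split; split; rewrite /cexp/=.
- by apply: is_derive_eq; rewrite /GRing.scale/=; ring.
- by apply: is_derive_eq; rewrite /GRing.scale/=; ring.
- by apply: is_derive_eq; rewrite /GRing.scale/=; ring.
- by apply: is_derive_eq; rewrite /GRing.scale/=; ring.
Qed.

Lemma cexp_cont z : ccont cexp z.
Proof.
case: z => x y e e0.
have K0 : 0 < expR (x + 1) :> R by exact: expR_gt0.
exists (Num.min 1 (e / (4 * expR (x + 1)))).
  by rewrite lt_min ltr01 divr_gt0// mulr_gt0.
case=> s t; rewrite lt_min => /andP[w1 we].
have sw : `|s| <= nc (s +i* t) := Re_le_nc (s +i* t).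
have tw : `|t| <= nc (s +i* t) := Im_le_nc (s +i* t).
have H1 : nc (cexp ((x + s) +i* (y + t)) - cexp (x +i* (y + t)))
    <= 2 * expR (x + 1) * `|(x + s) - x|.
  apply: (@rMVT_abs _ (fun u => cexp (u +i* (y + t))) (fun u => cexp (u +i* (y + t)))).
    by move=> u _; exact: (cexp_partials _ _).1.
  move=> u; rewrite [x + s]addrC addrK nc_cexp/= ler_expR => /ler_normlW us.
  by rewrite addrC -lerBlDr (le_trans us)// (le_trans sw)// ltW.
have H2 : nc (cexp (x +i* (y + t)) - cexp (x +i* y))
    <= 2 * expR (x + 1) * `|(y + t) - y|.
  apply: (@rMVT_abs _ (fun u => cexp (x +i* u)) (fun u => ci * cexp (x +i* u))).
    by move=> u _; exact: (cexp_partials _ _).2.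
  by move=> u _; rewrite nc_iM nc_cexp/= ler_expR lerDl.
rewrite -[x +i* y + _]/((x + s) +i* (y + t)).
rewrite -(subrKA (cexp (x +i* (y + t)))).
rewrite (le_trans (ncD _ _))// (le_trans (lerD H1 H2))//.
rewrite [x + s]addrC [y + t]addrC !addrK -mulrDr.
move/ltW : we; rewrite ler_pdivlMr ?mulr_gt0//; apply: le_trans.
rewrite mulrC [X in _ <= X]mulrC.
have -> : 4 * expR (x + 1) * nc (s +i* t) =
  2 * expR (x + 1) * (nc (s +i* t) + nc (s +i* t)) by ring.
by rewrite mulrC ler_wpM2l ?mulr_ge0 ?(ltW K0)// lerD.
Qed.

Lemma cderiv_cexp z : cderiv cexp z (cexp z).
Proof.
case: z => x y; apply: (@partial_cderiv _ _ _ _ _ 1) => //.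
  by move=> *; exact: cexp_partials.
exact: cexp_cont.
Qed.

End ComplexExp.

(** * Cauchy's theorem in a strip *)

Section Antiderivative.
Variable R : realType.
Local Open Scope complex_scope.
Notation mu := (@lebesgue_measure R).

Lemma continuous_integrable (f : R -> R) a b : continuous f ->
  mu.-integrable `[a, b] (EFin \o f).
Proof.
move=> cf; apply: continuous_compact_integrable; first exact: segment_compact.
exact: continuous_subspaceT.
Qed.

Lemma is_derive_local (f g : R -> R) (x l d : R) : 0 < d ->
  (forall y, `|y - x| < d -> f y = g y) -> is_derive x 1 f l -> is_derive x 1 g l.
Proof.
move=> d0 fg /is_deriveP H; apply/is_deriveP => e /H[d' d'0 Hd'].
exists (Num.min d d'); first by rewrite lt_min d0.
move=> w; rewrite lt_min => /andP[wd wd']; rewrite -!fg ?subrr ?normr0//.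
  exact: Hd'.
by rewrite [x + w]addrC addrK.
Qed.

Lemma continuous_antiderivative (f : R -> R) : continuous f ->
  exists F : R -> R, forall x : R, is_derive x 1 F (f x).
Proof.
move=> cf.
pose F x := \int[mu]_(t in `[0, x]) f t - \int[mu]_(t in `[x, 0]) f t.
exists F => x.
(* The base point [- N] lies to the left of both [x] and 0, as the fundamental theorem from a left
   end point requires; near [x] the signed integral [F] differs from [G] by the constant [G 0]. *)
pose N : R := `|x| + 1.
have N0 : 0 < N by rewrite /N ltr_wpDl.
have xN : - N < x < N.
  by rewrite -ltr_norml /N ltrDl.
have [Nx xN'] : - N < x /\ x < N by apply/andP.
pose G y := \int[mu]_(t in `[- N, y]) f t.
have [dG G'] := continuous_FTC1_closed xN' (@continuous_integrable f (- N) N cf) Nx (cf x).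
have N00 : - N <= 0 by rewrite oppr_le0 ltW.
have itvB (a b : R) : - N <= a -> a <= b -> G b - G a = \int[mu]_(t in `[a, b]) f t.
  move=> Na ab.
  have := @Rintegral_itvB R f (BLeft (- N)) (BRight b) a
    (@continuous_integrable f (- N) b cf).
  rewrite !bnd_simp => /(_ Na ab) ->.
  rewrite Rintegral_itv_obnd_cbnd//.
  apply: integrableS (@continuous_integrable f a b cf) => //.
  exact: subset_itv_oc_cc.
have empty (a b : R) : a <= b -> \int[mu]_(t in `[b, a]) f t = 0.
  rewrite le_eqVlt => /orP[/eqP<-|ab]; first by rewrite set_itv1 Rintegral_set1.
  by rewrite set_itv_ge ?Rintegral_set0// bnd_simp -ltNge.
have GF (y : R) : - N < y -> F y = G y - G 0.
  move=> Ny; rewrite /F; have [y0|/ltW y0] := leP 0 y.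
    by rewrite (empty 0 y)// subr0 itvB.
  by rewrite (empty y 0)// sub0r -itvB// ?opprB// ltW.
apply: (@is_derive_local (fun y => G y - G 0) _ _ _ (x + N)).
- by rewrite -ltrBlDr sub0r.
- move=> y; rewrite ltr_norml => /andP[H _]; apply/esym/GF; lra.
have -> : f x = f x - 0 by rewrite subr0.
apply: is_deriveB.
rewrite -G' derive1E; exact/derivableP.
Qed.

Definition rcont (f : R -> R[i]) (x : R) :=
  {for x, continuous (fun t => complex.Re (f t))} /\
  {for x, continuous (fun t => complex.Im (f t))}.

Lemma ccont_x (F : R[i] -> R[i]) x y : ccont F (x +i* y) -> rcont (fun t => F (t +i* y)) x.
Proof.
move=> H; split; apply/cvgrPdist_le => e e0; have [d d0 Hd] := H e e0;
  apply/nbhs_normP; exists d => // t /=; rewrite distrC => xt;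
  move: (Hd (t - x)%:C); rewrite nc_real addc_x [x + _]addrC subrK => /(_ xt) /=;
  rewrite distrC; apply: le_trans.
  by rewrite -Re_sub Re_le_nc.
by rewrite -Im_sub Im_le_nc.
Qed.

Lemma ccont_y (F : R[i] -> R[i]) x y : ccont F (x +i* y) -> rcont (fun t => F (x +i* t)) y.
Proof.
move=> H; split; apply/cvgrPdist_le => e e0; have [d d0 Hd] := H e e0;
  apply/nbhs_normP; exists d => // t /=; rewrite distrC => xt;
  move: (Hd (ci * (t - y)%:C)); rewrite nc_iM nc_real addc_y [y + _]addrC subrK => /(_ xt) /=;
  rewrite distrC; apply: le_trans.
  by rewrite -Re_sub Re_le_nc.
by rewrite -Im_sub Im_le_nc.
Qed.

Definition clamp (a b x : R) := Num.max a (Num.min b x).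

Lemma clamp_id a b x : a <= x <= b -> clamp a b x = x.
Proof. by move=> /andP[ax xb]; rewrite /clamp min_r// max_r. Qed.

Lemma clamp_itv a b x : a <= b -> a <= clamp a b x <= b.
Proof. by move=> ab; rewrite /clamp le_max lexx/= ge_max ab ge_min lexx. Qed.

Lemma continuous_clamp a b : continuous (clamp a b).
Proof.
by move=> x; apply: continuous_max; [exact: cvg_cst|apply: continuous_min; [exact: cvg_cst|exact: cvg_id]].
Qed.

(* The antiderivative is two-sided at the end points too: it is taken of the
   function frozen outside [a, b]. *)
Lemma rcont_antiderivative (f : R -> R[i]) a b : a <= b ->
  (forall x, a <= x <= b -> rcont f x) ->
  exists F : R -> R[i], forall x, a <= x <= b -> rderiv F x (f x).
Proof.
move=> ab cf.
have c1 : continuous (fun t => complex.Re (f (clamp a b t))).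
  move=> x; apply: (@continuous_comp _ _ _ (clamp a b) (fun t => complex.Re (f t))).
    exact: continuous_clamp.
  exact: (cf _ (clamp_itv _ ab)).1.
have c2 : continuous (fun t => complex.Im (f (clamp a b t))).
  move=> x; apply: (@continuous_comp _ _ _ (clamp a b) (fun t => complex.Im (f t))).
    exact: continuous_clamp.
  exact: (cf _ (clamp_itv _ ab)).2.
have [F1 HF1] := continuous_antiderivative c1.
have [F2 HF2] := continuous_antiderivative c2.
exists (fun x => F1 x +i* F2 x) => x xab; split => /=.
  by have := HF1 x; rewrite clamp_id.
by have := HF2 x; rewrite clamp_id.
Qed.

End Antiderivative.

Section Goursat.
Variable R : realType.
Local Open Scope complex_scope.
Implicit Types (A B : R -> R -> R[i]) (W : R[i] -> R[i]).

(* [A] and [B] play the role of antiderivatives along the horizontal and the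
   vertical lines, so that this is the circulation along a rectangle. *)
Definition circ A B x1 x2 y1 y2 : R[i] :=
  (A x2 y1 - A x1 y1) + (B x2 y2 - B x2 y1)
  - (A x2 y2 - A x1 y2) - (B x1 y2 - B x1 y1).

(** Each function is determined only up to a function of the other variable, which cancels in
    [circ]. With primitives in place of contour integrals, Goursat's argument needs nothing but the
    mean value estimate. *)
Definition line_primitives W A B (x1 x2 y1 y2 : R) :=
  forall x y, x1 <= x <= x2 -> y1 <= y <= y2 ->
    rderiv (A ^~ y) x (W (x +i* y)) /\ rderiv (B x) y (ci * W (x +i* y)).

Lemma circ_le W A B x1 x2 y1 y2 K : x1 <= x2 -> y1 <= y2 ->
  line_primitives W A B x1 x2 y1 y2 ->
  (forall x y, x1 <= x <= x2 -> y1 <= y <= y2 -> nc (W (x +i* y)) <= K) ->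
  nc (circ A B x1 x2 y1 y2) <= 4 * K * ((x2 - x1) + (y2 - y1)).
Proof.
move=> x12 y12 AB WK.
have HA y : y1 <= y <= y2 -> nc (A x2 y - A x1 y) <= 2 * K * (x2 - x1).
  move=> yy; apply: (@rMVT _ (A ^~ y) (fun x => W (x +i* y))) => // x xx.
    exact: (AB _ _ xx yy).1.
  exact: WK.
have HB x : x1 <= x <= x2 -> nc (B x y2 - B x y1) <= 2 * K * (y2 - y1).
  move=> xx; apply: (@rMVT _ (B x) (fun y => ci * W (x +i* y))) => // y yy.
    exact: (AB _ _ xx yy).2.
  by rewrite nc_iM; exact: WK.
rewrite /circ.
have -> : 4 * K * (x2 - x1 + (y2 - y1)) = 2 * K * (x2 - x1) + 2 * K * (y2 - y1)
   + 2 * K * (x2 - x1) + 2 * K * (y2 - y1) by ring.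
apply: le_trans (ncB _ _) _; apply: lerD; last by apply: HB; rewrite lexx.
apply: le_trans (ncB _ _) _; apply: lerD; last by apply: HA; rewrite lexx andbT.
apply: le_trans (ncD _ _) _; apply: lerD; first by apply: HA; rewrite lexx.
by apply: HB; rewrite lexx andbT.
Qed.

Lemma line_primitivesW W A B x1 x2 y1 y2 x1' x2' y1' y2' :
  x1 <= x1' -> x2' <= x2 -> y1 <= y1' -> y2' <= y2 ->
  line_primitives W A B x1 x2 y1 y2 -> line_primitives W A B x1' x2' y1' y2'.
Proof.
move=> h1 h2 h3 h4 H x y /andP[a b] /andP[c d]; apply: H.
  by rewrite (le_trans h1 a) (le_trans b h2).
by rewrite (le_trans h3 c) (le_trans d h4).
Qed.

(** The first-order Taylor polynomial of [W] at the point has the quadratic primitive [q], whose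
    circulation vanishes. What is left of [W] is at most [e / 4] times the size of the rectangle,
    and [circ_le] contributes the factor 4 and the size once more. *)
Lemma circ_local W A B x1 x2 y1 y2 x0 y0 e : 0 < e ->
  line_primitives W A B x1 x2 y1 y2 -> (exists l, cderiv W (x0 +i* y0) l) ->
  exists2 d, 0 < d & forall x1' x2' y1' y2',
    x1 <= x1' <= x0 -> x0 <= x2' <= x2 -> y1 <= y1' <= y0 -> y0 <= y2' <= y2 ->
    (x2' - x1') + (y2' - y1') < d ->
    nc (circ A B x1' x2' y1' y2') <= e * ((x2' - x1') + (y2' - y1')) ^+ 2.
Proof.
move=> e0 AB [l Wl].
have e4 : 0 < e / 4 by rewrite divr_gt0.
have [d d0 Hd] := Wl _ e4; exists d => // x1' x2' y1' y2'.
move=> /andP[x11 x10] /andP[x02 x22] /andP[y11 y10] /andP[y02 y22].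
set S := _ + _ => Sd.
set z0 := x0 +i* y0 in Wl Hd.
have dq z : cderiv (fun w => (W z0 - l * z0) * w + l / 2 * (w * w)) z (W z0 + l * (z - z0)).
  have -> : W z0 + l * (z - z0) = (W z0 - l * z0) * 1 + l / 2 * (1 * z + z * 1).
    by field.
  by apply: cderivD; [apply: cderivMl; exact: cderiv_id|apply: cderivMl; apply: cderivM; exact: cderiv_id].
pose q x y := (W z0 - l * z0) * (x +i* y) + l / 2 * ((x +i* y) * (x +i* y)).
have -> : circ A B x1' x2' y1' y2' =
  circ (fun x y => A x y - q x y) (fun x y => B x y - q x y) x1' x2' y1' y2'.
  by rewrite /circ; ring.
have -> : e * S ^+ 2 = 4 * (e / 4 * S) * S by field.
apply: (@circ_le (fun z => W z - (W z0 + l * (z - z0)))).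
- exact: le_trans x10 x02.
- exact: le_trans y10 y02.
- have {}AB := line_primitivesW x11 x22 y11 y22 AB.
  move=> x y xx yy; have [H1 H2] := AB x y xx yy; split.
    by apply: rderivB => //; exact: (cderiv_x (dq (x +i* y))).
  by rewrite mulrBr; apply: rderivB => //; exact: (cderiv_y (dq (x +i* y))).
- move=> x y /andP[ax xb] /andP[cy yd].
  have zS : nc ((x +i* y) - z0) <= S.
    rewrite (le_trans (nc_le_ReIm _))//= /S lerD// ler_norml.
      by rewrite lerNl opprB; apply/andP; split; lra.
    by rewrite lerNl opprB; apply/andP; split; lra.
  have := Hd ((x +i* y) - z0) (le_lt_trans zS Sd).
  rewrite [z0 + _]addrC subrK -[_ - _ - _]addrA -opprD => /le_trans; apply.
  by rewrite ler_wpM2l// ltW.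
Qed.

Lemma circ_split4 A B x1 xm x2 y1 ym y2 :
  circ A B x1 x2 y1 y2 = circ A B x1 xm y1 ym + circ A B xm x2 y1 ym
                       + circ A B x1 xm ym y2 + circ A B xm x2 ym y2.
Proof. rewrite /circ; ring. Qed.

Lemma ncD4 (a b c d : R[i]) : nc (a + b + c + d) <= nc a + nc b + nc c + nc d.
Proof.
by rewrite (le_trans (ncD _ _))// lerD2r (le_trans (ncD _ _))// lerD2r ncD.
Qed.

(** Repeated quartering: the circulation is additive and one quarter always keeps its share relative
    to the squared size. The nested rectangles shrink to a point where [circ_local] contradicts
    this. *)
Lemma goursat W A B x1 x2 y1 y2 : x1 <= x2 -> y1 <= y2 ->
  line_primitives W A B x1 x2 y1 y2 ->
  (forall x y, x1 <= x <= x2 -> y1 <= y <= y2 -> exists l, cderiv W (x +i* y) l) ->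
  circ A B x1 x2 y1 y2 = 0.
Proof.
move=> x12 y12 AB dW; apply/eqP/negPn/negP; rewrite -nc_gt0.
set c := nc _ => c0.
pose X := x2 - x1; pose Y := y2 - y1; pose S := X + Y.
have X0 : 0 <= X by rewrite subr_ge0.
have Y0 : 0 <= Y by rewrite subr_ge0.
have S0 : 0 < S.
  rewrite lt_neqAle addr_ge0// andbT eq_sym; apply/negP; rewrite paddr_eq0// !subr_eq0.
  by move=> /andP[/eqP ex /eqP ey]; move: c0; rewrite /c ex ey /circ !(subrr, subr0, addr0) Normc.normc0 ltxx.
(* With this [e] the threshold for the whole rectangle is [c / 2], so the rectangle is [Bad] at the
   start. *)
pose e := c / S ^+ 2 / 2.
have e0 : 0 < e by rewrite !divr_gt0// exprn_gt0.
pose h n : R := 2^-1 ^+ n.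
have h0 n : 0 < h n by rewrite exprn_gt0.
have hS n : h n = h n.+1 + h n.+1 by rewrite /h exprS; field.
pose Bad (s : nat * (R * R)) := let: (n, (x, y)) := s in
  [/\ x1 <= x, x + X * h n <= x2, y1 <= y, y + Y * h n <= y2 &
   e * (S * h n) ^+ 2 < nc (circ A B x (x + X * h n) y (y + Y * h n))].
(* The premise [Bad s] makes the relation total, as dependent choice demands; along the chosen
   sequence the premise always holds. *)
pose Link (s s' : nat * (R * R)) := Bad s -> [/\ Bad s', s'.1 = s.1.+1,
  s.2.1 <= s'.2.1, s'.2.1 + X * h s'.1 <= s.2.1 + X * h s.1 &
  s.2.2 <= s'.2.2 /\ s'.2.2 + Y * h s'.1 <= s.2.2 + Y * h s.1].
have HL s : exists s', Link s s'.
  case: (pselect (Bad s)) => [|nB]; last by exists s => /nB.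
  case: s => n [x y] [a1 a2 b1 b2 bad].
  set u := X * h n.+1; set v := Y * h n.+1.
  have u0 : 0 <= u by rewrite mulr_ge0// ltW.
  have v0 : 0 <= v by rewrite mulr_ge0// ltW.
  have un : x + X * h n = x + u + u by rewrite hS mulrDr addrA.
  have vn : y + Y * h n = y + v + v by rewrite hS mulrDr addrA.
  rewrite un in a2 bad; rewrite vn in b2 bad.
  have key x' y' : x <= x' <= x + u -> y <= y' <= y + v ->
     e * (S * h n.+1) ^+ 2 < nc (circ A B x' (x' + u) y' (y' + v)) ->
     exists s', Link (n, (x, y)) s'.
    move=> /andP[xx' xx''] /andP[yy' yy''] H; exists (n.+1, (x', y')) => _; rewrite /= -/u -/v un vn.
    by split => //; [split => //|..|split]; lra.
  case: (ltP (e * (S * h n.+1) ^+ 2) (nc (circ A B x (x + u) y (y + v)))) => [|H1].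
    by apply: key; apply/andP; split; lra.
  case: (ltP (e * (S * h n.+1) ^+ 2) (nc (circ A B (x + u) (x + u + u) y (y + v)))) => [|H2].
    by apply: key; apply/andP; split; lra.
  case: (ltP (e * (S * h n.+1) ^+ 2) (nc (circ A B x (x + u) (y + v) (y + v + v)))) => [|H3].
    by apply: key; apply/andP; split; lra.
  case: (ltP (e * (S * h n.+1) ^+ 2) (nc (circ A B (x + u) (x + u + u) (y + v) (y + v + v)))) => [|H4].
    by apply: key; apply/andP; split; lra.
  (* Four quarters below the threshold [e * (S * h n.+1) ^+ 2] add up to at most
     [e * (S * h n) ^+ 2], because halving the sides divides the threshold by four. *)
  exfalso; move: bad; rewrite (circ_split4 A B x (x + u) (x + u + u) y (y + v) (y + v + v)).
  rewrite ltNge => /negP; apply.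
  apply: le_trans (ncD4 _ _ _ _) _.
  apply: le_trans (lerD (lerD (lerD H1 H2) H3) H4) _; rewrite (hS n).
  by rewrite le_eqVlt; apply/orP; left; apply/eqP; ring.
have [s [s0 Hs]] := @dependent_choice _ _ (fun s => cid (HL s)) (0%N, (x1, y1)).
have bad0 : Bad (s 0%N).
  rewrite s0 /Bad /h expr0 !mulr1 /X /Y [x1 + _]addrC [y1 + _]addrC !subrK; split=> //.
  rewrite -/c /e; rewrite (_ : _ * S ^+ 2 = c / 2); last by field; rewrite gt_eqF.
  by rewrite ltr_pdivrMr// ltr_pMr// ltr1n.
have bad n : Bad (s n).
  by elim: n => // n /Hs[].
have s1 n : (s n).1 = n.
  by elim: n => [|n IH]; [rewrite s0|have [_ -> _ _ _] := Hs n (bad n); rewrite IH].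
pose x_ n := (s n).2.1; pose y_ n := (s n).2.2.
have badE n : Bad (n, (x_ n, y_ n)).
  by have := bad n; rewrite -[in n in Bad (n, _)](s1 n) /x_ /y_; case: (s n) => m [].
have linkE n : [/\ x_ n <= x_ n.+1, x_ n.+1 + X * h n.+1 <= x_ n + X * h n,
   y_ n <= y_ n.+1 & y_ n.+1 + Y * h n.+1 <= y_ n + Y * h n].
  by have [_ _] := Hs n (bad n); rewrite !s1 => H1 H2 [H3 H4].
have nested (x : nat -> R) (Z : R) : 0 <= Z -> (forall n, x n <= x n.+1) ->
   (forall n, x n.+1 + Z * h n.+1 <= x n + Z * h n) ->
   exists x0, forall n, x n <= x0 <= x n + Z * h n.
  move=> Z0 inc dec.
  have incS n k : x n <= x (n + k)%N.
    by elim: k => [|k IH]; rewrite ?addn0// addnS (le_trans IH).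
  have decS n k : x (n + k)%N + Z * h (n + k)%N <= x n + Z * h n.
    by elim: k => [|k IH]; rewrite ?addn0// addnS (le_trans (dec _)).
  have ub n m : x m <= x n + Z * h n.
    have [nm|/ltnW mn] := leqP n m.
      rewrite -(subnKC nm); apply: le_trans (decS n (m - n)%N).
      by rewrite lerDl mulr_ge0// ltW.
    rewrite -(subnKC mn) (le_trans (incS m (n - m)%N))//.
    by rewrite lerDl mulr_ge0// ltW.
  exists (sup (range x)) => n; apply/andP; split.
    apply: ub_le_sup; last by exists n.
    by exists (x n + Z * h n) => _ [m _ <-].
  apply: ge_sup; first by exists (x 0%N); exists 0%N.
  by move=> _ [m _ <-].
have [x0 Hx0] := nested x_ X X0 (fun n => let: And4 a _ _ _ := linkE n in a)
  (fun n => let: And4 _ a _ _ := linkE n in a).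
have [y0 Hy0] := nested y_ Y Y0 (fun n => let: And4 _ _ a _ := linkE n in a)
  (fun n => let: And4 _ _ _ a := linkE n in a).
have [|d d0 Hd] := @circ_local W A B x1 x2 y1 y2 x0 y0 e e0 AB.
  have [[a1 a2 b1 b2 _] /andP[c1 c2] /andP[d1 d2]] := And3 (badE 0%N) (Hx0 0%N) (Hy0 0%N).
  by apply: dW; apply/andP; split; lra.
have [n Hn] : exists n, S * h n < d.
  have := @cvg_geometric R S (2^-1); rewrite ger0_norm// invf_lt1// ltr1n => /(_ isT).
  move/cvgrPdist_lt => /(_ d d0) [n _ /(_ n (leqnn _))].
  rewrite sub0r normrN ger0_norm ?mulr_ge0 ?exprn_ge0 ?(ltW S0)// => H.
  by exists n.
have [a1 a2 b1 b2 H] := badE n.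
have := Hd (x_ n) (x_ n + X * h n) (y_ n) (y_ n + Y * h n).
have [/andP[c1 c2] /andP[d1 d2]] := conj (Hx0 n) (Hy0 n).
rewrite a1 a2 b1 b2 c1 c2 d1 d2 => /(_ isT isT isT isT).
rewrite [x_ n + _]addrC [y_ n + _]addrC !addrK -mulrDl -/S => /(_ Hn).
by rewrite [_ + x_ n]addrC [_ + y_ n]addrC leNgt H.
Qed.

End Goursat.

(** * Integrals of complex functions over the real line *)

Section Integrals.
Variable R : realType.
Local Open Scope complex_scope.
Notation mu := (@lebesgue_measure R).
Notation "'rintegrable' f" := (mu.-integrable [set: R] (EFin \o f)) (at level 10, f at level 9).

Lemma rintegrable_le (f g : R -> R) : measurable_fun [set: R] f ->
  (forall x, `|f x| <= g x) -> rintegrable g -> rintegrable f.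
Proof.
move=> mf fg ig; apply: (le_integrable (measurableT) _ _ ig).
  exact/measurable_EFinP.
by move=> x _ /=; rewrite lee_fin (le_trans (fg x))// ler_norm.
Qed.

Lemma eq_rintegrable (f g : R -> R) : f =1 g -> rintegrable f -> rintegrable g.
Proof. by move=> /funext ->. Qed.

Lemma rintegrableD (f g : R -> R) : rintegrable f -> rintegrable g ->
  rintegrable (fun x => f x + g x).
Proof. exact: integrableD. Qed.

Lemma rintegrableB (f g : R -> R) : rintegrable f -> rintegrable g ->
  rintegrable (fun x => f x - g x).
Proof. exact: integrableB. Qed.

Lemma rintegrableZ (f : R -> R) k : rintegrable f -> rintegrable (fun x => k * f x).
Proof. exact: integrableZl. Qed.

Lemma rintegrable_measurable (f : R -> R) : rintegrable f -> measurable_fun [set: R] f.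
Proof. by move=> /integrableP[/measurable_EFinP]. Qed.

Lemma le_rint (f g : R -> R) : rintegrable f -> rintegrable g ->
  (forall x, f x <= g x) -> \int[mu]_x f x <= \int[mu]_x g x.
Proof. by move=> *; exact: le_Rintegral. Qed.

Lemma rintegral_EFin (f : R -> R) : rintegrable f ->
  (\int[mu]_x (f x)%:E)%E = (\int[mu]_x f x)%:E.
Proof. by move=> rf; rewrite /Rintegral fineK//; exact: integrable_fin_num. Qed.

Implicit Types (f g : R -> R[i]).

Definition cintegrable (f : R -> R[i]) :=
  rintegrable (fun x => complex.Re (f x)) /\ rintegrable (fun x => complex.Im (f x)).

Lemma cintegrable_le (f : R -> R[i]) (g : R -> R) : cmeasurable f ->
  (forall x, nc (f x) <= g x) -> rintegrable g -> cintegrable f.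
Proof.
move=> [mf1 mf2] fg ig; split; apply: rintegrable_le ig => // x.
  exact: le_trans (Re_le_nc _) (fg x).
exact: le_trans (Im_le_nc _) (fg x).
Qed.

Lemma cmeasurable_nc f : cmeasurable f -> measurable_fun [set: R] (fun x => nc (f x)).
Proof.
move=> [m1 m2].
have -> : (fun x => nc (f x)) =
  (fun x => Num.sqrt (complex.Re (f x) ^+ 2 + complex.Im (f x) ^+ 2)).
  by apply/funext => x; case: (f x).
apply: measurableT_comp; first exact: continuous_measurable_fun (@sqrt_continuous R).
by apply: measurable_funD; exact: measurable_funX.
Qed.

Lemma cintegrable_nc f : cintegrable f -> rintegrable (fun x => nc (f x)).
Proof.
move=> [f1 f2].
apply: (@rintegrable_le _ (fun x => `|complex.Re (f x)| + `|complex.Im (f x)|)).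
- by apply: cmeasurable_nc; split; exact: rintegrable_measurable.
- by move=> x; rewrite ger0_norm ?nc_ge0// nc_le_ReIm.
- by apply: rintegrableD; exact: (integrable_norm).
Qed.

Lemma Re_mul (z w : R[i]) : complex.Re (z * w) = complex.Re z * complex.Re w - complex.Im z * complex.Im w.
Proof. by case: z w => [a b] [c d]. Qed.
Lemma Im_mul (z w : R[i]) : complex.Im (z * w) = complex.Re z * complex.Im w + complex.Im z * complex.Re w.
Proof. by case: z w => [a b] [c d]. Qed.

Lemma cmeasurableM f g : cmeasurable f -> cmeasurable g -> cmeasurable (fun x => f x * g x).
Proof.
move=> [f1 f2] [g1 g2]; split.
  by under eq_fun do rewrite Re_mul; apply: measurable_funB; exact: measurable_funM.
by under eq_fun do rewrite Im_mul; apply: measurable_funD; exact: measurable_funM.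
Qed.

Lemma cmeasurable_cst (c : R[i]) : cmeasurable (fun _ : R => c).
Proof. by split; exact: measurable_cst. Qed.

Lemma rcont_measurable f : (forall x, rcont f x) -> cmeasurable f.
Proof.
by move=> cf; split; apply: continuous_measurable_fun => x; [exact: (cf x).1|exact: (cf x).2].
Qed.

Lemma cintegrableB f g : cintegrable f -> cintegrable g -> cintegrable (fun x => f x - g x).
Proof.
move=> [f1 f2] [g1 g2]; split.
  by apply: (eq_rintegrable (fun x => esym (Re_sub (f x) (g x)))); exact: rintegrableB.
by apply: (eq_rintegrable (fun x => esym (Im_sub (f x) (g x)))); exact: rintegrableB.
Qed.

Lemma cintegrableZ c f : cintegrable f -> cintegrable (fun x => c * f x).
Proof.
move=> [f1 f2]; split.
  apply: (eq_rintegrable (fun x => esym (Re_mul c (f x)))).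
  by apply: rintegrableB; exact: rintegrableZ.
apply: (eq_rintegrable (fun x => esym (Im_mul c (f x)))).
by apply: rintegrableD; exact: rintegrableZ.
Qed.

Lemma cintegralB f g : cintegrable f -> cintegrable g ->
  cintegral (fun x => f x - g x) = cintegral f - cintegral g.
Proof.
move=> [f1 f2] [g1 g2]; apply: complex_eqE; rewrite ?Re_sub ?Im_sub /=.
  by under eq_Rintegral do rewrite Re_sub; exact: RintegralB.
by under eq_Rintegral do rewrite Im_sub; exact: RintegralB.
Qed.

Lemma cintegralZ c f : cintegrable f ->
  cintegral (fun x => c * f x) = c * cintegral f.
Proof.
move=> [f1 f2]; apply: complex_eqE; rewrite ?Re_mul ?Im_mul /=.
  under eq_Rintegral do rewrite Re_mul.
  by rewrite RintegralB ?RintegralZl//; exact: rintegrableZ.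
under eq_Rintegral do rewrite Im_mul.
by rewrite RintegralD ?RintegralZl//; exact: rintegrableZ.
Qed.

Lemma nc_cintegral f : cintegrable f -> nc (cintegral f) <= \int[mu]_x nc (f x).
Proof.
move=> cf; have [I EI] : exists I, cintegral f = I by exists (cintegral f).
rewrite EI.
have [->|I0] := eqVneq I 0.
  by rewrite Normc.normc0; apply: Rintegral_ge0 => x _; exact: nc_ge0.
have n0 : 0 < nc I by rewrite nc_gt0.
(* The conjugate phase of the integral [I]: multiplication by [u] makes the integral the nonnegative
   real [nc I], which is then the integral of a real part. *)
pose u : R[i] := (complex.Re I / nc I) +i* (- (complex.Im I / nc I)).
have uI : u * I = (nc I)%:C.
  have E : complex.Re I ^+ 2 + complex.Im I ^+ 2 = nc I ^+ 2.
    by case: (I) => a b /=; rewrite sqr_sqrtr// addr_ge0// sqr_ge0.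
  apply: complex_eqE; rewrite ?Re_mul ?Im_mul /=; last by field; rewrite gt_eqF.
  transitivity ((complex.Re I ^+ 2 + complex.Im I ^+ 2) / nc I).
    by field; rewrite gt_eqF.
  by rewrite E; field; rewrite gt_eqF.
have nu : nc u = 1.
  apply: (mulIf (_ : nc I != 0)); first by rewrite gt_eqF.
  by rewrite -ncM uI nc_real ger0_norm ?mul1r// ltW.
have -> : nc I = \int[mu]_x complex.Re (u * f x).
  rewrite -[RHS]/(complex.Re (cintegral (fun x => u * f x))) cintegralZ//.
  by rewrite EI uI.
apply: le_rint.
- exact: (cintegrableZ u cf).1.
- exact: cintegrable_nc.
- move=> x; rewrite (le_trans (ler_norm _))// (le_trans (Re_le_nc _))//.
  by rewrite ncM nu mul1r.
Qed.

Lemma eq_cintegral f g : f =1 g -> cintegral f = cintegral g.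
Proof. by move=> /funext ->. Qed.

Lemma eq_cintegrable f g : f =1 g -> cintegrable f -> cintegrable g.
Proof. by move=> /funext ->. Qed.

(** The integrand cut off to the interval from [- n] to [n] is dominated by its own absolute value.
    This turns primitives, the currency of [goursat], into integrals over the whole line. *)
Lemma rline_cvg (f F : R -> R) : continuous f -> rintegrable f ->
  (forall x : R, is_derive x 1 F (f x)) ->
  (fun n => F n%:R - F (- n%:R)) @ \oo --> \int[mu]_x f x.
Proof.
move=> cf intf dF.
have E n : (0 < n)%N -> (\int[mu]_(x in `[(- n%:R)%R : R, n%:R%R]) (f x)%:E =
   (F n%:R - F (- n%:R))%:E)%E.
  move=> n0; have n0' : (0 : R) < n%:R by rewrite ltr0n.
  rewrite (@continuous_FTC2 _ f F (- n%:R) n%:R) ?EFinB//.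
  - by lra.
  - exact: continuous_subspaceT.
  - have cF x : {for x, continuous F}.
      by apply: differentiable_continuous; apply/derivable1_diffP; have [] := dF x.
    split.
    + by move=> x _; have [] := dF x.
    + by apply: cvg_at_right_filter; exact: cF.
    + by apply: cvg_at_left_filter; exact: cF.
  - by move=> x _; rewrite derive1E (@derive_val _ _ _ _ _ _ _ (dF x)).
have mf := rintegrable_measurable intf.
pose f_ n := (EFin \o f) \_ `[- n%:R, n%:R : R].
have cv : (\int[mu]_x f_ n x)%E @[n --> \oo] --> (\int[mu]_x (f x)%:E)%E.
  apply: (@dominated_cvg _ _ _ mu setT measurableT f_ _ (fun x => `|(f x)%:E|%E)).
  - move=> n; apply: (measurable_restrictT _ (measurable_itv _)).1.
    by apply: measurable_funTS; exact: (measurable_int _ intf).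
  - move=> x _; apply: cvg_near_cst.
    near=> n; rewrite /f_ patchE mem_set//= in_itv/= -ler_norml.
    by near: n; exact: nbhs_infty_ger.
  - by move=> x _.
  - exact: integrable_abse.
  - move=> n x _; rewrite /f_ patchE; case: ifPn => // _.
    by rewrite abse0 abse_ge0.
rewrite (rintegral_EFin intf) in cv.
move/fine_cvgP : cv => [_]; apply: cvg_trans; apply: near_eq_cvg.
near=> n => /=; rewrite /f_ -integral_mkcond E//.
by near: n; exact: nbhs_infty_gt.
Unshelve. all: by end_near. Qed.

Lemma cline_cvg f F : (forall x, rcont f x) -> cintegrable f ->
  (forall x, rderiv F x (f x)) -> forall e, 0 < e -> exists N : nat,
  forall n, (N <= n)%N -> nc (F n%:R - F (- n%:R) - cintegral f) <= e.
Proof.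
move=> cf [f1 f2] dF e e0.
have e2 : 0 < e / 2 by rewrite divr_gt0.
have := @rline_cvg _ _ (fun x => (cf x).1) f1 (fun x => (dF x).1).
move=> /cvgrPdist_le /(_ _ e2)[N1 _ H1].
have := @rline_cvg _ _ (fun x => (cf x).2) f2 (fun x => (dF x).2).
move=> /cvgrPdist_le /(_ _ e2)[N2 _ H2].
exists (maxn N1 N2) => n; rewrite geq_max => /andP[/H1 {}H1 /H2 {}H2].
rewrite (le_trans (nc_le_ReIm _))// !Re_sub !Im_sub [e]splitr distrC lerD//.
by rewrite distrC.
Qed.

End Integrals.

Section GoursatExcept.
Variable R : realType.
Local Open Scope complex_scope.
Implicit Types (A B : R -> R -> R[i]) (W : R[i] -> R[i]).

(** Handles at once a point [c] inside the interval, at its ends or outside: the outer pieces are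
    degenerate or stop short of [c], and the middle piece is degenerate or close to [c]. *)
Lemma clamp_props (a b c d : R) : a <= b -> 0 < d ->
  let lo := clamp a b (c - d) in let hi := clamp a b (c + d) in
  [/\ a <= lo, lo <= hi, hi <= b &
   [/\ lo = a \/ lo <= c - d, hi = b \/ c + d <= hi & lo = hi \/ c - d <= lo /\ hi <= c + d]].
Proof.
move=> ab d0 lo hi; rewrite /lo /hi /clamp.
by have [?|?] := leP b (c - d); have [?|?] := leP b (c + d);
  repeat match goal with |- context [Num.max ?u ?v] => have [?|?] := leP u v end;
  split; try lra; split; try lra; try (left; lra); right; lra.
Qed.

Lemma circ_deg A B x1 x2 y1 y2 : x1 = x2 \/ y1 = y2 -> circ A B x1 x2 y1 y2 = 0.
Proof. by rewrite /circ; case=> ->; ring. Qed.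

Lemma circ_split3x A B x1 u v x2 y1 y2 : circ A B x1 x2 y1 y2 =
  circ A B x1 u y1 y2 + circ A B u v y1 y2 + circ A B v x2 y1 y2.
Proof. rewrite /circ; ring. Qed.

Lemma circ_split3y A B x1 x2 y1 u v y2 : circ A B x1 x2 y1 y2 =
  circ A B x1 x2 y1 u + circ A B x1 x2 u v + circ A B x1 x2 v y2.
Proof. rewrite /circ; ring. Qed.

(** Continuity bounds [W] near the exceptional point, so the circulation around a square shrinking
    to that point tends to 0. This takes the place of the removable singularity theorem. *)
Lemma goursat_except W A B x1 x2 y1 y2 x0 y0 : x1 <= x2 -> y1 <= y2 ->
  line_primitives W A B x1 x2 y1 y2 -> ccont W (x0 +i* y0) ->
  (forall x y, x1 <= x <= x2 -> y1 <= y <= y2 -> x +i* y <> x0 +i* y0 ->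
    exists l, cderiv W (x +i* y) l) ->
  circ A B x1 x2 y1 y2 = 0.
Proof.
move=> x12 y12 AB cW dW; apply/eqP; rewrite -nc_eq0 eq_le nc_ge0 andbT.
have [d d0 Hd] := cW 1 ltr01.
pose K := nc (W (x0 +i* y0)) + 1.
have K0 : 0 < K by rewrite ltr_wpDl ?nc_ge0.
have sub0 a b a' b' : x1 <= a -> a <= b -> b <= x2 -> y1 <= a' -> a' <= b' -> b' <= y2 ->
    (a < b -> a' < b' -> [\/ b < x0, x0 < a, b' < y0 | y0 < a']) -> circ A B a b a' b' = 0.
  move=> h1 h2 h3 h4 h5 h6 H.
  move: h2; rewrite le_eqVlt => /orP[/eqP ab|ab]; first by apply: circ_deg; left.
  move: h5; rewrite le_eqVlt => /orP[/eqP ab'|ab']; first by apply: circ_deg; right.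
  apply: (@goursat _ W); [exact: ltW|exact: ltW|exact: line_primitivesW AB|].
  move=> x y /andP[ax xb] /andP[ay yb]; apply: dW.
  - by rewrite (le_trans h1 ax) (le_trans xb h3).
  - by rewrite (le_trans h4 ay) (le_trans yb h6).
  - by case=> ex ey; case: (H ab ab') => ?; lra.
(* Four surrounding rectangles miss the point and have zero circulation. In the middle one [W] is
   bounded by [K] and the two sides add up to at most [4 * t]. *)
suff key t : 0 < t -> 2 * t < d -> nc (circ A B x1 x2 y1 y2) <= 16 * K * t.
  rewrite leNgt; apply/negP => c0.
  set c := nc _ in c0 key.
  pose t := Num.min (d / 3) (c / (32 * K)).
  have t0 : 0 < t by rewrite lt_min !divr_gt0// mulr_gt0.
  have td : 2 * t < d.
    have : t <= d / 3 by rewrite ge_min lexx.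
    by lra.
  have tc : t <= c / (32 * K) by rewrite ge_min lexx orbT.
  have := key t t0 td.
  move: tc; rewrite ler_pdivlMr ?mulr_gt0// => tc.
  by lra.
move=> t0 td.
have [lox xx hix [Hx1 Hx2 Hx3]] := clamp_props x0 x12 t0.
have [loy yy hiy [Hy1 Hy2 Hy3]] := clamp_props y0 y12 t0.
set u := clamp x1 x2 (x0 - t) in lox xx Hx1 Hx3.
set v := clamp x1 x2 (x0 + t) in hix xx Hx2 Hx3.
set u' := clamp y1 y2 (y0 - t) in loy yy Hy1 Hy3.
set v' := clamp y1 y2 (y0 + t) in hiy yy Hy2 Hy3.
rewrite (circ_split3y A B x1 x2 y1 u' v' y2) (circ_split3x A B x1 u v x2 u' v').
have -> : circ A B x1 x2 y1 u' = 0.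
  apply: sub0 => //; first by rewrite (le_trans yy).
  by move=> _ ?; apply: Or43; case: Hy1; lra.
have -> : circ A B x1 x2 v' y2 = 0.
  apply: sub0 => //; first by rewrite (le_trans loy).
  by move=> _ ?; apply: Or44; case: Hy2; lra.
have -> : circ A B x1 u u' v' = 0.
  apply: sub0 => //; first by rewrite (le_trans xx).
  by move=> ? _; apply: Or41; case: Hx1; lra.
have -> : circ A B v x2 u' v' = 0.
  apply: sub0 => //; first by rewrite (le_trans lox).
  by move=> ? _; apply: Or42; case: Hx2; lra.
rewrite !(add0r, addr0).
case: Hx3 => [e|[Hx3 Hx4]]; first by rewrite circ_deg ?Normc.normc0 ?mulr_ge0 ?(ltW K0) ?(ltW t0)//; left.
case: Hy3 => [e|[Hy3 Hy4]]; first by rewrite circ_deg ?Normc.normc0 ?mulr_ge0 ?(ltW K0) ?(ltW t0)//; right.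
apply: (@le_trans _ _ (4 * K * ((v - u) + (v' - u')))).
  apply: (@circ_le _ W) => //; first exact: line_primitivesW AB.
  move=> x y /andP[ux xv] /andP[uy yv].
  have -> : W (x +i* y) = (W ((x0 +i* y0) + ((x - x0) +i* (y - y0))) - W (x0 +i* y0)) + W (x0 +i* y0).
    rewrite subrK; congr W; apply: complex_eqE => /=; ring.
  rewrite (le_trans (ncD _ _))// addrC lerD2l; apply: Hd.
  rewrite (le_lt_trans (nc_le_ReIm _))//=.
  have : `|x - x0| <= t by rewrite ler_norml; lra.
  have : `|y - y0| <= t by rewrite ler_norml; lra.
  by lra.
have -> : 16 * K * t = 4 * K * (4 * t) by ring.
by rewrite ler_wpM2l ?mulr_ge0 ?(ltW K0)//; lra.
Qed.

Lemma strip_lines W a b : a <= b ->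
  (forall x y, a <= y <= b -> ccont W (x +i* y)) ->
  exists A B, forall x y, a <= y <= b ->
   rderiv (A ^~ y) x (W (x +i* y)) /\ rderiv (B x) y (ci * W (x +i* y)).
Proof.
move=> ab cW.
have HA y : exists F : R -> R[i], a <= y <= b -> forall x, rderiv F x (W (x +i* y)).
  case: (boolP (a <= y <= b)) => yab; last by exists (fun=> 0).
  have c1 : continuous (fun t => complex.Re (W (t +i* y))).
    by move=> x; exact: (ccont_x (cW x y yab)).1.
  have c2 : continuous (fun t => complex.Im (W (t +i* y))).
    by move=> x; exact: (ccont_x (cW x y yab)).2.
  have [F1 HF1] := continuous_antiderivative c1.
  have [F2 HF2] := continuous_antiderivative c2.
  by exists (fun x => F1 x +i* F2 x) => _ x; split => /=.
have HB x : exists F : R -> R[i], forall y, a <= y <= b -> rderiv F y (ci * W (x +i* y)).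
  apply: rcont_antiderivative => // y yab.
  apply: (@ccont_y _ (fun z => ci * W z)) => e e0.
  have [d d0 Hd] := cW x y yab e e0; exists d => // w /Hd.
  by rewrite -mulrBr nc_iM.
have [A' HA'] := choice HA; have [B HB'] := choice HB.
exists (fun x y => A' y x), B => x y yab; split; last exact: HB'.
exact: HA'.
Qed.

Lemma rderiv_local (f g : R -> R[i]) (x : R) l (d : R) : 0 < d ->
  (forall y, `|y - x| < d -> f y = g y) -> rderiv f x l -> rderiv g x l.
Proof.
move=> d0 fg [f1 f2]; split.
  by apply: (is_derive_local d0 _ f1) => y yd; rewrite fg.
by apply: (is_derive_local d0 _ f2) => y yd; rewrite fg.
Qed.

(** By Goursat [A - B] is a function of [x] plus a function of [y]. Removing the part that depends
    on [y] from [A] leaves a function [U] that differs from [B] by a function of [x] alone, hence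
    has both partial derivatives required by [partial_cderiv]. *)
Lemma strip_primitive W a b x0 y0 : a < b ->
  (forall x y, a <= y <= b -> ccont W (x +i* y)) ->
  (forall x y, a <= y <= b -> x +i* y <> x0 +i* y0 -> exists l, cderiv W (x +i* y) l) ->
  a <= y0 <= b ->
  exists H, forall x y, a < y < b -> cderiv H (x +i* y) (W (x +i* y)).
Proof.
move=> ab cW dW y0ab.
have [A [B AB]] := strip_lines (ltW ab) cW.
pose E x y := A x y - B x y.
have E0 x1 x2 y1 y2 : x1 <= x2 -> y1 <= y2 -> a <= y1 -> y2 <= b ->
    E x2 y1 - E x1 y1 - E x2 y2 + E x1 y2 = 0.
  move=> x12 y12 ay1 y2b.
  have <- : circ A B x1 x2 y1 y2 = E x2 y1 - E x1 y1 - E x2 y2 + E x1 y2.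
    by rewrite /circ /E; ring.
  apply: (@goursat_except W _ _ _ _ _ _ x0 y0) => //.
  - move=> x y _ /andP[h1 h2]; apply: AB.
    by rewrite (le_trans ay1 h1) (le_trans h2 y2b).
  - exact: cW.
  - move=> x y _ /andP[h1 h2]; apply: dW.
    by rewrite (le_trans ay1 h1) (le_trans h2 y2b).
have Ea x y : a <= y <= b -> E x y - E 0 y = E x a - E 0 a.
  move=> /andP[ay yb]; have [x0'|/ltW x0'] := leP 0 x.
    have := E0 0 x a y x0' ay (lexx _) yb.
    move=> H; apply/eqP; rewrite -subr_eq0 -oppr_eq0 -H; apply/eqP; ring.
  have := E0 x 0 a y x0' ay (lexx _) yb.
  move=> H; apply/eqP; rewrite -subr_eq0 -H; apply/eqP; ring.
pose U x y := A x y - E 0 y.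
exists (fun z => U (complex.Re z) (complex.Im z)) => x y /andP[ay yb].
have dd : 0 < Num.min (y - a) (b - y) by rewrite lt_min !subr_gt0 ay.
apply: (@partial_cderiv _ (fun z => U (complex.Re z) (complex.Im z)) W x y _ dd); last first.
  by apply: cW; rewrite (ltW ay) (ltW yb).
move=> x' y' _; rewrite lt_min => /andP[].
rewrite ltr_norml => /andP[h1 _]; rewrite ltr_norml => /andP[_ h2].
have ay' : a < y' by lra.
have yb' : y' < b by lra.
have yab' : a <= y' <= b by rewrite (ltW ay') (ltW yb').
split => /=.
  rewrite /U -[W _]subr0; apply: rderivB; last exact: rderiv_cst.
  by have [] := AB x' y' yab'.
have dd' : 0 < Num.min (y' - a) (b - y') by rewrite lt_min !subr_gt0 ay'.
apply: (@rderiv_local (fun t => B x' t + (E x' a - E 0 a)) _ _ _ _ dd').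
  move=> t; rewrite lt_min => /andP[].
  rewrite ltr_norml => /andP[h3 _]; rewrite ltr_norml => /andP[_ h4].
  rewrite -(Ea x' t); last by apply/andP; split; lra.
  by rewrite /U /E; ring.
rewrite -[X in rderiv _ _ X]addr0; apply: rderivD; last exact: rderiv_cst.
by have [] := AB x' y' yab'.
Qed.

(* The hypothesis on [B] says that the vertical sides do not contribute. *)
Lemma line_integral_const W a b x0 y0 : a <= b ->
  (forall x y, a <= y <= b -> ccont W (x +i* y)) ->
  (forall x y, a <= y <= b -> x +i* y <> x0 +i* y0 -> exists l, cderiv W (x +i* y) l) ->
  ccont W (x0 +i* y0) ->
  cintegrable (fun x => W (x +i* a)) -> cintegrable (fun x => W (x +i* b)) ->
  (forall e : R, 0 < e -> exists X : R, forall x : R, X <= `|x| -> forall B : R -> R[i],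
    (forall y, a <= y <= b -> rderiv B y (ci * W (x +i* y))) -> nc (B b - B a) <= e) ->
  cintegral (fun x => W (x +i* a)) = cintegral (fun x => W (x +i* b)).
Proof.
move=> ab cW dW cW0 ia ib vert.
have [A [B AB]] := strip_lines ab cW.
have aab : a <= a <= b by rewrite lexx.
have bab : a <= b <= b by rewrite lexx andbT.
apply/eqP; rewrite -subr_eq0 -nc_eq0 eq_le nc_ge0 andbT.
rewrite leNgt; apply/negP; set Ia := cintegral _; set Ib := cintegral _ => c0.
set c := nc _ in c0.
have c5 : 0 < c / 5 by rewrite divr_gt0.
have [Na HNa] := @cline_cvg _ _ (A ^~ a) (fun x => ccont_x (cW x a aab)) ia (fun x => (AB x a aab).1) _ c5.
have [Nb HNb] := @cline_cvg _ _ (A ^~ b) (fun x => ccont_x (cW x b bab)) ib (fun x => (AB x b bab).1) _ c5.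
have [X HX] := vert _ c5.
pose n := maxn (maxn Na Nb) (Num.truncn X).+1.
have nX : X <= n%:R.
  rewrite (le_trans (ltW (truncnS_gt _)))// ler_nat leq_max leqnn orbT//.
have {}HNa : nc (A n%:R a - A (- n%:R) a - Ia) <= c / 5.
  by apply: HNa; rewrite !leq_max leqnn.
have {}HNb : nc (A n%:R b - A (- n%:R) b - Ib) <= c / 5.
  by apply: HNb; rewrite !leq_max leqnn orbT.
have V1 : nc (B n%:R b - B n%:R a) <= c / 5.
  by apply: (HX n%:R) => [|y /(AB n%:R)[]//]; rewrite normr_nat.
have V2 : nc (B (- n%:R) b - B (- n%:R) a) <= c / 5.
  by apply: (HX (- n%:R)) => [|y /(AB (- n%:R))[]//]; rewrite normrN normr_nat.
have : circ A B (- n%:R) n%:R a b = 0.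
  apply: (@goursat_except W _ _ _ _ _ _ x0 y0) => //.
  - by rewrite (@le_trans _ _ 0)// oppr_le0.
  - by move=> x y _ /AB.
  - by move=> x y _; exact: dW.
move=> H0.
have E : Ia - Ib = (B (- n%:R) b - B (- n%:R) a) - (B n%:R b - B n%:R a)
  - (A n%:R a - A (- n%:R) a - Ia) + (A n%:R b - A (- n%:R) b - Ib).
  apply/eqP; rewrite -subr_eq0 -[X in _ == X]H0 /circ; apply/eqP; ring.
have : c <= c / 5 + c / 5 + c / 5 + c / 5.
  rewrite {1}/c E; apply: le_trans (ncD4 _ _ _ _) _; rewrite !ncN !lerD//.
by lra.
Qed.

End GoursatExcept.

(** * The Poisson kernel *)

Section Kernel.
Variable R : realType.
Local Open Scope complex_scope.
Implicit Types (x y t : R) (z w : R[i]).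

Definition sinh t : R := (expR t - expR (- t)) / 2.

Lemma cosh_ge t : 1 + t ^+ 2 / 8 <= cosh t.
Proof.
wlog t0 : t / 0 <= t.
  move=> H; have [/H//|/ltW t0] := leP 0 t.
  by have := H (- t); rewrite sqrrN /cosh opprK [expR (- t) + _]addrC oppr_ge0; apply.
pose u := t / 2.
have u0 : 0 <= u by rewrite divr_ge0.
(* This is [cosh t - 1] as twice the square of [sinh (t / 2)]; the quadratic gap later keeps [D]
   away from 0 when [x] is away from 0. *)
have -> : cosh t = 1 + (expR u - expR (- u)) ^+ 2 / 2.
  have e1 : expR t = expR u ^+ 2 by rewrite -expRM_natl /u; congr expR; field.
  have e2 : expR (- t) = expR (- u) ^+ 2 by rewrite -expRM_natl /u; congr expR; field.
  have e3 : expR (- u) * expR u = 1 by rewrite -expRD addNr expR0.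
  rewrite /cosh e1 e2 sqrrB mulrC [expR u * _]mulrC e3; by field.
have h1 : 1 + u <= expR u by exact: expR_ge1Dx.
have h2 : expR (- u) <= 1 by rewrite -expR0 ler_expR oppr_le0.
have h3 : u <= expR u - expR (- u) by lra.
have -> : t ^+ 2 / 8 = u ^+ 2 / 2 by rewrite /u; field.
by rewrite lerD2l ler_wpM2r// ler_pXn2r// nnegrE// (le_trans u0).
Qed.

Lemma cosh_ge1 t : 1 <= cosh t.
Proof. by rewrite (le_trans _ (cosh_ge t))// lerDl divr_ge0// sqr_ge0. Qed.

Lemma cosh_gt0 t : 0 < cosh t.
Proof. exact: lt_le_trans ltr01 (cosh_ge1 t). Qed.

Lemma cosh_ge_exp t : expR `|t| / 2 <= cosh t.
Proof.
rewrite /cosh ler_wpM2r//; have [t0|t0] := leP 0 t.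
  by rewrite ger0_norm// lerDl expR_ge0.
by rewrite ltr0_norm// lerDr expR_ge0.
Qed.

Lemma cosh2 t : cosh t ^+ 2 = 1 + sinh t ^+ 2.
Proof.
rewrite /cosh /sinh.
have e3 : expR (- t) = (expR t)^-1 by rewrite expRN.
by rewrite e3; field; rewrite gt_eqF// expR_gt0.
Qed.

Definition ccosh z : R[i] := (cexp z + cexp (- z)) / 2.
Definition csinh z : R[i] := (cexp z - cexp (- z)) / 2.

Lemma half_real : (2^-1 : R[i]) = (2^-1 : R)%:C.
Proof. by rewrite fmorphV/= rmorph_nat. Qed.

Lemma ccoshE x y : ccosh (x +i* y) = (cosh x * cos y) +i* (sinh x * sin y).
Proof.
rewrite /ccosh /cosh /sinh /cexp/= cosN sinN half_real.
by apply: complex_eqE => /=; ring.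
Qed.

Lemma csinhE x y : csinh (x +i* y) = (sinh x * cos y) +i* (cosh x * sin y).
Proof.
rewrite /csinh /cosh /sinh /cexp/= cosN sinN half_real.
by apply: complex_eqE => /=; ring.
Qed.

Lemma nc_csinh x y : nc (csinh (x +i* y)) <= cosh x.
Proof.
rewrite csinhE /Normc.normc -[leRHS](ger0_norm (ltW (cosh_gt0 x))) -sqrtr_sqr ler_wsqrtr//.
rewrite [X in X + _]exprMn [X in _ + X]exprMn.
have := cosh2 x; have := cos2Dsin2 y; have := sqr_ge0 (cos y).
set a := cos y ^+ 2; set b := sin y ^+ 2; set C := cosh x ^+ 2; set S := sinh x ^+ 2.
move=> a0 ab ->; have -> : b = 1 - a by rewrite -ab; ring.
by rewrite -subr_ge0 (_ : _ - _ = a)//; ring.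
Qed.

Definition piC : R[i] := (pi : R)%:C.

Lemma piCM x y : piC * (x +i* y) = (pi * x) +i* (pi * y).
Proof. by apply: complex_eqE => /=; ring. Qed.

Lemma cderiv_pi z : cderiv (fun w => piC * w) z piC.
Proof. by have := cderivMl piC (cderiv_id z); rewrite mulr1. Qed.

Lemma cderiv_ccosh z : cderiv (fun w => ccosh (piC * w)) z (piC * csinh (piC * z)).
Proof.
rewrite /ccosh /csinh.
have d1 := cderiv_comp (cderiv_pi z) (cderiv_cexp (piC * z)).
have d2 := cderiv_comp (cderivN (cderiv_pi z)) (cderiv_cexp (- (piC * z))).
have := cderivM (cderivD d1 d2) (cderiv_cst (2^-1) z).
congr cderiv; ring.
Qed.

Lemma cderiv_csinh z : cderiv (fun w => csinh (piC * w)) z (piC * ccosh (piC * z)).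
Proof.
rewrite /ccosh /csinh.
have d1 := cderiv_comp (cderiv_pi z) (cderiv_cexp (piC * z)).
have d2 := cderiv_comp (cderivN (cderiv_pi z)) (cderiv_cexp (- (piC * z))).
have := cderivM (cderivB d1 d2) (cderiv_cst (2^-1) z).
congr cderiv; ring.
Qed.

Lemma cos_lt1 t : t != 0 -> `|t| < 2 * pi -> cos t < 1.
Proof.
move=> t0 tpi.
have -> : cos t = 1 - 2 * sin (`|t| / 2) ^+ 2.
  have -> : cos t = cos (`|t| / 2 + `|t| / 2) by rewrite -splitr cos_norm.
  rewrite cosD -!expr2 cos2sin2; ring.
have s0 : 0 < sin (`|t| / 2).
  by apply: sin_gt0_pi; rewrite divr_gt0 ?normr_gt0//=; lra.
have := exprn_gt0 2 s0; lra.
Qed.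

Variables (al : R) (Hal : 0 < al < 1).

Let al0 : 0 < al. Proof. by case/andP: Hal. Qed.
Let al1 : al < 1. Proof. by case/andP: Hal. Qed.

Definition sal : R := sin (pi * al).
Definition cal : R := cos (pi * al).

Lemma sal_gt0 : 0 < sal.
Proof. by apply: sin_gt0_pi; rewrite mulr_gt0 ?pi_gt0//= gtr_pMr ?pi_gt0. Qed.

Lemma cal2 : cal ^+ 2 + sal ^+ 2 = 1. Proof. exact: cos2Dsin2. Qed.

Lemma cal_lt1 : `|cal| < 1.
Proof.
rewrite -(@ltr_pXn2r _ 2)// ?nnegrE// expr1n real_normK ?num_real//.
have := cal2; have := exprn_gt0 2 sal_gt0; lra.
Qed.

Definition D z : R[i] := ccosh (piC * z) - cal%:C.

Lemma cderiv_D z : cderiv D z (piC * csinh (piC * z)).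
Proof.
have := cderivB (cderiv_ccosh z) (cderiv_cst cal%:C z).
by rewrite subr0.
Qed.

(** [D z] is twice the product of the hyperbolic sines of [pi * (z - i al) / 2] and
    [pi * (z + i al) / 2]; each factor on the right is twice the squared modulus of one of them.
    Only the first can vanish in the closed strip. *)
Lemma nc_D2 x y : nc (D (x +i* y)) ^+ 2 =
  (cosh (pi * x) - cos (pi * (y - al))) * (cosh (pi * x) - cos (pi * (y + al))).
Proof.
rewrite /D piCM ccoshE /= sqr_sqrtr ?addr_ge0 ?sqr_ge0//.
rewrite subr0 [pi * (y - al)]mulrBr [pi * (y + al)]mulrDr cosB cosD.
have e1 := cosh2 (pi * x).
have e2 : sin (pi * y) ^+ 2 = 1 - cos (pi * y) ^+ 2 by rewrite -(cos2Dsin2 (pi * y)); ring.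
have e3 : sal ^+ 2 = 1 - cal ^+ 2 by rewrite -cal2; ring.
have {}e1 : sinh (pi * x) ^+ 2 = cosh (pi * x) ^+ 2 - 1 by rewrite e1; ring.
rewrite [X in _ + X]exprMn e1 e2; move: e2 e3; rewrite /sal /cal.
set C := cosh _; set a := cos (pi * y); set b := sin (pi * y); set c := cos _; set s := sin _.
move=> e2 e3.
transitivity (C ^+ 2 - 2 * C * a * c + a ^+ 2 * c ^+ 2 - b ^+ 2 * s ^+ 2); last by ring.
rewrite e2 e3; ring.
Qed.

(** The zeros of [D] lie on the imaginary axis at heights [al + 2 k] and [- al + 2 k], so the range
    of [y] runs between the two neighbours of [zal]. It exceeds the closed strip, which leaves room
    for derivatives on the boundary lines. *)
Lemma D_neq0 x y : - al < y < 2 - al -> x +i* y <> 0 +i* al -> D (x +i* y) != 0.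
Proof.
move=> /andP[y1 y2] ne.
suff : nc (D (x +i* y)) ^+ 2 != 0 by rewrite sqrf_eq0 nc_eq0.
rewrite nc_D2.
have pi0 : 0 < pi :> R := pi_gt0 R.
have f2 : 0 < cosh (pi * x) - cos (pi * (y + al)).
  rewrite subr_gt0 (lt_le_trans _ (cosh_ge1 _))//; apply: cos_lt1.
    by rewrite mulf_neq0 ?gt_eqF//; lra.
  rewrite normrM gtr0_norm// [2 * pi]mulrC ltr_pM2l// ltr_norml; have := al0; have := al1; lra.
rewrite mulf_neq0 ?(gt_eqF f2)// gt_eqF// subr_gt0.
have [yal|yal] := eqVneq y al.
  rewrite yal subrr mulr0 cos0 (lt_le_trans _ (cosh_ge _))// ltrDl divr_gt0// exprn_even_gt0//=.
  rewrite mulf_neq0 ?(gt_eqF pi0)//; apply/eqP => x0; apply: ne.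
  by rewrite x0 yal.
rewrite (lt_le_trans _ (cosh_ge1 _))//; apply: cos_lt1.
  by rewrite mulf_neq0 ?(gt_eqF pi0)// subr_eq0.
rewrite normrM gtr0_norm// [2 * pi]mulrC ltr_pM2l// ltr_norml; have := al0; have := al1; lra.
Qed.

Lemma D_al : D (0 +i* al) = 0.
Proof.
rewrite /D piCM ccoshE mulr0; apply: complex_eqE => /=.
  by rewrite /cosh oppr0 expR0; rewrite -[(1 + 1)]/(2%:R) divff// mul1r subrr.
by rewrite /sinh oppr0 expR0 subrr !mul0r addr0.
Qed.

Lemma csinh_al : csinh (piC * (0 +i* al)) = ci * sal%:C.
Proof.
rewrite piCM csinhE mulr0; apply: complex_eqE => /=.
  by rewrite /sinh oppr0 expR0 subrr !mul0r mulr0 subr0.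
rewrite /cosh oppr0 expR0; rewrite -[(1 + 1)]/(2%:R) divff// /sal; ring.
Qed.

(** Comparability with [cosh (pi * x)] yields at once the decay of the kernel and the boundedness of
    [csinh / D]. *)
Lemma D_lower eta : 0 < eta <= 2^-1 -> exists2 k, 0 < k &
  forall x y, 0 <= y <= 1 -> eta <= `|x| \/ eta <= `|y - al| ->
   k * cosh (pi * x) <= nc (D (x +i* y)).
Proof.
move=> /andP[e0 e2].
have pi0 : 0 < pi :> R := pi_gt0 R.
(* [k1] and [k2] serve the first factor of [nc_D2], according as [x] or [y] is far from the pole.
   [k3] serves the second, where [cos (pi * (y + al))] is at most the absolute value of [cal]
   because [sin (pi * y)] is nonnegative. *)
pose k1 : R := 1 - (1 + (pi * eta) ^+ 2 / 8)^-1.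
have K1 : 0 < (pi * eta) ^+ 2 / 8 by rewrite divr_gt0// exprn_gt0// mulr_gt0.
have k10 : 0 < k1.
  have P : 0 < 1 + (pi * eta) ^+ 2 / 8 by lra.
  by rewrite subr_gt0 invf_lt1// ltrDl.
pose k2 : R := 1 - cos (pi * eta).
have k20 : 0 < k2.
  rewrite subr_gt0; apply: cos_lt1; first by rewrite gt_eqF// mulr_gt0.
  rewrite ger0_norm ?mulr_ge0 ?ltW// [2 * pi]mulrC ltr_pM2l//; lra.
pose k3 : R := 1 - `|cal|.
have k30 : 0 < k3 by rewrite subr_gt0 cal_lt1.
pose k := Num.min (Num.min k1 k2) k3.
have k0 : 0 < k by rewrite !lt_min k10 k20.
exists k => // x y /andP[y0 y1] far.
have C0 := cosh_gt0 (pi * x); have C1 := cosh_ge1 (pi * x).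
have f2 : k * cosh (pi * x) <= cosh (pi * x) - cos (pi * (y + al)).
  have h : cos (pi * (y + al)) <= `|cal|.
    rewrite mulrDr cosD -/cal -/sal.
    have sy : 0 <= sin (pi * y) * sal.
      by rewrite mulr_ge0 ?(ltW sal_gt0)// sin_ge0_pi// mulr_ge0 ?(ltW pi0)//= ger_pMr.
    have : cos (pi * y) * cal <= `|cal|.
      rewrite (le_trans (ler_norm _))// normrM ler_piMl//.
      by rewrite ler_norml cos_geN1 cos_le1.
    lra.
  apply: (@le_trans _ _ (k3 * cosh (pi * x))).
    by rewrite ler_wpM2r ?(ltW C0)// ge_min lexx orbT.
  rewrite /k3 mulrBl mul1r lerD2l lerN2 (le_trans h)// ler_peMr//.
have f1 : k * cosh (pi * x) <= cosh (pi * x) - cos (pi * (y - al)).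
  case: far => [ex|ey].
    apply: (@le_trans _ _ (k1 * cosh (pi * x))).
      by rewrite ler_wpM2r ?(ltW C0)// !ge_min lexx.
    rewrite /k1 mulrBl mul1r lerD2l lerN2 (le_trans (cos_le1 _))//.
    rewrite mulrC ler_pdivlMr ?ltr_wpDr//; last exact: ltW.
    rewrite mul1r (le_trans _ (cosh_ge _))// lerD2l ler_wpM2r// !exprMn ler_wpM2l ?sqr_ge0//.
    by rewrite -[x ^+ 2]real_normK ?num_real// ler_pXn2r// nnegrE ltW.
  apply: (@le_trans _ _ (k2 * cosh (pi * x))).
    by rewrite ler_wpM2r ?(ltW C0)// !ge_min lexx orbT.
  have ce : 0 <= cos (pi * eta).
    apply: cos_ge0_pihalf; rewrite ?inE//.
    apply/andP; split; first by rewrite (@le_trans _ _ 0) ?oppr_le0 ?divr_ge0 ?mulr_ge0// ltW.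
    by rewrite ler_wpM2l// ltW.
  have h : cos (pi * (y - al)) <= cos (pi * eta).
    rewrite -[cos (pi * (y - al))]cos_norm normrM gtr0_norm//.
    have yal : `|y - al| <= 1 by have := al0; have := al1; rewrite ler_norml; lra.
    have i1 : pi * `|y - al| \in `[0, pi].
      by rewrite in_itv/= mulr_ge0 ?(ltW pi0)//= ler_piMr// ltW.
    have i2 : pi * eta \in `[0, pi].
      rewrite in_itv/= mulr_ge0 ?(ltW pi0) ?(ltW e0)//= ler_piMr ?(ltW pi0)//; lra.
    by rewrite leNgt ltr_cos// ltr_pM2l// -leNgt.
  rewrite /k2 mulrBl mul1r lerD2l lerN2 (le_trans h)// ler_peMr//.
rewrite -(@ler_pXn2r _ 2)// ?nnegrE ?nc_ge0 ?mulr_ge0 ?(ltW k0) ?(ltW C0)//.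
rewrite nc_D2 expr2.
by rewrite ler_pM// ?mulr_ge0 ?(ltW k0) ?(ltW C0).
Qed.

End Kernel.

(** * Polynomial weights against exponentials and Gaussians *)

Section Weights.
Variable R : realType.
Notation mu := (@lebesgue_measure R).
Notation "'rintegrable' f" := (mu.-integrable [set: R] (EFin \o f)) (at level 10, f at level 9).
Local Open Scope complex_scope.

(** The common scale: [wt] is integrable, the kernel decays at least like [wt ^ 2], and [Psi] as
    well as the primitives of [h] grow at most like [1 / wt]. *)
Definition wt (x : R) : R := (1 + x ^+ 2)^-1.

Lemma wt_den (x : R) : 0 < 1 + x ^+ 2.
Proof. by rewrite ltr_wpDr ?sqr_ge0. Qed.

Lemma wt_gt0 x : 0 < wt x. Proof. by rewrite invr_gt0 wt_den. Qed.

Lemma wt_ge0 x : 0 <= wt x. Proof. exact/ltW/wt_gt0. Qed.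

Lemma wt_le1 x : wt x <= 1.
Proof. by rewrite invf_le1 ?wt_den// lerDl sqr_ge0. Qed.

Lemma wt_le_inv (x : R) : 0 < x -> wt x <= x^-1.
Proof.
move=> x0; rewrite lef_pV2 ?posrE ?wt_den//.
have := sqr_ge0 (x - 1); have := sqr_ge0 x; rewrite sqrrB expr1n mulr1; lra.
Qed.

Lemma wt_norm (x : R) : wt `|x| = wt x.
Proof. by rewrite /wt real_normK// num_real. Qed.

Lemma wtK (x : R) : (1 + x ^+ 2) * wt x = 1.
Proof. by rewrite mulfV// gt_eqF// wt_den. Qed.

Lemma wt_sqr_le x : wt x ^+ 2 <= wt x.
Proof. by rewrite expr2 ler_piMl ?wt_ge0 ?wt_le1. Qed.

Lemma norm_le_den (x : R) : 1 + `|x| <= 2 * (1 + x ^+ 2).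
Proof.
have := sqr_ge0 (`|x| - 1); rewrite sqrrB real_normK ?num_real// expr1n mulr1.
by have := sqr_ge0 x; lra.
Qed.

Lemma far_line (y al : R) : y != al -> exists2 eta : R, 0 < eta <= 2^-1 & eta <= `|y - al|.
Proof.
move=> yal; exists (Num.min (2^-1) `|y - al|); last by rewrite ge_min lexx orbT.
by rewrite lt_min normr_gt0 subr_eq0 yal ge_min lexx invr_gt0 ltr0n.
Qed.

Lemma wt_integrable : rintegrable wt.
Proof.
have mw : measurable_fun [set: R] wt.
  apply: continuous_measurable_fun; exact: (@continuous_oneDsqrV R).
apply/integrableP; split; first exact/measurable_EFinP.
under eq_integral => x _ do rewrite gee0_abs ?lee_fin ?wt_ge0//.
rewrite ge0_symfun_integralT//; last 3 first.
- exact: wt_ge0.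
- exact: continuous_oneDsqrV.
- by move=> x; rewrite /wt /= sqrrN.
by rewrite -set_itvcy integral0y_oneDsqr -EFinM ltry.
Qed.

Lemma expR_poly m : exists2 K : R, 0 < K & forall x : R, (1 + x ^+ 2) ^+ m <= K * expR `|x|.
Proof.
case: m => [|m].
  exists 1 => // x; rewrite expr0 mul1r (le_trans _ (expR_ge1Dx _))// lerDl//.
set n := m.+1.
pose K : R := (4 * n%:R ^+ 2) ^+ n.
have n0 : (0 : R) < n%:R by rewrite ltr0n.
have K0 : 0 < K by rewrite exprn_gt0// mulr_gt0// exprn_gt0.
exists K => // x.
(* The scale is chosen so that [expR u] to the power [2 * n] is the exponential of the absolute
   value of [x]; the bound [1 + u <= expR u] then suffices. *)
pose u := `|x| / (2 * n%:R).
have u0 : 0 <= u by rewrite divr_ge0// mulr_ge0// ltW.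
have -> : expR `|x| = (expR u ^+ 2) ^+ n.
  rewrite -!expRM_natl; congr expR; rewrite /u; field.
  by rewrite gt_eqF.
rewrite /K -exprMn lerXn2r ?nnegrE ?(ltW (wt_den _)) ?mulr_ge0 ?exprn_ge0 ?expR_ge0 ?(ltW n0)//.
have h : 1 + u <= expR u by exact: expR_ge1Dx.
have h2 : (1 + u) ^+ 2 <= expR u ^+ 2.
  by rewrite lerXn2r// nnegrE ?expR_ge0// addr_ge0.
apply: (@le_trans _ _ (4 * n%:R ^+ 2 * (1 + u) ^+ 2)); last first.
  by rewrite ler_wpM2l ?mulr_ge0 ?exprn_ge0 ?(ltW n0).
have -> : 4 * n%:R ^+ 2 * (1 + u) ^+ 2 = (2 * n%:R + `|x|) ^+ 2.
  by rewrite /u; field; rewrite gt_eqF.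
have n1 : (1 : R) <= n%:R by rewrite ler1n.
rewrite sqrrD real_normK ?num_real// lerD//.
rewrite -[leLHS]addr0; apply: lerD; last by rewrite mulrn_wge0// !mulr_ge0// ltW.
by rewrite exprn_ege1//; lra.
Qed.

Lemma expR_gauss (A eps : R) m : 0 <= A -> 0 < eps -> exists2 K : R, 0 < K &
  forall x : R, (1 + x ^+ 2) ^+ m * expR (A * `|x| - eps * x ^+ 2) <= K.
Proof.
move=> A0 e0; have [K K0 HK] := expR_poly m.
(* The polynomial costs one extra exponential by [expR_poly], hence [A + 1]; the maximum over [t] of
   [B * t - eps * t ^ 2] is [B ^ 2 / (4 * eps)]. *)
pose B := A + 1.
exists (K * expR (B ^+ 2 / (4 * eps))); first by rewrite mulr_gt0// expR_gt0.
move=> x; rewrite (le_trans (ler_wpM2r (expR_ge0 _) (HK x)))//.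
rewrite -mulrA -expRD ler_wpM2l ?(ltW K0)// ler_expR.
have -> : `|x| + (A * `|x| - eps * x ^+ 2) = B * `|x| - eps * `|x| ^+ 2.
  by rewrite real_normK ?num_real// /B; ring.
rewrite -subr_ge0.
have -> : B ^+ 2 / (4 * eps) - (B * `|x| - eps * `|x| ^+ 2) =
   eps * (`|x| - B / (2 * eps)) ^+ 2 by field; rewrite gt_eqF.
by rewrite mulr_ge0 ?sqr_ge0 ?(ltW e0).
Qed.

End Weights.

Section Quotient.
Variable R : realType.
Local Open Scope complex_scope.
Implicit Types (f d : R[i] -> R[i]) (z : R[i]).

(* The quotient of two functions vanishing at [z0], continued by the quotient
   of their derivatives. *)
Definition cquot f d (z0 a b : R[i]) : R[i] -> R[i] :=
  fun z => if z == z0 then a / b else f z / d z.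

Lemma cquot_cont f d z0 a b : cderiv f z0 a -> cderiv d z0 b -> b != 0 ->
  f z0 = 0 -> d z0 = 0 -> ccont (cquot f d z0 a b) z0.
Proof.
move=> df dd b0 f0 d0 e e0.
have n0 : 0 < nc b by rewrite nc_gt0.
have h2 : 0 < nc b / 2 by rewrite divr_gt0.
have [r1 r10 H1] := dd _ h2.
pose S := nc b + nc a + 1.
have S0 : 0 < S by rewrite ltr_wpDl// addr_ge0// nc_ge0.
pose e' := e * (nc b ^+ 2 / 2) / S.
have e'0 : 0 < e' by rewrite divr_gt0// mulr_gt0// divr_gt0// exprn_gt0.
have [r2 r20 H2] := dd _ e'0.
have [r3 r30 H3] := df _ e'0.
exists (Num.min r1 (Num.min r2 r3)); first by rewrite !lt_min r10 r20.
move=> w; rewrite !lt_min => /and3P[/H1 {}H1 /H2 {}H2 /H3 {}H3].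
have [->|w0] := eqVneq w 0; first by rewrite addr0 subrr Normc.normc0 ltW.
have wn0 : 0 < nc w by rewrite nc_gt0.
rewrite /cquot eqxx ifF; last by apply/negP => /eqP /(canRL (addKr _)); rewrite addNr; apply/eqP.
rewrite d0 subr0 in H1 H2; rewrite f0 subr0 in H3.
have dw : nc b / 2 * nc w <= nc (d (z0 + w)).
  have := ncB (d (z0 + w)) (d (z0 + w) - b * w).
  rewrite opprB addrCA subrr addr0 ncM; lra.
have dn0 : 0 < nc (d (z0 + w)) by rewrite (lt_le_trans _ dw)// mulr_gt0.
(* Over the common denominator both first-order remainders appear, so the numerator is small
   compared with [nc w], while the denominator is at least [nc b ^ 2 / 2] times [nc w]. *)
have -> : f (z0 + w) / d (z0 + w) - a / b =
   ((f (z0 + w) - a * w) * b - a * (d (z0 + w) - b * w)) / (d (z0 + w) * b).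
  by field; rewrite b0 -nc_gt0 dn0.
rewrite ncM ncV ler_pdivrMr; last by rewrite ncM mulr_gt0.
rewrite (le_trans (ncB _ _))// !ncM.
apply: (@le_trans _ _ (e' * nc w * S)).
  have a1 : nc (f (z0 + w) - a * w) * nc b <= e' * nc w * nc b.
    by rewrite ler_wpM2r ?nc_ge0.
  have a2 : nc a * nc (d (z0 + w) - b * w) <= nc a * (e' * nc w).
    by rewrite ler_wpM2l ?nc_ge0.
  have a3 : 0 <= e' * nc w by rewrite mulr_ge0 ?nc_ge0// ltW.
  have -> : e' * nc w * S = e' * nc w * nc b + nc a * (e' * nc w) + e' * nc w.
    by rewrite /S; ring.
  lra.
have -> : e' * nc w * S = e * (nc b / 2 * nc w * nc b).
  by rewrite /e'; field; rewrite gt_eqF.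
by rewrite ler_wpM2l ?(ltW e0)// ler_wpM2r// nc_ge0.
Qed.

Lemma cquot_cderiv f d z0 a b z : z <> z0 -> (exists l, cderiv f z l) -> (exists l, cderiv d z l) ->
  d z != 0 -> exists l, cderiv (cquot f d z0 a b) z l.
Proof.
move=> zz0 [lf df] [ld dd] dz0.
have := cderivM df (cderivV dz0 dd).
set l := _ + _ => H; exists l.
have h0 : 0 < nc (z - z0) by rewrite nc_gt0 subr_eq0; apply/eqP.
apply: (cderiv_eq h0 _ H) => w wz; rewrite /cquot ifF//.
apply/negP => /eqP zw; move: wz.
by rewrite -zw opprD addNKr ncN ltxx.
Qed.

End Quotient.

Section PoissonKernel.
Variables (R : realType) (al : R) (Hal : 0 < al < 1).
Local Open Scope complex_scope.
Notation mu := (@lebesgue_measure R).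
Notation "'rintegrable' f" := (mu.-integrable [set: R] (EFin \o f)) (at level 10, f at level 9).
Implicit Types (x y : R) (z w : R[i]).

Let al0 : 0 < al. Proof. by case/andP: Hal. Qed.
Let al1 : al < 1. Proof. by case/andP: Hal. Qed.

Definition zal : R[i] := 0 +i* al.

(* The residue of this kernel at [zal] is [1 / (2 pi i)]. *)
Definition kern z : R[i] := (sal al / 2)%:C / D al z.

Lemma poisson_den x : 0 < cosh (pi * x) - cal al.
Proof.
rewrite subr_gt0 (lt_le_trans _ (cosh_ge1 _))// (le_lt_trans (ler_norm _))//.
exact: cal_lt1.
Qed.

Lemma poisson_gt0 x : 0 < poisson al x.
Proof. by rewrite /poisson mulr_gt0// divr_gt0 ?poisson_den// sal_gt0. Qed.

Lemma D0 x : D al (x +i* 0) = (cosh (pi * x) - cal al)%:C.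
Proof.
rewrite /D piCM ccoshE mulr0 cos0 sin0; apply: complex_eqE => /=; ring.
Qed.

Lemma D1 x : D al (x +i* 1) = (- (cosh (pi * x) + cal al))%:C.
Proof.
rewrite /D piCM ccoshE mulr1 cospi sinpi; apply: complex_eqE => /=; ring.
Qed.

Lemma cal_sym : cal (1 - al) = - cal al.
Proof. by rewrite /cal mulrBr mulr1 cosB cospi sinpi mul0r addr0 mulN1r. Qed.

Lemma sal_sym : sal (1 - al) = sal al.
Proof. by rewrite /sal mulrBr mulr1 sinB cospi sinpi mul0r mulN1r opprK add0r. Qed.

Lemma kern0 x : kern (x +i* 0) = (poisson al x)%:C.
Proof.
by rewrite /kern D0 -fmorphV -rmorphM; congr (_%:C); rewrite /poisson /sal /cal; ring.
Qed.

Lemma kern1 x : kern (x +i* 1) = (- poisson (1 - al) x)%:C.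
Proof.
rewrite /kern D1 -fmorphV -rmorphM; congr (_%:C).
by rewrite /poisson -/(sal (1 - al)) -/(cal (1 - al)) sal_sym cal_sym opprK invrN; ring.
Qed.

Lemma D_zal : D al zal = 0. Proof. exact: D_al. Qed.

Definition D'al : R[i] := piC R * (ci * (sal al)%:C).

Lemma cderiv_D_zal : cderiv (D al) zal D'al.
Proof. by have := cderiv_D al zal; rewrite csinh_al. Qed.

Lemma D'al_neq0 : D'al != 0.
Proof.
rewrite -nc_gt0 !ncM nc_i mul1r !nc_real mulr_gt0// normr_gt0 gt_eqF ?pi_gt0//.
exact: sal_gt0.
Qed.

Lemma cderiv_kern z : D al z != 0 ->
  cderiv kern z (- (piC R * csinh (piC R * z)) / D al z * kern z).
Proof.
move=> Dz; have := cderivMl (sal al / 2)%:C (cderivV Dz (cderiv_D al z)).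
by congr cderiv; rewrite /kern; field.
Qed.

(** Both estimates rest on [D_lower]: for the kernel [cosh] beats any polynomial, for the quotient
    it dominates [csinh]. The quotient is, up to the factor [pi], the logarithmic derivative of
    [D]. *)
Lemma kern_bound eta : 0 < eta <= 2^-1 -> exists2 K : R, 0 < K &
  forall x y, 0 <= y <= 1 -> eta <= `|x| \/ eta <= `|y - al| ->
   nc (kern (x +i* y)) <= K * wt x ^+ 2 /\
   nc (csinh (piC R * (x +i* y)) / D al (x +i* y)) <= K.
Proof.
move=> He; have [k k0 Hk] := D_lower Hal He.
have [K K0 HK] := expR_poly R 2.
have s0 := sal_gt0 Hal.
exists (sal al * K / k + k^-1).
  by rewrite addr_gt0 ?invr_gt0// divr_gt0// mulr_gt0.
move=> x y y01 far; have {}Hk := Hk x y y01 far.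
have C0 := cosh_gt0 (pi * x).
have kC : 0 < k * cosh (pi * x) by rewrite mulr_gt0.
have D0 : 0 < nc (D al (x +i* y)) by rewrite (lt_le_trans _ Hk).
have pi0 : 0 < pi :> R := pi_gt0 R.
have KE : 0 <= sal al * K / k by rewrite divr_ge0 ?mulr_ge0 ?(ltW s0) ?(ltW K0) ?(ltW k0).
have KF : 0 <= k^-1 by rewrite invr_ge0 ltW.
split.
  apply: (@le_trans _ _ (sal al * K / k * wt x ^+ 2)); last first.
    by rewrite ler_wpM2r ?exprn_ge0 ?wt_ge0// lerDl.
  rewrite /kern ncM ncV nc_real ger0_norm ?divr_ge0 ?(ltW s0)//.
  apply: (@le_trans _ _ (sal al / 2 * (k * cosh (pi * x))^-1)).
    by rewrite ler_wpM2l ?divr_ge0 ?(ltW s0)// lef_pV2 ?posrE.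
  have -> : sal al * K / k * wt x ^+ 2 = sal al / 2 * ((2 * K) * wt x ^+ 2 / k).
    by field; rewrite gt_eqF.
  rewrite ler_wpM2l ?divr_ge0 ?(ltW s0)// invfM mulrC ler_wpM2r//.
  rewrite -[leLHS]mul1r ler_pdivrMr// /wt exprVn mulrAC ler_pdivlMr ?exprn_gt0 ?wt_den// mul1r.
  rewrite (le_trans (HK x))// -mulrA mulrCA ler_wpM2l ?(ltW K0)//.
  apply: (@le_trans _ _ (expR `|pi * x|)); last by have := cosh_ge_exp (pi * x); lra.
  rewrite ler_expR normrM gtr0_norm// ler_peMl//.
  by have := pi_ge2 R; lra.
rewrite ncM ncV; apply: (@le_trans _ _ k^-1); last by rewrite lerDr.
rewrite ler_pdivrMr// -ler_pdivrMl ?invr_gt0// invrK.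
apply: le_trans Hk; rewrite ler_wpM2l ?(ltW k0)// piCM; exact: nc_csinh.
Qed.

Lemma rcont_kern y : 0 <= y <= 1 -> y != al -> forall x, rcont (fun t => kern (t +i* y)) x.
Proof.
move=> y01 yal x; apply: ccont_x; apply: cderiv_cont; apply: cderiv_kern.
apply: D_neq0 => //; first by have := al0; have := al1; lra.
by case=> _ e; move: yal; rewrite e eqxx.
Qed.

Lemma cmeasurable_kern y : 0 <= y <= 1 -> y != al -> cmeasurable (fun t => kern (t +i* y)).
Proof. by move=> y01 yal; apply: rcont_measurable; exact: rcont_kern. Qed.

Lemma poisson_bound : exists2 K : R, 0 < K & forall x, poisson al x <= K * wt x ^+ 2.
Proof.
pose eta := Num.min (2^-1) al.
have He : 0 < eta <= 2^-1 by rewrite lt_min al0 ge_min lexx; apply/andP; split => //=; lra.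
have [K K0 HK] := kern_bound He; exists K => // x.
have y01 : 0 <= (0 : R) <= 1 by rewrite lexx ler01.
have far : eta <= `|0 - al| by rewrite sub0r normrN gtr0_norm// ge_min lexx orbT.
have [+ _] := HK x 0 y01 (or_intror far).
by rewrite kern0 nc_real gtr0_norm ?poisson_gt0.
Qed.

Lemma continuous_poisson : continuous (poisson al).
Proof.
move=> x.
have y01 : 0 <= (0 : R) <= 1 by rewrite lexx ler01.
have n0 : (0 : R) != al by rewrite lt_eqF.
have [+ _] := rcont_kern y01 n0 x.
have -> // : poisson al = (fun t => complex.Re (kern (t +i* 0))).
by apply/funext => t; rewrite kern0.
Qed.

Lemma poisson_integrable : rintegrable (poisson al).
Proof.
have [K K0 HK] := poisson_bound.
apply: (@rintegrable_le _ _ (fun x => K * wt x)).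
- apply: continuous_measurable_fun; exact: continuous_poisson.
- move=> x; rewrite gtr0_norm ?poisson_gt0// (le_trans (HK x))//.
  by rewrite ler_wpM2l ?(ltW K0)// wt_sqr_le.
- exact/rintegrableZ/wt_integrable.
Qed.

Lemma integral_poisson : \int[mu]_x poisson al x = 1 - al.
Proof.
have s0 := sal_gt0 Hal; have pi0 : 0 < pi :> R := pi_gt0 R.
(* With [t = expR (pi * x)] the measure [poisson al x dx] becomes [sal al / pi] times
   [dt / ((t - cal al) ^ 2 + sal al ^ 2)], whose primitive is an arctangent. *)
pose F x := pi^-1 * atan ((expR (pi * x) - cal al) / sal al).
have dF x : is_derive x 1 F (poisson al x).
  rewrite /F; apply: is_derive_eq.
  have E0 : 0 < expR (pi * x) by exact: expR_gt0.
  have := poisson_den x.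
  rewrite /GRing.scale/= /poisson /cosh -/(sal al) -/(cal al) expRN.
  have := cal2 al; set s := sal al in s0 *; set c := cal al; set E := expR _ in E0 *.
  move=> cs den.
  have den2 : (E - c) ^+ 2 + s ^+ 2 = 2 * E * ((E + E^-1) / 2 - c).
    have -> : (E - c) ^+ 2 + s ^+ 2 = E ^+ 2 - 2 * E * c + (c ^+ 2 + s ^+ 2) by ring.
    by rewrite cs; field; rewrite gt_eqF.
  have den3 : (E - c) ^+ 2 + s ^+ 2 != 0.
    by rewrite den2 gt_eqF// !mulr_gt0.
  have -> : (1 + ((E - c) / s) ^+ 2)^-1 = s ^+ 2 / (2 * E * ((E + E^-1) / 2 - c)).
    rewrite -den2; field.
    by rewrite den3 (gt_eqF s0).
  clear den2 den3; move: den; set q := _ - c => q0.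
  have aux (p : R) : 0 < p -> p^-1 * (s ^+ 2 / (2 * E * q) *
      ((E - c) * 0 + s^-1 * (E * (p * 1) - 0))) = 2^-1 * (s / q).
    by move=> p0; field; rewrite (gt_eqF E0) (gt_eqF q0) (gt_eqF s0) (gt_eqF p0).
  exact: aux.
have lim1 := rline_cvg continuous_poisson poisson_integrable dF.
have c1 : (fun n => F n%:R) @ \oo --> pi^-1 * (pi / 2).
  rewrite /F; apply: cvgM; first exact: cvg_cst.
  apply: (@cvg_comp _ _ _ (fun n : nat => (expR (pi * n%:R) - cal al) / sal al) (@atan R) _ _ _ _ (@cvgy_atan R)).
  apply/cvgryPge => A; near=> n.
  rewrite ler_pdivlMr// lerBrDr.
  have nA : A * sal al + cal al <= n%:R by near: n; exact: nbhs_infty_ger.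
  rewrite (le_trans nA)// (@le_trans _ _ (1 + pi * n%:R)) ?expR_ge1Dx//.
  rewrite -[leLHS]add0r lerD// ler_peMl//; have := pi_ge2 R; lra.
(* The limit at minus infinity: [- cal al / sal al] is the tangent of [pi * al - pi / 2], an angle
   in the principal range. *)
have at0 : atan ((0 - cal al) / sal al) = pi * al - pi / 2.
  rewrite sub0r -[- cal al]sinBpihalf -[sal al]cosBpihalf -/(tan _) tanK// in_itv/=.
  apply/andP; split.
    by rewrite -subr_gt0 opprK subrK mulr_gt0.
  by rewrite ltrBlDr -splitr gtr_pMr.
have c2 : (fun n => F (- n%:R)) @ \oo --> pi^-1 * (pi * al - pi / 2).
  rewrite /F -at0; apply: cvgM; first exact: cvg_cst.
  apply: (@cvg_comp _ _ _ (fun n : nat => (expR (pi * - n%:R) - cal al) / sal al) (@atan R) _ _ _ _ (@continuous_atan R _)).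
  apply: cvgM; last exact: cvg_cst.
  apply: cvgB; last exact: cvg_cst.
  have -> : (fun n => expR (pi * - n%:R)) = (fun n : nat => 1 * expR (- pi) ^+ n) :> (nat -> R).
    by apply/funext => n; rewrite mul1r -expRM_natl; congr expR; ring.
  apply: cvg_geometric; rewrite ger0_norm ?expR_ge0//.
  by rewrite -expR0 ltr_expR oppr_lt0.
have -> := cvg_unique _ lim1 (cvgB c1 c2).
have pn : pi^-1 * pi = 1 :> R by rewrite mulVf// gt_eqF.
by rewrite -mulrBr mulrBr !mulrA mulrBr !mulrA pn; field.
Unshelve. all: by end_near. Qed.

End PoissonKernel.

(** * Cauchy's formula with the kernel *)

Section Cauchy.
Variables (R : realType) (al : R) (Hal : 0 < al < 1).
Local Open Scope complex_scope.
Notation mu := (@lebesgue_measure R).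
Implicit Types (x y : R) (z w : R[i]).

Let al0 : 0 < al. Proof. by case/andP: Hal. Qed.
Let al1 : al < 1. Proof. by case/andP: Hal. Qed.
Let k := @kern R al.

Definition vertical_vanish (W : R[i] -> R[i]) a b :=
  forall e : R, 0 < e -> exists X : R, forall x : R, X <= `|x| -> forall B : R -> R[i],
    (forall y, a <= y <= b -> rderiv B y (ci * W (x +i* y))) -> nc (B b - B a) <= e.

Lemma vertical_pointwise W a b K : a <= b -> 0 < K ->
  (forall x y, a <= y <= b -> 1 <= `|x| -> nc (W (x +i* y)) <= K * wt x) ->
  vertical_vanish W a b.
Proof.
move=> ab K0 HW e e0.
have ba : 0 <= b - a by rewrite subr_ge0.
have P : 0 <= 2 * K * (b - a) / e by rewrite divr_ge0 ?mulr_ge0 ?(ltW K0) ?(ltW e0).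
exists (1 + 2 * K * (b - a) / e) => x xX B dB.
have x1 : 1 <= `|x| by lra.
have x0 : 0 < `|x| by lra.
apply: (@le_trans _ _ (2 * (K * wt x) * (b - a))).
  apply: (rMVT ab dB) => y yab; rewrite nc_iM; exact: HW.
have h : wt x <= `|x|^-1 by rewrite -wt_norm; exact: wt_le_inv.
apply: (@le_trans _ _ (2 * K * (b - a) * `|x|^-1)).
  rewrite [2 * (K * _) * _](_ : _ = 2 * K * (b - a) * wt x); last by ring.
  by rewrite ler_wpM2l ?mulr_ge0 ?(ltW K0).
rewrite ler_pdivrMr// [e * _]mulrC -ler_pdivrMr//; lra.
Qed.

Lemma cintegrable_kern y : 0 <= y <= 1 -> y != al -> cintegrable (fun x => k (x +i* y)).
Proof.
move=> y01 yal.
have [eta He far] := far_line yal.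
have [K K0 HK] := kern_bound Hal He.
apply: (@cintegrable_le _ _ (fun x => K * wt x)).
- exact: cmeasurable_kern.
- move=> x; have [|h _] := HK x y y01; first by right.
  apply: (le_trans h); rewrite ler_wpM2l ?(ltW K0)// wt_sqr_le//.
- exact/rintegrableZ/wt_integrable.
Qed.

Lemma kern_vertical a b : 0 <= a -> a <= b -> b <= 1 -> vertical_vanish k a b.
Proof.
move=> a0 ab b1.
have He : 0 < (2^-1 : R) <= 2^-1 by rewrite lexx invr_gt0 ltr0n.
have [K K0 HK] := kern_bound Hal He.
apply: (@vertical_pointwise _ _ _ K) => // x y /andP[ay yb] x1.
have y01 : 0 <= y <= 1 by rewrite (le_trans a0 ay) (le_trans yb b1).
have x2 : 2^-1 <= `|x| by lra.
have [h _] := HK x y y01 (or_introl x2).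
apply: (le_trans h); rewrite ler_wpM2l ?(ltW K0)// wt_sqr_le//.
Qed.

Lemma kern_cderiv_ex x y : 0 <= y <= 1 -> x +i* y <> zal al -> exists l, cderiv k (x +i* y) l.
Proof.
move=> y01 ne; eexists; apply: cderiv_kern; apply: D_neq0 => //.
by have := al0; have := al1; lra.
Qed.

Lemma kern_line_const a b : 0 <= a -> a <= b -> b <= 1 -> b < al \/ al < a ->
  cintegral (fun x => k (x +i* a)) = cintegral (fun x => k (x +i* b)).
Proof.
move=> a0 ab b1 sep.
have ne x y : a <= y <= b -> x +i* y <> zal al.
  by move=> /andP[ay yb] [_ e]; case: sep; rewrite -e; lra.
have dk x y : a <= y <= b -> exists l, cderiv k (x +i* y) l.
  move=> yab; apply: kern_cderiv_ex; last exact: ne.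
  by case/andP: yab => ay yb; rewrite (le_trans a0 ay) (le_trans yb b1).
have ck x y : a <= y <= b -> ccont k (x +i* y).
  by move=> /(dk x)[l]; exact: cderiv_cont.
apply: (@line_integral_const _ k a b 0 a) => //.
- by move=> x y yab _; exact: dk.
- by apply: ck; rewrite lexx.
- apply: cintegrable_kern; first by rewrite a0 (le_trans ab).
  by case: sep => h; rewrite ?(gt_eqF h) ?(lt_eqF (le_lt_trans ab h)).
- apply: cintegrable_kern; first by rewrite b1 (le_trans a0).
  by case: sep => h; rewrite ?(lt_eqF h) ?(gt_eqF (lt_le_trans h ab)).
- exact: kern_vertical.
Qed.

Lemma Hal' : 0 < 1 - al < 1.
Proof. by have := al0; have := al1; lra. Qed.

Lemma cintegral_real (f : R -> R) : cintegral (fun x => (f x)%:C) = (\int[mu]_x f x)%:C.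
Proof. by apply: complex_eqE => //=; rewrite Rintegral_cst// mul0r. Qed.

(** The line moves down to [y = 0] without crossing the pole, and there the kernel is [poisson al];
    in [kern_line_high] it moves up to [y = 1]. The jump between the two values is 1, which is the
    residue theorem for this kernel. *)
Lemma kern_line_low a : 0 <= a -> a < al -> cintegral (fun x => k (x +i* a)) = (1 - al)%:C.
Proof.
move=> a0 aal; rewrite -(@kern_line_const 0 a)//; last 2 first.
- by rewrite ltW// (lt_trans aal).
- by left.
by rewrite -(integral_poisson Hal) -cintegral_real; apply: eq_cintegral => x; rewrite /k kern0.
Qed.

Lemma kern_line_high b : al < b -> b <= 1 -> cintegral (fun x => k (x +i* b)) = (- al)%:C.
Proof.
move=> bal b1; rewrite (@kern_line_const b 1)//; last 2 first.
- by rewrite ltW// (lt_trans al0).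
- by right.
have -> : - al = \int[mu]_x - poisson (1 - al) x.
  under eq_Rintegral do rewrite -mulN1r.
  rewrite RintegralZl//; last exact: poisson_integrable Hal'.
  by rewrite (integral_poisson Hal'); ring.
by rewrite -cintegral_real; apply: eq_cintegral => x; rewrite /k kern1.
Qed.

(** The function [(g - g0) * k] extends continuously over the pole as the quotient [W], so its
    integrals on the two lines agree. The remainder [g0 * k] contributes [g0 * ((1 - al) + al)]. *)
Lemma kernel_cauchy (g : R[i] -> R[i]) a b : 0 <= a -> a < al -> al < b -> b <= 1 ->
  (forall x y, a <= y <= b -> exists l, cderiv g (x +i* y) l) ->
  cintegrable (fun x => g (x +i* a) * k (x +i* a)) ->
  cintegrable (fun x => g (x +i* b) * k (x +i* b)) ->
  vertical_vanish (fun z => g z * k z) a b ->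
  cintegral (fun x => g (x +i* a) * k (x +i* a)) -
  cintegral (fun x => g (x +i* b) * k (x +i* b)) = g (zal al).
Proof.
move=> a0 aal alb b1 dg ia ib vert.
have ab : a <= b by rewrite ltW// (lt_trans aal).
set g0 := g (zal al).
have [l dl] : exists l, cderiv g (zal al) l by apply: dg; rewrite !ltW.
pose f z := (g z - g0) * (sal al / 2)%:C.
have df z l' : cderiv g z l' -> cderiv f z (l' * (sal al / 2)%:C).
  move=> H; have := cderivM (cderivB H (cderiv_cst g0 z)) (cderiv_cst (sal al / 2)%:C z).
  by rewrite subr0 mulr0 addr0.
pose W := cquot f (D al) (zal al) (l * (sal al / 2)%:C) (D'al al).
have f0 : f (zal al) = 0 by rewrite /f subrr mul0r.
have cW0 : ccont W (zal al).
  apply: cquot_cont => //; [exact: df|exact: cderiv_D_zal|exact: D'al_neq0|exact: D_zal].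
have dW x y : a <= y <= b -> x +i* y <> zal al -> exists l, cderiv W (x +i* y) l.
  move=> yab ne; apply: cquot_cderiv => //.
  - by have [l' dl'] := dg x y yab; eexists; exact: df dl'.
  - by eexists; exact: cderiv_D.
  - apply: D_neq0 => //; have := al0; have := al1; lra.
have WE z : z <> zal al -> W z = g z * k z - g0 * k z.
  by move=> /eqP/negbTE ne; rewrite /W /cquot ne /f /k /kern; ring.
have ne y : y != al -> forall x, x +i* y <> zal al.
  by move=> yal x [_ e]; rewrite e eqxx in yal.
have nea : a != al by rewrite lt_eqF.
have neb : b != al by rewrite gt_eqF.
have a01 : 0 <= a <= 1 by rewrite a0 (le_trans ab).
have b01 : 0 <= b <= 1 by rewrite b1 (le_trans a0).
have ka := cintegrable_kern a01 nea.
have kb := cintegrable_kern b01 neb.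
have Ea x : g (x +i* a) * k (x +i* a) - g0 * k (x +i* a) = W (x +i* a).
  by rewrite WE//; exact: ne.
have Eb x : g (x +i* b) * k (x +i* b) - g0 * k (x +i* b) = W (x +i* b).
  by rewrite WE//; exact: ne.
have iWa : cintegrable (fun x => W (x +i* a)).
  by apply: (eq_cintegrable Ea); apply: cintegrableB => //; exact: cintegrableZ.
have iWb : cintegrable (fun x => W (x +i* b)).
  by apply: (eq_cintegrable Eb); apply: cintegrableB => //; exact: cintegrableZ.
have : cintegral (fun x => W (x +i* a)) = cintegral (fun x => W (x +i* b)).
  apply: (@line_integral_const _ W a b 0 al) => //.
  - move=> x y yab; have [e|/eqP e] := eqVneq (x +i* y) (zal al); first by rewrite e.
    by have [l' /cderiv_cont] := dW x y yab e.
  - move=> e e0; have e2 : 0 < e / 2 by rewrite divr_gt0.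
    have [X1 H1] := vert _ e2.
    have g00 : 0 < nc g0 + 1 by rewrite ltr_wpDl ?nc_ge0.
    have e3 : 0 < e / 2 / (nc g0 + 1) by rewrite divr_gt0.
    have [X2 H2] := kern_vertical a0 ab b1 e3.
    exists (Num.max 1 (Num.max X1 X2)) => x; rewrite !ge_max => /and3P[x1 xX1 xX2] B dB.
    have nex y : x +i* y <> zal al.
      by case=> e' _; move: x1; rewrite e' normr0 ler10.
    (* The hypothesis concerns [g * k], whereas [B] is a primitive of [ci * W]. Adding [g0] times a
       primitive of [ci * k] makes it apply, and the added term is small by [kern_vertical]. *)
    have [B2 dB2] : exists F : R -> R[i], forall y, a <= y <= b -> rderiv F y (ci * k (x +i* y)).
      apply: rcont_antiderivative => // y yab.
      apply: (@ccont_y _ (fun z => ci * k z)).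
      have [|l' dl'] := @kern_cderiv_ex x y _ (nex y).
        by case/andP: yab => ay yb; rewrite (le_trans a0 ay) (le_trans yb b1).
      exact: cderiv_cont (cderivMl ci dl').
    have -> : B b - B a = ((B b + g0 * B2 b) - (B a + g0 * B2 a)) - g0 * (B2 b - B2 a) by ring.
    rewrite (le_trans (ncB _ _))// [e]splitr lerD//.
      apply: (H1 x xX1 (fun y => B y + g0 * B2 y)) => y yab.
      have -> : ci * (g (x +i* y) * k (x +i* y)) = ci * W (x +i* y) + g0 * (ci * k (x +i* y)).
        by rewrite WE//; ring.
      by apply: rderivD; [exact: dB|exact/rderivZ/dB2].
    have h := H2 x xX2 B2 dB2.
    rewrite ncM mulrC; move: h; rewrite ler_pdivlMr//; apply: le_trans.
    by rewrite ler_wpM2l ?nc_ge0// lerDl.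
rewrite -(eq_cintegral Ea) -(eq_cintegral Eb).
rewrite (cintegralB ia (cintegrableZ g0 ka)) (cintegralB ib (cintegrableZ g0 kb)).
rewrite (cintegralZ g0 ka) (cintegralZ g0 kb) (kern_line_low a0 aal) (kern_line_high alb b1).
move=> /eqP; rewrite -subr_eq0 => /eqP H.
apply/eqP; rewrite -subr_eq0 -H; apply/eqP.
rewrite rmorphB rmorphN rmorph1; ring.
Qed.

End Cauchy.

(** * The exponent of the extremal function *)

Section LnPoisson.
Variables (R : realType) (al : R) (Hal : 0 < al < 1).
Local Open Scope complex_scope.
Implicit Types (x y : R).

Lemma csinh0 x : csinh (piC R * (x +i* 0)) = (sinh (pi * x))%:C.
Proof. by rewrite piCM csinhE mulr0 cos0 sin0 mulr1 mulr0. Qed.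

Lemma csinh1 x : csinh (piC R * (x +i* 1)) = (- sinh (pi * x))%:C.
Proof. by rewrite piCM csinhE mulr1 cospi sinpi mulrN1 mulr0. Qed.

Lemma is_derive_cosh x : is_derive x 1 (fun t => cosh (pi * t)) (pi * sinh (pi * x)).
Proof.
rewrite /cosh /sinh; apply: is_derive_eq; rewrite /GRing.scale/=; ring.
Qed.

Lemma is_derive_ln_poisson x : is_derive x 1 (fun t => ln (poisson al t))
  (- (pi * sinh (pi * x)) / (cosh (pi * x) - cal al)).
Proof.
have den := poisson_den Hal x.
have dc := is_derive_cosh x.
have P0 := poisson_gt0 Hal x.
have d1 : is_derive x 1 (poisson al) (2^-1 * (sal al * (- (pi * sinh (pi * x)) / (cosh (pi * x) - cal al) ^+ 2))).
  rewrite /poisson -/(sal al) -/(cal al).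
  have dd : is_derive x 1 (fun t => cosh (pi * t) - cal al) (pi * sinh (pi * x)).
    by rewrite -[X in is_derive _ _ _ X]subr0; apply: is_deriveB.
  have dv := @is_deriveV R (fun t => cosh (pi * t) - cal al) x _ _ (lt0r_neq0 den) dd.
  apply: is_deriveZ; apply: is_deriveZ.
  move: dv; congr is_derive; rewrite /GRing.scale/=; ring.
have := @is_derive1_comp _ (@ln R) (poisson al) x _ _ (is_derive1_ln P0) d1.
congr is_derive; rewrite /poisson -/(sal al) -/(cal al); field.
by rewrite (gt_eqF (sal_gt0 Hal)) gt_eqF.
Qed.

(** The logarithmic derivative is [- pi * csinh / D] on [y = 0], bounded by [kern_bound]; a
    Lipschitz function grows at most linearly. *)
Lemma ln_poisson_bound : exists2 K : R, 0 < K & forall x, `|ln (poisson al x)| <= K * (1 + `|x|).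
Proof.
have al0 : 0 < al by case/andP: Hal.
pose eta := Num.min (2^-1) al.
have He : 0 < eta <= 2^-1 by rewrite lt_min al0 ge_min lexx invr_gt0 ltr0n.
have [K K0 HK] := kern_bound Hal He.
have pi0 : 0 < pi :> R := pi_gt0 R.
have dK x : `|- (pi * sinh (pi * x)) / (cosh (pi * x) - cal al)| <= pi * K.
  have y01 : 0 <= (0 : R) <= 1 by rewrite lexx ler01.
  have far : eta <= `|0 - al| by rewrite sub0r normrN gtr0_norm// ge_min lexx orbT.
  have [_] := HK x 0 y01 (or_intror far).
  rewrite csinh0 D0 -fmorphV -rmorphM nc_real => h.
  by rewrite mulNr normrN -mulrA normrM gtr0_norm// ler_wpM2l// ltW.
pose K1 := `|ln (poisson al 0)|.
have piK0 : 0 < pi * K by rewrite mulr_gt0.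
have K11 : 0 <= K1 := normr_ge0 _.
exists (K1 + pi * K); first by lra.
move=> x.
have h : `|ln (poisson al x) - ln (poisson al 0)| <= pi * K * `|x|.
  have [x0|/ltW x0] := leP 0 x.
    have := @MVT_le _ (fun t => ln (poisson al t)) _ 0 x (pi * K) x0
      (fun t _ => is_derive_ln_poisson t) (fun t _ => dK t).
    by rewrite subr0 [`|x|]ger0_norm.
  have := @MVT_le _ (fun t => ln (poisson al t)) _ x 0 (pi * K) x0
    (fun t _ => is_derive_ln_poisson t) (fun t _ => dK t).
  by rewrite distrC sub0r [`|x|]ler0_norm.
have := ler_normD (ln (poisson al x) - ln (poisson al 0)) (ln (poisson al 0)).
rewrite subrK => h2.
have K10 : 0 <= K1 * `|x| by rewrite mulr_ge0// normr_ge0.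
have piK : 0 <= pi * K by rewrite mulr_ge0// ltW.
rewrite mulrDl !mulrDr !mulr1; rewrite -/K1 in h2; lra.
Qed.

End LnPoisson.

Section Exponent.
Variables (R : realType) (al : R) (Hal : 0 < al < 1) (a b : R).
Local Open Scope complex_scope.
Notation mu := (@lebesgue_measure R).
Implicit Types (x y : R) (z w : R[i]).

Let al0 : 0 < al. Proof. by case/andP: Hal. Qed.
Let al1 : al < 1. Proof. by case/andP: Hal. Qed.

(** The affine function with real part [a * (1 - y) + b * y]: the two exponents on the boundary
    lines, and their mean [affm] at the pole. *)
Definition affk z : R[i] := a%:C + ci * (a - b)%:C * z.

Definition affm : R := a * (1 - al) + b * al.

(* [lamnum / D] is holomorphic near the strip once its removable singularity
   at [zal] is filled; on the lines [y = 0] and [y = 1], where [csinh (pi z)]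
   and [D] are real, its real part is [a] times, respectively [b] times, the
   logarithmic derivative of [poisson al], respectively [poisson (1 - al)]. *)
Definition lamnum z : R[i] :=
  - piC R * (affk z * csinh (piC R * z) - ci * (affm * sal al)%:C).

Lemma affk_zal : affk (zal al) = affm%:C.
Proof. by rewrite /affk /affm /zal; apply: complex_eqE => /=; ring. Qed.

(** The constant in [lamnum] is the value of [affk * csinh] at the pole. It is purely imaginary, so
    removing the singularity leaves the real parts on the boundary lines intact. *)
Lemma lamnum_zal : lamnum (zal al) = 0.
Proof. by rewrite /lamnum affk_zal /zal csinh_al rmorphM; ring. Qed.

Lemma cderiv_affk z : cderiv affk z (ci * (a - b)%:C).
Proof.
have := cderivD (cderiv_cst a%:C z) (cderivMl (ci * (a - b)%:C) (cderiv_id z)).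
by rewrite add0r mulr1.
Qed.

Definition lamnum' z : R[i] := - piC R *
  (ci * (a - b)%:C * csinh (piC R * z) + affk z * (piC R * ccosh (piC R * z))).

Lemma cderiv_lamnum z : cderiv lamnum z (lamnum' z).
Proof.
have := cderivMl (- piC R) (cderivB (cderivM (cderiv_affk z) (cderiv_csinh z))
  (cderiv_cst (ci * (affm * sal al)%:C) z)).
by rewrite subr0.
Qed.

Definition Lam := cquot lamnum (D al) (zal al) (lamnum' (zal al)) (D'al al).

Lemma Lam_cont0 : ccont Lam (zal al).
Proof.
apply: cquot_cont; [exact: cderiv_lamnum|exact: cderiv_D_zal|exact: D'al_neq0|exact: lamnum_zal|exact: D_zal].
Qed.

Lemma LamE z : z <> zal al -> Lam z = lamnum z / D al z.
Proof. by move=> /eqP/negbTE ne; rewrite /Lam /cquot ne. Qed.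

Lemma Lam_cderiv x y : - al < y < 2 - al -> x +i* y <> zal al ->
  exists l, cderiv Lam (x +i* y) l.
Proof.
move=> yy ne; apply: cquot_cderiv => //.
- by eexists; exact: cderiv_lamnum.
- by eexists; exact: cderiv_D.
- exact: D_neq0.
Qed.

Lemma Lam_cont x y : - al < y < 2 - al -> ccont Lam (x +i* y).
Proof.
move=> yy; have [->|/eqP ne] := eqVneq (x +i* y) (zal al); first exact: Lam_cont0.
by have [l /cderiv_cont] := Lam_cderiv yy ne.
Qed.

Lemma line_neq_zal x y : y != al -> x +i* y <> zal al.
Proof. by move=> yal [_ e]; rewrite e eqxx in yal. Qed.

Lemma Re_Lam0 x : complex.Re (Lam (x +i* 0)) =
  a * (- (pi * sinh (pi * x)) / (cosh (pi * x) - cal al)).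
Proof.
rewrite LamE; last by apply: line_neq_zal; rewrite lt_eqF.
rewrite D0 -fmorphV.
transitivity (complex.Re (lamnum (x +i* 0)) / (cosh (pi * x) - cal al)).
  by case: (lamnum _) => p q /=; rewrite mulr0 subr0.
rewrite mulrA; congr (_ * _).
rewrite /lamnum csinh0 /piC /affk; move: (sinh _) (affm * _) => p q /=; ring.
Qed.

Lemma Re_Lam1 x : complex.Re (Lam (x +i* 1)) =
  b * (- (pi * sinh (pi * x)) / (cosh (pi * x) + cal al)).
Proof.
rewrite LamE; last by apply: line_neq_zal; rewrite gt_eqF.
rewrite D1 -fmorphV.
transitivity (- complex.Re (lamnum (x +i* 1)) / (cosh (pi * x) + cal al)).
  by case: (lamnum _) => p q /=; rewrite mulr0 subr0 invrN mulrN mulNr.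
rewrite mulrA; congr (_ * _).
rewrite /lamnum csinh1 /piC /affk; move: (sinh _) (affm * _) => p q /=; ring.
Qed.

(** Near the pole continuity gives a constant bound; elsewhere [csinh / D] and the kernel are
    bounded and only [affk] grows. *)
Lemma Lam_bound : exists2 K : R, 0 < K & forall x y, 0 <= y <= 1 ->
  nc (Lam (x +i* y)) <= K * (1 + `|x|).
Proof.
have [d d0 Hd] := Lam_cont0 ltr01.
pose eta := Num.min (2^-1) (d / 3).
have He : 0 < eta <= 2^-1 by rewrite lt_min ge_min lexx invr_gt0 ltr0n divr_gt0.
have [K K0 HK] := kern_bound Hal He.
pose K1 := nc (Lam (zal al)) + 1.
pose K2 := pi * (`|a| + `|a - b|) * K + 2 * pi * `|affm| * K.
have pi0 : 0 < pi :> R := pi_gt0 R.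
have K10 : 0 < K1 by rewrite ltr_wpDl// nc_ge0.
have [pi00 K00] := (ltW pi0, ltW K0).
have K20 : 0 <= K2 by rewrite /K2 addr_ge0// !mulr_ge0// addr_ge0.
exists (K1 + K2); first by rewrite ltr_wpDr.
move=> x y y01; have x0 : 0 <= `|x| by [].
have [far|] := boolP ((eta <= `|x|) || (eta <= `|y - al|)); last first.
  rewrite negb_or -!ltNge => /andP[ex ey].
  have e3 : eta <= d / 3 by rewrite ge_min lexx orbT.
  have h : nc (Lam (x +i* y) - Lam (zal al)) <= 1.
    have -> : x +i* y = zal al + (x +i* (y - al)) by apply: complex_eqE => /=; ring.
    by apply: Hd; rewrite (le_lt_trans (nc_le_ReIm _))//=; lra.
  have : nc (Lam (x +i* y)) <= K1.
    by rewrite -[Lam _](subrK (Lam (zal al))) (le_trans (ncD _ _))// addrC lerD2l.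
  move=> /le_trans; apply; apply: (@le_trans _ _ ((K1 + K2) * 1)).
    by rewrite mulr1 lerDl.
  by rewrite ler_wpM2l ?lerDl// addr_ge0// ltW.
have {}far : eta <= `|x| \/ eta <= `|y - al| by apply/orP.
have [kb sb] := HK x y y01 far.
have [y0 y1] := andP y01.
have e0 : 0 < eta by case/andP: He.
rewrite LamE; last first.
  case=> ex ey; case: far; rewrite ?ex ?ey ?subrr ?normr0; lra.
(* The constant term divided by [D] is a multiple of [kern al], since [kern al] is [sal al / 2] over
   [D]. *)
have -> : lamnum (x +i* y) / D al (x +i* y) =
  - piC R * (affk (x +i* y) * (csinh (piC R * (x +i* y)) / D al (x +i* y)))
  + piC R * ci * (2 * affm)%:C * kern al (x +i* y).
  rewrite /lamnum /kern.
  have -> : (2 * affm)%:C = 2 * affm%:C :> R[i] by rewrite rmorphM rmorph_nat.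
  have -> : (sal al / 2)%:C = (sal al)%:C / 2 :> R[i] by rewrite rmorphM fmorphV rmorph_nat.
  by rewrite rmorphM; move: (D al _)^-1 => i; field.
have na : nc (affk (x +i* y)) <= (`|a| + `|a - b|) * (1 + `|x|).
  rewrite /affk (le_trans (ncD _ _))// !ncM nc_i mul1r !nc_real.
  have nxy : nc (x +i* y) <= 1 + `|x|.
    by rewrite (le_trans (nc_le_ReIm _))//= addrC lerD2r ger0_norm.
  rewrite mulrDl lerD//; first by rewrite ler_peMr// lerDl.
  by rewrite ler_wpM2l.
have kb1 : nc (kern al (x +i* y)) <= K.
  rewrite (le_trans kb)// ler_piMr ?(ltW K0)// exprn_ile1 ?wt_ge0 ?wt_le1//.
have gen (A q k : R[i]) : nc A <= (`|a| + `|a - b|) * (1 + `|x|) -> nc q <= K -> nc k <= K ->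
    nc (- piC R * (A * q) + piC R * ci * (2 * affm)%:C * k) <= (K1 + K2) * (1 + `|x|).
  move=> hA hq hk.
  rewrite (le_trans (ncD _ _))// !ncM ncN nc_i mulr1 !nc_real (gtr0_norm pi0) normrM ger0_norm//.
  apply: (@le_trans _ _ (K2 * (1 + `|x|))); last first.
    by rewrite ler_wpM2r ?addr_ge0// lerDr ltW.
  have -> : K2 * (1 + `|x|) = pi * (`|a| + `|a - b|) * K * (1 + `|x|) + 2 * pi * `|affm| * K * (1 + `|x|).
    by rewrite /K2; ring.
  apply: lerD.
    have -> : pi * (`|a| + `|a - b|) * K * (1 + `|x|) = pi * ((`|a| + `|a - b|) * (1 + `|x|) * K) by ring.
    by rewrite ler_wpM2l// ler_pM ?nc_ge0.
  have -> : pi * (2 * `|affm|) * nc k = 2 * pi * `|affm| * nc k by ring.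
  apply: (@le_trans _ _ (2 * pi * `|affm| * K)).
    by rewrite ler_wpM2l// !mulr_ge0.
  by rewrite ler_peMr ?lerDl// !mulr_ge0.
exact: gen.
Qed.

(* [Psi] is a holomorphic logarithm of the extremal function: [affine]
   corrections with real part supported on one boundary line adjust the
   constants of integration. *)
Lemma exponent_exists (b0 b1 : R) : exists (Psi L : R[i] -> R[i]) (K r : R), 0 < K /\
  [/\ forall x y, 0 <= y <= 1 -> cderiv Psi (x +i* y) (L (x +i* y)),
     forall x y, 0 <= y <= 1 -> nc (L (x +i* y)) <= K * (1 + `|x|),
     forall x y, 0 <= y <= 1 -> `|complex.Re (Psi (x +i* y))| <= K * (1 + `|x|) &
     forall x y, 0 <= y <= 1 -> nc (Psi (x +i* y)) <= K * (1 + x ^+ 2)] /\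
  [/\ forall x, complex.Re (Psi (x +i* 0)) = a * ln (poisson al x) + b0,
     forall x, complex.Re (Psi (x +i* 1)) = b * ln (poisson (1 - al) x) + b1 &
     forall z, z <> zal al -> L z = lamnum z / D al z + ci * r%:C].
Proof.
(* This open strip contains the closed one, so that [H] is complex differentiable on the boundary
   lines too, yet it avoids the other zeros of [D]. *)
have [H dH] : exists H, forall x y, - (al / 2) < y < 1 + (1 - al) / 2 ->
    cderiv H (x +i* y) (Lam (x +i* y)).
  have rng y : - (al / 2) <= y <= 1 + (1 - al) / 2 -> - al < y < 2 - al.
    by have := al0; have := al1; lra.
  apply: (@strip_primitive _ Lam _ _ 0 al).
  - by have := al0; have := al1; lra.
  - by move=> x y /rng; exact: Lam_cont.
  - by move=> x y /rng; exact: Lam_cderiv.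
  - by have := al0; have := al1; lra.
have rng01 y : 0 <= y <= 1 -> - (al / 2) < y < 1 + (1 - al) / 2.
  by have := al0; have := al1; lra.
have y00 : 0 <= (0 : R) <= 1 by rewrite lexx ler01.
have y11 : 0 <= (1 : R) <= 1 by rewrite lexx ler01.
have const (f g g' : R -> R) : (forall x : R, is_derive x 1 f (g' x)) ->
    (forall x : R, is_derive x 1 g (g' x)) -> exists c, forall x, f x = g x + c.
  move=> df dg; exists (f 0 - g 0) => x.
  have d0 (t : R) : is_derive t 1 (fun t => f t - g t) 0.
    by rewrite -[X in is_derive _ _ _ X](subrr (g' t)); apply: is_deriveB.
  have E u v : u <= v -> f u - g u = f v - g v.
    move=> uv; have := @MVT_le _ (fun t => f t - g t) (fun=> 0) u v 0 uv (fun t _ => d0 t).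
    rewrite normr0 mul0r => /(_ (fun _ _ => lexx _)).
    by rewrite normr_le0 subr_eq0 => /eqP.
  by have [h|/ltW h] := leP 0 x; [have := E _ _ h|have := E _ _ h]; lra.
have dr0 (x : R) : is_derive x 1 (fun t => a * ln (poisson al t)) (complex.Re (Lam (x +i* 0))).
  by rewrite Re_Lam0; apply: is_deriveZ; exact: is_derive_ln_poisson.
have dr1 (x : R) : is_derive x 1 (fun t => b * ln (poisson (1 - al) t)) (complex.Re (Lam (x +i* 1))).
  rewrite Re_Lam1 -[cal al]opprK -cal_sym; apply: is_deriveZ.
  exact: (is_derive_ln_poisson (Hal' Hal)).
have [c0 H0] := const (fun x => complex.Re (H (x +i* 0)))
  (fun x => a * ln (poisson al x)) (fun x => complex.Re (Lam (x +i* 0)))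
  (fun x => (cderiv_x (dH x 0 (rng01 _ y00))).1) dr0.
have [c1 H1] := const (fun x => complex.Re (H (x +i* 1)))
  (fun x => b * ln (poisson (1 - al) x)) (fun x => complex.Re (Lam (x +i* 1)))
  (fun x => (cderiv_x (dH x 1 (rng01 _ y11))).1) dr1.
have [K1 K10 HK1] := Lam_bound.
have [K3 K30 HK3] := ln_poisson_bound Hal.
(* The correction [p * (1 + ci * z) - q * (ci * z)] has real part [p * (1 - y) + q * y] and
   derivative [ci * r]; it replaces the constants [c0] and [c1] of integration by [b0] and [b1]. *)
pose p := b0 - c0; pose q := b1 - c1; pose r := p - q.
pose Psi z := H z + (p%:C * (1 + ci * z) - q%:C * (ci * z)).
pose L z := Lam z + ci * r%:C.
have dPsi x y : 0 <= y <= 1 -> cderiv Psi (x +i* y) (L (x +i* y)).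
  move=> y01; apply: cderivD; first exact/dH/rng01.
  have d1 z : cderiv (fun w => ci * w) z ci by have := cderivMl ci (cderiv_id z); rewrite mulr1.
  have := cderivB (cderivMl p%:C (cderivD (cderiv_cst 1 (x +i* y)) (d1 _))) (cderivMl q%:C (d1 (x +i* y))).
  by congr cderiv; rewrite (rmorphB _ p q : r%:C = p%:C - q%:C); ring.
pose KL := K1 + `|r|.
have KL0 : 0 <= KL by rewrite addr_ge0// ltW.
have LK x y : 0 <= y <= 1 -> nc (L (x +i* y)) <= KL * (1 + `|x|).
  move=> y01; rewrite (le_trans (ncD _ _))// nc_iM nc_real mulrDl lerD ?HK1//.
  by rewrite ler_peMr// lerDl.
have Re0 x : complex.Re (Psi (x +i* 0)) = a * ln (poisson al x) + b0.
  rewrite /Psi Re_add (H0 x) -addrA; congr (_ + _); rewrite /p /=; ring.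
have Re1 x : complex.Re (Psi (x +i* 1)) = b * ln (poisson (1 - al) x) + b1.
  rewrite /Psi Re_add (H1 x) -addrA; congr (_ + _); rewrite /q /=; ring.
(* The real part is known explicitly on [y = 0], so this vertical step keeps its growth linear. For
   the full modulus [L] must also be integrated along [y = 0], which makes the growth quadratic. *)
have vert x y : 0 <= y <= 1 -> nc (Psi (x +i* y) - Psi (x +i* 0)) <= 2 * KL * (1 + `|x|).
  move=> /andP[y0 y1].
  have := @rMVT _ (fun t => Psi (x +i* t)) (fun t => ci * L (x +i* t)) 0 y (KL * (1 + `|x|)) y0.
  rewrite subr0 mulrA => H2; apply: le_trans (H2 _ _) _.
  - move=> t /andP[t0 ty]; apply: cderiv_y; apply: dPsi; rewrite t0/=; exact: le_trans ty y1.
  - move=> t /andP[t0 ty]; rewrite nc_iM; apply: LK; rewrite t0/=; exact: le_trans ty y1.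
  - by rewrite ler_piMr// !mulr_ge0// addr_ge0.
have hor x : nc (Psi (x +i* 0) - Psi (0 +i* 0)) <= 2 * KL * (1 + `|x|) * `|x|.
  have := @rMVT_abs _ (fun t => Psi (t +i* 0)) (fun t => L (t +i* 0)) 0 x (KL * (1 + `|x|)).
  rewrite subr0 mulrA; apply => t; rewrite subr0 => tx.
    exact/cderiv_x/dPsi.
  by apply: le_trans (LK _ _ y00) _; rewrite ler_wpM2l// lerD2l.
pose P0 := nc (Psi (0 +i* 0)).
have P00 : 0 <= P0 := nc_ge0 _.
pose K := KL + (`|a| * K3 + `|b0| + 2 * KL) + (P0 + 4 * KL) + 1.
have A0 : 0 <= `|a| * K3 by rewrite mulr_ge0// ltW.
have B0 : 0 <= `|b0| by [].
exists Psi, L, K, r; split; first by rewrite /K; lra.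
split; split => //.
- move=> x y y01; apply: le_trans (LK x y y01) _; rewrite ler_wpM2r ?addr_ge0// /K; lra.
- move=> x y y01.
  apply: (@le_trans _ _ ((`|a| * K3 + `|b0| + 2 * KL) * (1 + `|x|))); last first.
    by rewrite ler_wpM2r ?addr_ge0// /K; lra.
  have -> : complex.Re (Psi (x +i* y)) = complex.Re (Psi (x +i* y) - Psi (x +i* 0)) + complex.Re (Psi (x +i* 0)).
    by rewrite Re_sub subrK.
  rewrite addrC mulrDl (le_trans (ler_normD _ _))// lerD//; last first.
    exact: le_trans (Re_le_nc _) (vert _ _ y01).
  rewrite Re0 mulrDl (le_trans (ler_normD _ _))// lerD//; last by rewrite ler_peMr// lerDl.
  by rewrite normrM -mulrA ler_wpM2l.
- move=> x y y01.
  have x0 : 0 <= `|x| by [].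
  have x2 : 0 <= x ^+ 2 by exact: sqr_ge0.
  have xx : `|x| ^+ 2 = x ^+ 2 by rewrite real_normK// num_real.
  apply: (@le_trans _ _ ((P0 + 4 * KL) * (1 + x ^+ 2))); last first.
    by rewrite ler_wpM2r ?addr_ge0// /K; lra.
  have -> : Psi (x +i* y) = (Psi (x +i* y) - Psi (x +i* 0)) + (Psi (x +i* 0) - Psi (0 +i* 0)) + Psi (0 +i* 0) by ring.
  rewrite (le_trans (ncD _ _))// addrC mulrDl lerD//.
    by rewrite -/P0 ler_peMr// lerDl.
  rewrite (le_trans (ncD _ _))// (le_trans (lerD (vert _ _ y01) (hor _)))//.
  have -> : 2 * KL * (1 + `|x|) + 2 * KL * (1 + `|x|) * `|x| = 4 * KL * ((1 + `|x|) ^+ 2 / 2).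
    by field.
  rewrite ler_wpM2l ?mulr_ge0//.
  have := sqr_ge0 (`|x| - 1); rewrite sqrrB sqrrD xx expr1n mul1r; lra.
- by move=> z ne; rewrite /L LamE.
Qed.

End Exponent.

(** * Gaussian damping *)

Section Damped.
Variables (R : realType) (al : R) (Hal : 0 < al < 1).
Local Open Scope complex_scope.
Implicit Types (x y : R) (z w : R[i]).
Variables (Psi L : R[i] -> R[i]) (K : R).
Hypothesis K0 : 0 < K.
Hypothesis dPsi : forall x y, 0 <= y <= 1 -> cderiv Psi (x +i* y) (L (x +i* y)).
Hypothesis LK : forall x y, 0 <= y <= 1 -> nc (L (x +i* y)) <= K * (1 + `|x|).
Hypothesis ReK : forall x y, 0 <= y <= 1 -> `|complex.Re (Psi (x +i* y))| <= K * (1 + `|x|).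
Variable eps : R.
Hypothesis eps0 : 0 < eps.

Let al0 : 0 < al. Proof. by case/andP: Hal. Qed.
Let al1 : al < 1. Proof. by case/andP: Hal. Qed.

(** The sign -1 gives the factor multiplied with [h] in Cauchy's formula, the sign 1 the nearly
    extremal function of the lower bound. The Gaussian is the same in both. *)
Definition damp (sg : R) z : R[i] := cexp (sg%:C * Psi z - eps%:C * (z * z)).
Definition damp' (sg : R) z : R[i] := (sg%:C * L z - eps%:C * (z + z)) * damp sg z.

Lemma cderiv_damp sg x y : 0 <= y <= 1 -> cderiv (damp sg) (x +i* y) (damp' sg (x +i* y)).
Proof.
move=> y01; rewrite /damp' mulrC.
have d1 := cderivM (cderiv_id (x +i* y)) (cderiv_id (x +i* y)).
have := cderivB (cderivMl sg%:C (dPsi x y01)) (cderivMl eps%:C d1).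
rewrite mul1r mulr1 => d2; exact: cderiv_comp d2 (cderiv_cexp _).
Qed.

Lemma nc_damp sg x y : nc (damp sg (x +i* y)) =
  expR (sg * complex.Re (Psi (x +i* y)) - eps * (x ^+ 2 - y ^+ 2)).
Proof.
rewrite /damp nc_cexp; congr expR; rewrite Re_sub; case: (Psi _) => p q /=; ring.
Qed.

Lemma damp_bound sg m : `|sg| <= 1 -> exists2 C : R, 0 < C & forall x y, 0 <= y <= 1 ->
  nc (damp sg (x +i* y)) <= C * wt x ^+ m /\ nc (damp' sg (x +i* y)) <= C * wt x ^+ m.
Proof.
move=> sg1.
(* One power of [wt] more than claimed: it absorbs the polynomial factor that multiplies [damp] in
   [damp']. *)
have [C1 C10 HC1] := expR_gauss m.+1 (ltW K0) eps0.
pose C2 := C1 * expR (K + eps).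
have C20 : 0 < C2 by rewrite mulr_gt0 ?expR_gt0.
pose C3 := 2 * K + 4 * eps.
have C30 : 0 <= C3 by rewrite addr_ge0// mulr_ge0// ltW.
have main x y : 0 <= y <= 1 -> nc (damp sg (x +i* y)) * (1 + x ^+ 2) ^+ m.+1 <= C2.
  move=> y01; have [y0 y1] := andP y01.
  rewrite nc_damp; apply: (@le_trans _ _ ((1 + x ^+ 2) ^+ m.+1 * expR (K * `|x| - eps * x ^+ 2) * expR (K + eps))).
    rewrite mulrC -mulrA -expRD ler_wpM2l ?exprn_ge0 ?(ltW (wt_den _))// ler_expR.
    have h1 : sg * complex.Re (Psi (x +i* y)) <= K * (1 + `|x|).
      rewrite (le_trans (ler_norm _))// normrM -[leRHS]mul1r.
      by rewrite ler_pM// ReK.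
    have h2 : y ^+ 2 <= 1 by rewrite exprn_ile1.
    have h3 : eps * y ^+ 2 <= eps * 1 by rewrite ler_wpM2l// ltW.
    rewrite mulrDr mulr1 in h1; rewrite mulrBr; lra.
  by rewrite ler_wpM2r ?expR_ge0.
exists (C2 * (1 + C3)); first by rewrite mulr_gt0// ltr_wpDr.
move=> x y y01; have [y0 y1] := andP y01.
have W0 := wt_den x.
have W1 : 1 <= 1 + x ^+ 2 by rewrite lerDl sqr_ge0.
have e1 : nc (damp sg (x +i* y)) <= C2 * wt x ^+ m.+1.
  by rewrite /wt exprVn ler_pdivlMr ?exprn_gt0// main.
have wm : wt x ^+ m.+1 <= wt x ^+ m.
  by rewrite exprS ler_piMl ?exprn_ge0 ?wt_ge0 ?wt_le1.
split.
  apply: (le_trans e1); rewrite -mulrA ler_wpM2l ?(ltW C20)//.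
  by rewrite (le_trans wm)// ler_peMl ?exprn_ge0 ?wt_ge0// lerDl.
have x1 := norm_le_den x.
have e2 : nc (sg%:C * L (x +i* y) - eps%:C * ((x +i* y) + (x +i* y))) <= C3 * (1 + x ^+ 2).
  rewrite (le_trans (ncB _ _))// !ncM !nc_real (gtr0_norm eps0).
  have nz : nc (x +i* y) <= 1 + `|x|.
    by rewrite (le_trans (nc_le_ReIm _))//= addrC lerD2r ger0_norm.
  have a1 : `|sg| * nc (L (x +i* y)) <= K * (2 * (1 + x ^+ 2)).
    rewrite -[leRHS]mul1r ler_pM ?nc_ge0// (le_trans (LK x y01))// ler_wpM2l// ltW//.
  have a2 : eps * nc ((x +i* y) + (x +i* y)) <= eps * (2 * (2 * (1 + x ^+ 2))).
    rewrite ler_wpM2l ?(ltW eps0)// (le_trans (ncD _ _))//; lra.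
  rewrite /C3; lra.
rewrite /damp' ncM.
apply: (@le_trans _ _ (C3 * (1 + x ^+ 2) * (C2 * wt x ^+ m.+1))).
  by rewrite ler_pM ?nc_ge0.
have -> : C3 * (1 + x ^+ 2) * (C2 * wt x ^+ m.+1) = C2 * C3 * wt x ^+ m.
  transitivity (C2 * C3 * wt x ^+ m * ((1 + x ^+ 2) * wt x)); first by rewrite [wt x ^+ m.+1]exprS; ring.
  by rewrite wtK mulr1.
rewrite ler_wpM2r ?exprn_ge0 ?wt_ge0// ler_wpM2l ?(ltW C20)//; lra.
Qed.

Lemma vertical_lipschitz (F F' : R[i] -> R[i]) x y1 y2 C : y1 <= y2 ->
  (forall y, y1 <= y <= y2 -> cderiv F (x +i* y) (F' (x +i* y))) ->
  (forall y, y1 <= y <= y2 -> nc (F' (x +i* y)) <= C) ->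
  nc (F (x +i* y2) - F (x +i* y1)) <= 2 * C * (y2 - y1).
Proof.
move=> y12 dF CF; apply: (@rMVT _ (fun y => F (x +i* y)) (fun y => ci * F' (x +i* y))) => //.
  by move=> y /dF; exact: cderiv_y.
by move=> y /CF; rewrite nc_iM.
Qed.

Definition tker z : R[i] := damp (-1) z * kern al z.
Definition tker' z : R[i] := damp' (-1) z * kern al z +
  damp (-1) z * (- (piC R * csinh (piC R * z)) / D al z * kern al z).

Lemma cderiv_tker x y : 0 <= y <= 1 -> x +i* y <> zal al ->
  cderiv tker (x +i* y) (tker' (x +i* y)).
Proof.
move=> y01 ne; apply: cderivM; first exact: cderiv_damp.
apply: cderiv_kern; apply: D_neq0 => //; have := al0; have := al1; lra.
Qed.

Lemma tker_bound eta : 0 < eta <= 2^-1 -> exists2 C : R, 0 < C & forall x y,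
  0 <= y <= 1 -> eta <= `|x| \/ eta <= `|y - al| ->
  nc (tker (x +i* y)) <= C * wt x ^+ 2 /\ nc (tker' (x +i* y)) <= C * wt x ^+ 2.
Proof.
move=> He; have [C C0 HC] := @damp_bound (-1) 2 ltac:(by rewrite normrN1).
have [k k0 Hk] := kern_bound Hal He.
have pi0 : 0 < pi :> R := pi_gt0 R.
have C1 : 0 < C * k by rewrite mulr_gt0.
have C2 : 0 < C * (pi * k * k) by rewrite !mulr_gt0.
exists (C * k + (C * k + C * (pi * k * k))); first by lra.
move=> x y y01 far; have [d1 d2] := HC x y y01; have [k1 k2] := Hk x y y01 far.
have {}k1 : nc (kern al (x +i* y)) <= k.
  by rewrite (le_trans k1)// ler_piMr ?(ltW k0)// exprn_ile1 ?wt_ge0 ?wt_le1.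
have w2 : 0 <= wt x ^+ 2 by rewrite exprn_ge0 ?wt_ge0.
have e1 : nc (tker (x +i* y)) <= C * k * wt x ^+ 2.
  by rewrite /tker ncM mulrAC ler_pM ?nc_ge0.
split; first by rewrite (le_trans e1)// ler_wpM2r//; lra.
rewrite /tker' (le_trans (ncD _ _))//.
apply: (@le_trans _ _ ((C * k + C * (pi * k * k)) * wt x ^+ 2)); last first.
  by rewrite ler_wpM2r//; lra.
rewrite mulrDl lerD//.
  by rewrite ncM mulrAC ler_pM ?nc_ge0.
have e3 : nc (- (piC R * csinh (piC R * (x +i* y))) / D al (x +i* y) * kern al (x +i* y)) <= pi * k * k.
  have -> : - (piC R * csinh (piC R * (x +i* y))) / D al (x +i* y) * kern al (x +i* y) =
    - piC R * ((csinh (piC R * (x +i* y)) / D al (x +i* y)) * kern al (x +i* y)) by ring.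
  move: k2 k1; move: (csinh _ / _) (kern al _) => p q hp hq.
  by rewrite !ncM ncN nc_real gtr0_norm// -mulrA ler_wpM2l ?(ltW pi0)// ler_pM ?nc_ge0.
have -> : C * (pi * k * k) * wt x ^+ 2 = C * wt x ^+ 2 * (pi * k * k) by ring.
by rewrite ncM ler_pM ?nc_ge0.
Qed.

(** Both heights lie on the same side of the pole at distance [eta], so the whole vertical segment
    does. The integrable weight lets the test function be moved between lines under the integral,
    see [line_shift]. *)
Lemma tker_lipschitz eta : 0 < eta <= 2^-1 -> exists2 C : R, 0 < C & forall x y1 y2,
  0 <= y1 -> y1 <= y2 -> y2 <= 1 -> y2 <= al - eta \/ al + eta <= y1 ->
  nc (tker (x +i* y2) - tker (x +i* y1)) <= C * (y2 - y1) * wt x.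
Proof.
move=> He; have [C C0 HC] := tker_bound He.
have e0 : 0 < eta by case/andP: He.
exists (2 * C); first by rewrite mulr_gt0.
move=> x y1 y2 h0 h12 h1 side.
apply: (@le_trans _ _ (2 * (C * wt x ^+ 2) * (y2 - y1))).
  have sd y : y1 <= y <= y2 -> 0 <= y <= 1 /\ eta <= `|y - al|.
    move=> /andP[a b]; split; first by rewrite (le_trans h0 a) (le_trans b h1).
    by case: side => s; rewrite ler_normr; apply/orP; [right|left]; lra.
  apply: (vertical_lipschitz h12) => y /sd[y01 far].
    apply: cderiv_tker => //; apply: line_neq_zal; apply/eqP => e.
    by move: far; rewrite e subrr normr0; lra.
  by have [_] := HC x y y01 (or_intror far).
have -> : 2 * (C * wt x ^+ 2) * (y2 - y1) = 2 * C * (y2 - y1) * wt x * wt x by ring.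
by rewrite ler_piMr ?wt_le1// !mulr_ge0 ?wt_ge0 ?subr_ge0// ltW.
Qed.

End Damped.

(** * Passage to the boundary *)

Section Growth.
Variable R : realType.
Local Open Scope complex_scope.
Notation mu := (@lebesgue_measure R).
Notation "'rintegrable' f" := (mu.-integrable [set: R] (EFin \o f)) (at level 10, f at level 9).
Implicit Types (x y : R) (z w : R[i]).

(** Between 0 and [x] the reciprocal of [wt] is at most [1 + x ^ 2], so the integral of [g] there is
    at most that factor times the weighted integral. *)
Lemma real_growth (f g F : R -> R) N : continuous f -> (forall x, `|f x| <= g x) ->
  rintegrable (fun x => g x * wt x) -> \int[mu]_x (g x * wt x) <= N ->
  (forall x : R, is_derive x 1 F (f x)) -> forall x, `|F x - F 0| <= (1 + x ^+ 2) * N.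
Proof.
move=> cf fg ig gN dF x.
have cF t : {for t, continuous F}.
  by apply: differentiable_continuous; apply/derivable1_diffP; have [] := dF t.
have g0 t : 0 <= g t by exact: le_trans (fg t).
have FTC u v : u < v -> F v - F u = \int[mu]_(t in `[u, v]) f t.
  move=> uv; rewrite /Rintegral (@continuous_FTC2 _ f F u v)//.
  - exact: continuous_subspaceT.
  - split.
    + by move=> t _; have [] := dF t.
    + by apply: cvg_at_right_filter; exact: cF.
    + by apply: cvg_at_left_filter; exact: cF.
  - by move=> t _; rewrite derive1E (@derive_val _ _ _ _ _ _ _ (dF t)).
have key u v (M : R) : u < v -> (forall t, u <= t <= v -> 1 + t ^+ 2 <= M) -> `|F v - F u| <= M * N.
  move=> uv hM.
  have M0 : 0 < M by apply: lt_le_trans (wt_den u) (hM u _); rewrite lexx ltW.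
  have iu : mu.-integrable `[u, v] (EFin \o f) by exact: continuous_integrable.
  have i2 : mu.-integrable `[u, v] (EFin \o (fun t => g t * wt t)).
    exact: integrableS ig.
  rewrite FTC// (le_trans (le_normr_Rintegral _ iu))//.
  apply: (@le_trans _ _ (\int[mu]_(t in `[u, v]) (M * (g t * wt t)))).
    apply: le_Rintegral => //.
    - exact: (integrable_norm iu).
    - exact: integrableS (rintegrableZ M ig).
    - move=> t; rewrite /= in_itv/= => tuv; rewrite (le_trans (fg t))//.
      have h := hM t tuv.
      rewrite mulrCA ler_peMr// /wt ler_pdivlMr ?wt_den// mul1r//.
  rewrite RintegralZl// ler_wpM2l ?(ltW M0)// (le_trans _ gN)//.
  rewrite Rintegral_mkcond; apply: le_rint => //.
    by rewrite -restrict_EFin; apply/integrable_restrict => //=; rewrite setTI.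
  move=> t; rewrite patchE; case: ifPn => // _.
  by rewrite mulr_ge0 ?wt_ge0.
have xx (t : R) : `|t| <= `|x| -> 1 + t ^+ 2 <= 1 + x ^+ 2.
  by move=> h; rewrite lerD2l -[leLHS]real_normK ?num_real// -[leRHS]real_normK ?num_real// lerXn2r ?nnegrE.
have [x0|x0|<-] := ltgtP 0 x.
- apply: key => // t /andP[t0 tx]; apply: xx; rewrite !ger0_norm// ltW//.
- rewrite distrC; apply: key => // t /andP[t0 tx]; apply: xx.
  by rewrite !ler0_norm ?lerN2// ltW.
- rewrite subrr normr0 mulr_ge0 ?(ltW (wt_den _))//.
  by apply: le_trans gN; apply: Rintegral_ge0 => t _; rewrite mulr_ge0 ?wt_ge0.
Qed.

Lemma complex_growth (f F : R -> R[i]) N : (forall x, rcont f x) ->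
  rintegrable (fun x => nc (f x) * wt x) -> \int[mu]_x (nc (f x) * wt x) <= N ->
  (forall x, rderiv F x (f x)) -> forall x, nc (F x - F 0) <= 2 * N * (1 + x ^+ 2).
Proof.
move=> cf ig gN dF x.
have h1 := @real_growth _ _ _ N (fun x => (cf x).1) (fun x => Re_le_nc (f x)) ig gN (fun x => (dF x).1) x.
have h2 := @real_growth _ _ _ N (fun x => (cf x).2) (fun x => Im_le_nc (f x)) ig gN (fun x => (dF x).2) x.
rewrite (le_trans (nc_le_ReIm _))// Re_sub Im_sub (le_trans (lerD h1 h2))//.
by rewrite -mulrA mulr_natl mulr2n mulrC lerD// mulrC.
Qed.

Lemma rcont_bounded (f : R -> R[i]) a b : a <= b -> (forall x, a <= x <= b -> rcont f x) ->
  exists2 C, 0 <= C & forall x, a <= x <= b -> nc (f x) <= C.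
Proof.
move=> ab cf.
have bnd (u : R -> R) : (forall x, a <= x <= b -> {for x, continuous u}) ->
    exists C, forall x, a <= x <= b -> `|u x| <= C.
  move=> cu.
  have c : {within `[a, b], continuous (fun x => `|u x|)}.
    apply: continuous_in_subspaceT => x /set_mem /=; rewrite in_itv/= => xab.
    by apply: continuous_comp; [exact: cu|exact: norm_continuous].
  have [c0 _ Hc] := EVT_max ab c.
  by exists `|u c0| => x xab; apply: Hc; rewrite in_itv.
have [C1 H1] := bnd _ (fun x xab => (cf x xab).1).
have [C2 H2] := bnd _ (fun x xab => (cf x xab).2).
exists (C1 + C2).
  have aab : a <= a <= b by rewrite lexx.
  by rewrite addr_ge0// ?(le_trans (normr_ge0 _) (H1 _ aab)) ?(le_trans (normr_ge0 _) (H2 _ aab)).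
move=> x xab; rewrite (le_trans (nc_le_ReIm _))// lerD ?H1 ?H2//.
Qed.

End Growth.

Lemma small_pos (R : realType) (r d e k : R) : 0 < r -> 0 < d -> 0 < e -> 0 < k ->
  exists2 a : R, 0 < a & [/\ a < r, a < d, a < e & a < k].
Proof.
move=> r0 d0 e0 k0; pose m := Num.min (Num.min r d) (Num.min e k).
have m0 : 0 < m by rewrite !lt_min r0 d0 e0 k0.
exists (m / 2); first by rewrite divr_gt0.
have mm : m / 2 < m by lra.
by split; apply: (lt_le_trans mm); rewrite !ge_min !lexx ?orbT.
Qed.

Lemma fifths (R : realType) (c : R) : 0 < c -> c / 5 + c / 5 + c / 5 + c / 5 < c.
Proof. lra. Qed.

Lemma nc_telescope (R : realType) (a a' u b b' v : R[i]) (e : R) :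
  nc (a - a') <= e -> nc (a' - u) <= e -> nc (b - b') <= e -> nc (b' - v) <= e ->
  nc (u - v - (a - b)) <= e + e + e + e.
Proof.
move=> h1 h2 h3 h4.
have -> : u - v - (a - b) = - (a - a') + - (a' - u) + (b - b') + (b' - v) by ring.
by apply: le_trans (ncD4 _ _ _ _) _; rewrite !ncN !lerD.
Qed.

Section BoundaryCauchy.
Variables (R : realType) (al : R) (Hal : 0 < al < 1).
Local Open Scope complex_scope.
Notation mu := (@lebesgue_measure R).
Notation "'rintegrable' f" := (mu.-integrable [set: R] (EFin \o f)) (at level 10, f at level 9).
Implicit Types (x y : R) (z w : R[i]).
Variables (Psi L : R[i] -> R[i]) (K : R).
Hypothesis K0 : 0 < K.
Hypothesis dPsi : forall x y, 0 <= y <= 1 -> cderiv Psi (x +i* y) (L (x +i* y)).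
Hypothesis LK : forall x y, 0 <= y <= 1 -> nc (L (x +i* y)) <= K * (1 + `|x|).
Hypothesis ReK : forall x y, 0 <= y <= 1 -> `|complex.Re (Psi (x +i* y))| <= K * (1 + `|x|).
Variable eps : R.
Hypothesis eps0 : 0 < eps.
Variables (h : R[i] -> R[i]) (N : R).
Hypothesis dh : forall x y, 0 < y < 1 -> exists l, cderiv h (x +i* y) l.
Hypothesis ih : forall y, 0 < y < 1 -> rintegrable (fun x => nc (h (x +i* y)) * wt x).
Hypothesis hN : forall y, 0 < y < 1 -> \int[mu]_x (nc (h (x +i* y)) * wt x) <= N.

Let al0 : 0 < al. Proof. by case/andP: Hal. Qed.
Let al1 : al < 1. Proof. by case/andP: Hal. Qed.
Let T := tker al Psi eps.
Let T' := tker' al Psi L eps.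

Let N0 : 0 <= N.
Proof. by apply: le_trans (hN Hal); apply: Rintegral_ge0 => t _; rewrite mulr_ge0 ?nc_ge0 ?wt_ge0. Qed.

Lemma wt_small C e : 0 < e -> exists X : R, forall x, X <= `|x| -> 1 <= `|x| /\ C * wt x <= e.
Proof.
move=> e0; exists (1 + `|C| / e) => x xX.
have P : 0 <= `|C| / e by rewrite divr_ge0// ltW.
have x1 : 1 <= `|x| by lra.
have x0 : 0 < `|x| by lra.
split => //; apply: (@le_trans _ _ (`|C| * `|x|^-1)).
  apply: (@le_trans _ _ (`|C| * wt x)); first by rewrite ler_wpM2r ?wt_ge0// ler_norm.
  by rewrite ler_wpM2l// -wt_norm wt_le_inv.
by rewrite ler_pdivrMr// [e * _]mulrC -ler_pdivrMr//; lra.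
Qed.

Let ch x y : 0 < y < 1 -> ccont h (x +i* y).
Proof. by move=> /(dh x)[l /cderiv_cont]. Qed.

Let dT x y : 0 <= y <= 1 -> x +i* y <> zal al -> cderiv T (x +i* y) (T' (x +i* y)).
Proof. exact: cderiv_tker. Qed.

(* The primitive of [h] has polynomial growth, so that an integration by parts
   along the vertical side only leaves small terms. *)
Lemma h_vertical a b : 0 < a -> a <= b -> b < 1 -> vertical_vanish (fun z => h z * T z) a b.
Proof.
move=> a0 ab b1.
(* The primitive lives on a slightly larger strip, still inside the open one, so that it is
   differentiable on the lines [a] and [b]. *)
have [H dH] : exists H, forall x y, a / 2 < y < (1 + b) / 2 -> cderiv H (x +i* y) (h (x +i* y)).
  have rng y : a / 2 <= y <= (1 + b) / 2 -> 0 < y < 1 by lra.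
  apply: (@strip_primitive _ h _ _ 0 a).
  - lra.
  - by move=> x y /rng; exact: ch.
  - by move=> x y /rng yy _; exact: dh.
  - lra.
have rab y : a <= y <= b -> a / 2 < y < (1 + b) / 2 by lra.
have r01 y : a <= y <= b -> 0 < y < 1 by lra.
have [C0 C00 HC0] := @rcont_bounded _ (fun y => H (0 +i* y)) a b ab
  (fun y yab => ccont_y (cderiv_cont (dH 0 y (rab y yab)))).
pose M := C0 + 2 * N.
have M0 : 0 <= M by rewrite addr_ge0// mulr_ge0.
have HM x y : a <= y <= b -> nc (H (x +i* y)) <= M * (1 + x ^+ 2).
  move=> yab.
  have := @complex_growth _ (fun t => h (t +i* y)) (fun t => H (t +i* y)) N
    (fun t => ccont_x (ch t (r01 y yab))) (ih (r01 y yab)) (hN (r01 y yab))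
    (fun t => cderiv_x (dH t y (rab y yab))) x => h1.
  have h2 := HC0 y yab.
  rewrite -[H (x +i* y)](subrK (H (0 +i* y))) (le_trans (ncD _ _))//.
  rewrite addrC /M mulrDl lerD// (le_trans h2)// ler_peMr// lerDl sqr_ge0//.
have He : 0 < (2^-1 : R) <= 2^-1 by rewrite lexx invr_gt0 ltr0n.
have [C C1 HC] := tker_bound Hal K0 LK ReK eps0 He.
move=> e e0.
have [X HX] := wt_small (4 * M * C) e0.
exists X => x /HX[x1 we] B dB.
have W0 := wt_den x.
have far : 2^-1 <= `|x| by lra.
have prod u v : nc u <= M * (1 + x ^+ 2) -> nc v <= C * wt x ^+ 2 -> nc (u * v) <= M * C * wt x.
  move=> hu hv; rewrite ncM; apply: le_trans (ler_pM (nc_ge0 _) (nc_ge0 _) hu hv) _.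
  rewrite [X in X <= _](_ : _ = M * C * wt x * ((1 + x ^+ 2) * wt x)); last by ring.
  by rewrite wtK mulr1.
have yy y : a <= y <= b -> 0 <= y <= 1 by lra.
have nz y : x +i* y <> zal al by case=> e' _; move: x1; rewrite e' normr0 ler10.
have HT y : a <= y <= b -> nc (H (x +i* y) * T (x +i* y)) <= M * C * wt x.
  by move=> yab; apply: prod; [exact: HM|exact: (HC x y (yy y yab) (or_introl far)).1].
have HT' y : a <= y <= b -> nc (H (x +i* y) * T' (x +i* y)) <= M * C * wt x.
  by move=> yab; apply: prod; [exact: HM|exact: (HC x y (yy y yab) (or_introl far)).2].
(* Integration by parts in differential form: [B - H * T] has derivative [- ci * H * T'] along the
   side, where only [H] appears, which is bounded pointwise. *)
have G : nc ((B b - H (x +i* b) * T (x +i* b)) - (B a - H (x +i* a) * T (x +i* a)))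
    <= 2 * (M * C * wt x) * (b - a).
  apply: (@rMVT _ (fun y => B y - H (x +i* y) * T (x +i* y))
    (fun y => - (ci * (H (x +i* y) * T' (x +i* y))))) => //.
    move=> y yab.
    have := rderivB (dB y yab) (cderiv_y (cderivM (dH x y (rab y yab)) (dT (yy y yab) (nz y)))).
    by congr rderiv; ring.
  by move=> y yab; rewrite ncN nc_iM; exact: HT'.
have aab : a <= a <= b by rewrite lexx.
have bab : a <= b <= b by rewrite lexx andbT.
have -> : B b - B a = ((B b - H (x +i* b) * T (x +i* b)) - (B a - H (x +i* a) * T (x +i* a)))
  + H (x +i* b) * T (x +i* b) - H (x +i* a) * T (x +i* a) by ring.
rewrite (le_trans (ncB _ _))// (le_trans (lerD (ncD _ _) (lexx _)))//.
apply: le_trans (lerD (lerD G (HT b bab)) (HT a aab)) _.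
apply: le_trans we.
have MC : 0 <= M * C * wt x by rewrite !mulr_ge0 ?wt_ge0// ltW.
rewrite [4 * M * C * wt x](_ : _ = 2 * (M * C * wt x) * 1 + M * C * wt x + M * C * wt x); last by ring.
by rewrite !lerD2r ler_wpM2l ?(mulr_ge0 _ MC)//; lra.
Qed.

Lemma cmeasurable_tker y : 0 <= y <= 1 -> y != al -> cmeasurable (fun x => T (x +i* y)).
Proof.
move=> y01 yal; apply: rcont_measurable => x; apply: ccont_x.
by apply: cderiv_cont; apply: dT => //; exact: line_neq_zal.
Qed.

Lemma tker_le y : 0 <= y <= 1 -> y != al -> exists2 C : R, 0 < C &
  forall x, nc (T (x +i* y)) <= C * wt x.
Proof.
move=> y01 yal; have [eta He far] := far_line yal.
have [C C0 HC] := tker_bound Hal K0 LK ReK eps0 He.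
exists C => // x; apply: le_trans (HC x y y01 (or_intror far)).1 _.
by rewrite ler_wpM2l ?(ltW C0)// wt_sqr_le.
Qed.

Lemma cintegrable_mul_tker (f : R -> R[i]) y : cmeasurable f ->
  rintegrable (fun x => nc (f x) * wt x) -> 0 <= y <= 1 -> y != al ->
  cintegrable (fun x => f x * T (x +i* y)).
Proof.
move=> mf i_f y01 yal; have [C C0 HC] := tker_le y01 yal.
apply: (@cintegrable_le _ _ (fun x => C * (nc (f x) * wt x))).
- by apply: cmeasurableM => //; exact: cmeasurable_tker.
- by move=> x; rewrite ncM mulrCA ler_wpM2l ?nc_ge0.
- exact: rintegrableZ.
Qed.

Let mh y : 0 < y < 1 -> cmeasurable (fun x => h (x +i* y)).
Proof. by move=> y01; apply: rcont_measurable => x; apply: ccont_x; exact: ch. Qed.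

Lemma interior_cauchy a b : 0 < a -> a < al -> al < b -> b < 1 ->
  cintegral (fun x => h (x +i* a) * T (x +i* a)) -
  cintegral (fun x => h (x +i* b) * T (x +i* b)) = h (zal al) * damp Psi eps (-1) (zal al).
Proof.
move=> a0 aal alb b1.
have a01 : 0 < a < 1 by lra.
have b01 : 0 < b < 1 by lra.
have assoc z : h z * T z = h z * damp Psi eps (-1) z * kern al z by rewrite /T /tker mulrA.
have ia : cintegrable (fun x => h (x +i* a) * T (x +i* a)).
  apply: cintegrable_mul_tker; [exact: mh|exact: ih|lra|by rewrite lt_eqF].
have ib : cintegrable (fun x => h (x +i* b) * T (x +i* b)).
  apply: cintegrable_mul_tker; [exact: mh|exact: ih|lra|by rewrite gt_eqF].
have := @kernel_cauchy R al Hal (fun z => h z * damp Psi eps (-1) z) a b (ltW a0) aal alb (ltW b1).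
rewrite (eq_cintegral (fun x => esym (assoc (x +i* a)))) (eq_cintegral (fun x => esym (assoc (x +i* b)))).
apply.
- move=> x y yab.
  have [l dl] : exists l, cderiv h (x +i* y) l by apply: dh; lra.
  eexists; apply: cderivM dl _; apply: (cderiv_damp dPsi); lra.
- exact: eq_cintegrable (fun x => assoc (x +i* a)) ia.
- exact: eq_cintegrable (fun x => assoc (x +i* b)) ib.
- have -> : (fun z => h z * damp Psi eps (-1) z * kern al z) = (fun z => h z * T z).
    by apply/funext => z; rewrite assoc.
  by apply: h_vertical => //; rewrite ltW// (lt_trans aal).
Qed.

(** Tempered convergence speaks of one fixed test function. This replaces the kernel on the line [y]
    by the one on [y0] while [h] stays on [y], using only that the weighted integrals of [h] are
    bounded uniformly. *)
Lemma line_shift y0 : 0 <= y0 <= 1 -> y0 != al -> exists C : R, exists2 eta : R, 0 < eta & 0 < C /\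
  forall y, 0 < y < 1 -> `|y - y0| < eta ->
  nc (cintegral (fun x => h (x +i* y) * T (x +i* y)) - cintegral (fun x => h (x +i* y) * T (x +i* y0)))
  <= C * `|y - y0|.
Proof.
move=> y001 y0al; have [eta He far] := far_line y0al.
have e0 : 0 < eta by case/andP: He.
have e2 : 0 < eta / 2 <= 2^-1 by lra.
have [C C0 HC] := tker_lipschitz Hal K0 dPsi LK ReK eps0 e2.
exists (C * (N + 1)); exists (eta / 2); first by lra.
split; first by rewrite mulr_gt0// ltr_wpDl.
move=> y y01 yy0.
have yal : y != al.
  by apply/eqP => e; move: yy0 far; rewrite e distrC => u v; lra.
have lip x : nc (T (x +i* y) - T (x +i* y0)) <= C * `|y - y0| * wt x.
  move: yy0 far; have [le|/ltW le] := leP y0 y.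
    rewrite ger0_norm ?subr_ge0// => yy0 far; apply: HC => //; [lra|lra|].
    by move: far; have [c|c] := leP y0 al; [rewrite ler0_norm ?subr_le0// => far; left|rewrite gtr0_norm ?subr_gt0// => far; right]; lra.
  rewrite distrC ger0_norm ?subr_ge0// => yy0 far; rewrite -ncN opprB; apply: HC => //; [lra|lra|].
  by move: far; have [c|c] := leP y0 al; [rewrite ler0_norm ?subr_le0// => far; left|rewrite gtr0_norm ?subr_gt0// => far; right]; lra.
have y01' : 0 <= y <= 1 by lra.
have i1 := cintegrable_mul_tker (mh y01) (ih y01) y01' yal.
have i2 := cintegrable_mul_tker (mh y01) (ih y01) y001 y0al.
rewrite -(cintegralB i1 i2); apply: le_trans (nc_cintegral (cintegrableB i1 i2)) _.
apply: (@le_trans _ _ (\int[mu]_x (C * `|y - y0| * (nc (h (x +i* y)) * wt x)))).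
  apply: le_rint.
  - exact/cintegrable_nc/cintegrableB.
  - exact/rintegrableZ/ih.
  - by move=> x; rewrite -mulrBr ncM mulrCA ler_wpM2l ?nc_ge0.
rewrite RintegralZl//; last exact: ih.
have -> : C * (N + 1) * `|y - y0| = C * `|y - y0| * (N + 1) by ring.
rewrite ler_wpM2l ?mulr_ge0 ?(ltW C0)//.
by apply: le_trans (hN y01) _; rewrite lerDl.
Qed.

Variables (h0 h1 : R -> R[i]).
Hypothesis lim0 : forall e : R, 0 < e -> exists2 d : R, 0 < d & forall y, 0 < y < d ->
  nc (cintegral (fun x => h (x +i* y) * T (x +i* 0)) - cintegral (fun x => h0 x * T (x +i* 0))) <= e.
Hypothesis lim1 : forall e : R, 0 < e -> exists2 d : R, 0 < d & forall y, 1 - d < y < 1 ->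
  nc (cintegral (fun x => h (x +i* y) * T (x +i* 1)) - cintegral (fun x => h1 x * T (x +i* 1))) <= e.

Lemma boundary_cauchy :
  cintegral (fun x => h0 x * T (x +i* 0)) - cintegral (fun x => h1 x * T (x +i* 1))
  = h (zal al) * damp Psi eps (-1) (zal al).
Proof.
set I0 := cintegral _; set I1 := cintegral _; set v := _ * _.
apply/eqP; rewrite -subr_eq0 -nc_eq0 eq_le nc_ge0 andbT.
rewrite leNgt; apply/negP; set c := nc _ => c0.
(* Four errors occur, a moved kernel and a tempered limit on each line; fifths of [c] make their sum
   strictly smaller than [c]. *)
have c5 : 0 < c / 5 by rewrite divr_gt0.
have y00 : 0 <= (0 : R) <= 1 by rewrite lexx ler01.
have y11 : 0 <= (1 : R) <= 1 by rewrite lexx ler01.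
have n0 : 0 != al by rewrite lt_eqF.
have n1 : 1 != al by rewrite gt_eqF.
have [d0 d00 H0] := lim0 c5.
have [d1 d10 H1] := lim1 c5.
have [C0 [e0 e00 [C00 S0]]] := line_shift y00 n0.
have [C1 [e1 e10 [C10 S1]]] := line_shift y11 n1.
have [a a0 [aal aD aE aC]] := small_pos al0 d00 e00 (divr_gt0 c5 C00).
have al1' : 0 < 1 - al by rewrite subr_gt0.
have [b' b0 [bA bD bE bC]] := small_pos al1' d10 e10 (divr_gt0 c5 C10).
pose b := 1 - b'.
have alb : al < b by rewrite /b ltrBrDl -ltrBrDr.
have b1 : b < 1 by rewrite /b gtrBl.
have a01 : 0 < a < 1 by rewrite a0 (lt_trans aal).
have b01 : 0 < b < 1 by rewrite b1 (lt_trans al0).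
have E := interior_cauchy a0 aal alb b1.
have t0 : nc (cintegral (fun x => h (x +i* a) * T (x +i* a)) - cintegral (fun x => h (x +i* a) * T (x +i* 0))) <= c / 5.
  apply: le_trans (S0 a a01 _) _; rewrite subr0 gtr0_norm//.
  by rewrite mulrC -ler_pdivlMr// ltW.
have t1 : nc (cintegral (fun x => h (x +i* b) * T (x +i* b)) - cintegral (fun x => h (x +i* b) * T (x +i* 1))) <= c / 5.
  have eb : `|b - 1| = b' by rewrite (_ : b - 1 = - b') ?normrN ?gtr0_norm// /b; ring.
  apply: le_trans (S1 b b01 _) _; rewrite eb//.
  by rewrite mulrC -ler_pdivlMr// ltW.
have ad : 0 < a < d0 by rewrite a0.
have bd : 1 - d1 < b < 1 by rewrite b1 /b ltrD2l ltrN2 bD.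
have {}H0 := H0 a ad.
have {}H1 := H1 b bd.
have : c <= c / 5 + c / 5 + c / 5 + c / 5.
  by rewrite {1}/c /v -E; exact: nc_telescope t0 H0 t1 H1.
by rewrite leNgt (fifths c0).
Qed.

End BoundaryCauchy.

(** * Schwartz functions on the boundary lines *)

Section ExponentialGrowth.
Variables (R : realType) (y : R).
Local Open Scope complex_scope.
Implicit Types (x : R) (z w : R[i]) (F G : R[i] -> R[i]).

Definition expgrow F := exists A C : R, [/\ 0 <= A, 0 <= C &
  forall x, nc (F (x +i* y)) <= C * expR (A * `|x|)].

(** Membership in the Schwartz space involves all derivatives. This class of functions with [n]
    derivatives of exponential growth on the line is closed under sums and products, and a Gaussian
    factor beats any such growth. *)
Fixpoint expgrown (n : nat) F : Prop := expgrow F /\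
  if n is m.+1 then exists2 F' : R[i] -> R[i],
    forall x, cderiv F (x +i* y) (F' (x +i* y)) & expgrown m F' else True.

Lemma expgrown0 n F : expgrown n F -> expgrow F.
Proof. by case: n => [|n] []. Qed.

Lemma expgrownS n F : expgrown n.+1 F -> expgrown n F.
Proof.
elim: n F => [|n IH] F [gF [F' dF gF']]; first by split.
by split => //; exists F' => //; exact: IH.
Qed.

Lemma expgrowM F G : expgrow F -> expgrow G -> expgrow (fun z => F z * G z).
Proof.
move=> [A [C [A0 C0 HF]]] [B [E [B0 E0 HG]]]; exists (A + B), (C * E).
split; rewrite ?addr_ge0 ?mulr_ge0// => x.
have := ler_pM (nc_ge0 _) (nc_ge0 _) (HF x) (HG x).
rewrite -ncM => /le_trans; apply.
by rewrite mulrDl expRD mulrACA.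
Qed.

Lemma expgrowD F G : expgrow F -> expgrow G -> expgrow (fun z => F z + G z).
Proof.
move=> [A [C [A0 C0 HF]]] [B [E [B0 E0 HG]]]; exists (A + B), (C + E).
split; rewrite ?addr_ge0// => x.
have mono (u v : R) : 0 <= v -> expR (u * `|x|) <= expR ((u + v) * `|x|).
  by move=> v0; rewrite ler_expR ler_wpM2r// lerDl.
rewrite (le_trans (ncD _ _))// mulrDl lerD//.
  by rewrite (le_trans (HF x))// ler_wpM2l// mono.
by rewrite (le_trans (HG x))// ler_wpM2l// addrC mono.
Qed.

Lemma expgrown_cst n c : expgrown n (fun=> c).
Proof.
have g d : expgrow (fun=> d).
  exists 0, (nc d); split; rewrite ?nc_ge0// => x.
  by rewrite mul0r expR0 mulr1.
elim: n c => [|n IH] c; split => //.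
by exists (fun=> 0) => // x; exact: cderiv_cst.
Qed.

Lemma expgrow_id : expgrow (fun z => z).
Proof.
exists 1, (1 + `|y|); split => // x.
rewrite mul1r (le_trans (nc_le_ReIm _))//=.
have h := expR_ge1Dx `|x|.
have : `|y| * 1 <= `|y| * expR `|x| by rewrite ler_wpM2l// (le_trans _ h)// lerDl.
by rewrite mulr1 mulrDl mul1r => h2; lra.
Qed.

Lemma expgrown_id n : expgrown n (fun z => z).
Proof.
case: n => [|n]; split; try exact: expgrow_id; first by [].
by exists (fun=> 1); [move=> x; exact: cderiv_id|exact: expgrown_cst].
Qed.

Lemma expgrownD n F G : expgrown n F -> expgrown n G -> expgrown n (fun z => F z + G z).
Proof.
elim: n F G => [|n IH] F G [gF dF] [gG dG]; split; try exact: expgrowD; first by [].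
have [F' dF1 dF2] := dF; have [G' dG1 dG2] := dG.
exists (fun z => F' z + G' z); last exact: IH.
by move=> x; exact: cderivD.
Qed.

Lemma expgrownM n F G : expgrown n F -> expgrown n G -> expgrown n (fun z => F z * G z).
Proof.
elim: n F G => [|n IH] F G HF HG; first by split => //; exact: expgrowM HF.1 HG.1.
have [gF [F' dF1 dF2]] := HF; have [gG [G' dG1 dG2]] := HG.
split; first exact: expgrowM.
exists (fun z => F' z * G z + F z * G' z); first by move=> x; exact: cderivM.
by apply: expgrownD; apply: IH => //; exact: expgrownS.
Qed.

(** Bootstrapping: the equation expresses the derivative of [G] through [G] itself, so a bound on
    [G] alone propagates to every order. It serves for exponentials. *)
Lemma expgrown_ode n F G : (forall m, expgrown m F) -> expgrow G ->
  (forall x, cderiv G (x +i* y) (F (x +i* y) * G (x +i* y))) -> expgrown n G.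
Proof.
move=> gF gG dG; elim: n => [|n IH]; split => //.
by exists (fun z => F z * G z) => //; exact: expgrownM.
Qed.

(** The same bootstrapping for reciprocals: the derivative of [1 / D] is [- D'] times the square of
    [1 / D]. *)
Lemma expgrown_riccati n F G : (forall m, expgrown m F) -> expgrow G ->
  (forall x, cderiv G (x +i* y) (F (x +i* y) * (G (x +i* y) * G (x +i* y)))) -> expgrown n G.
Proof.
move=> gF gG dG; elim: n => [|n IH]; split => //.
by exists (fun z => F z * (G z * G z)) => //; do 2?apply: expgrownM.
Qed.

Lemma expgrown_cexp n (s : R) : expgrown n (fun z => cexp (s%:C * z)).
Proof.
apply: (@expgrown_ode _ (fun=> s%:C)); first by move=> m; exact: expgrown_cst.
  exists `|s|, 1; split => // x; rewrite nc_cexp mul1r ler_expR/=.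
  by rewrite mul0r subr0 -normrM ler_norm.
move=> x; have := cderiv_comp (cderivMl s%:C (cderiv_id (x +i* y))) (cderiv_cexp _).
by rewrite mulr1 mulrC.
Qed.

Let cexp_real_scale (s : R) z : cexp (- (s%:C * z)) = cexp ((- s)%:C * z).
Proof. by rewrite rmorphN mulNr. Qed.

Lemma expgrown_csinh n : expgrown n (fun z => csinh (piC R * z)).
Proof.
have := expgrownM (expgrownD (expgrown_cexp n pi)
  (expgrownM (expgrown_cst n (-1)) (expgrown_cexp n (- pi)))) (expgrown_cst n 2^-1).
by under eq_fun do rewrite -cexp_real_scale mulN1r.
Qed.

End ExponentialGrowth.

Section GaussianSchwartz.
Variables (R : realType) (y eps : R).
Hypothesis eps0 : 0 < eps.
Local Open Scope complex_scope.
Implicit Types (x : R) (z w : R[i]) (F G : R[i] -> R[i]).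

Let gauss z : R[i] := cexp (- (eps%:C * (z * z))).

Let cderiv_gauss F x l : cderiv F (x +i* y) l ->
  cderiv (fun z => F z * gauss z) (x +i* y)
    ((l - 2 * eps%:C * (x +i* y) * F (x +i* y)) * gauss (x +i* y)).
Proof.
move=> dF; set z := x +i* y.
have dq := cderivM (cderiv_id z) (cderiv_id z).
have dg : cderiv gauss z (gauss z * - (eps%:C * (1 * z + z * 1))).
  exact: cderiv_comp (cderivN (cderivMl eps%:C dq)) (cderiv_cexp _).
have := cderivM dF dg; congr cderiv; ring.
Qed.

(** Differentiation keeps this shape, with [F] replaced by [F' - 2 * eps * z * F], hence the
    inductions on the order below. Real parts are enough: the imaginary part for [F] is the real
    part for [- ci * F]. *)
Let re F x : R := complex.Re (F (x +i* y) * gauss (x +i* y)).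

Let re_derive F F' : (forall x, cderiv F (x +i* y) (F' (x +i* y))) ->
  (forall x, derivable (re F) x 1) /\
  derive1 (re F) = re (fun z => F' z + - (2 * eps%:C) * (z * F z)).
Proof.
move=> dF.
have d (x : R) : is_derive x 1 (re F) (re (fun z => F' z + - (2 * eps%:C) * (z * F z)) x).
  have -> : re (fun z => F' z + - (2 * eps%:C) * (z * F z)) x = complex.Re
      ((F' (x +i* y) - 2 * eps%:C * (x +i* y) * F (x +i* y)) * gauss (x +i* y)).
    by rewrite /re; congr (complex.Re (_ * _)); ring.
  exact: (cderiv_x (cderiv_gauss (dF x))).1.
split; first by move=> x; have [] := d x.
by apply/funext => x; rewrite derive1E; have [_ ->] := d x.
Qed.

Let step n F F' : expgrown y n F -> expgrown y n F' ->
  expgrown y n (fun z => F' z + - (2 * eps%:C) * (z * F z)).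
Proof.
move=> gF gF'; apply: expgrownD gF' _; apply: expgrownM; first exact: expgrown_cst.
by apply: expgrownM gF; exact: expgrown_id.
Qed.

Let derivable_re n F x : expgrown y n.+1 F -> derivable (derive1n n (re F)) x 1.
Proof.
elim: n F => [|n IH] F gF.
  by have [_ [F' dF _]] := gF; have [d _] := re_derive dF; rewrite derive1n0.
have [_ [F' dF gF']] := gF; have [_ e] := re_derive dF.
by rewrite derive1Sn e; apply: IH; apply: step => //; exact: expgrownS.
Qed.

Let re_bound k n F : expgrown y n F ->
  exists M : R, forall x, `|x ^+ k * derive1n n (re F) x| <= M.
Proof.
elim: n F => [|n IH] F gF; last first.
  have [_ [F' dF gF']] := gF; have [_ e] := re_derive dF.
  by rewrite derive1Sn e; apply: IH; apply: step => //; exact: expgrownS.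
have [A [C [A0 C0 HF]]] := expgrown0 gF.
have [M M0 HM] := @expR_gauss _ A eps k A0 eps0.
exists (M * (C * expR (eps * y ^+ 2))) => x; rewrite derive1n0.
have W1 : 1 <= 1 + x ^+ 2 by rewrite lerDl sqr_ge0.
have xk : `|x ^+ k| <= (1 + x ^+ 2) ^+ k.
  rewrite normrX lerXn2r ?nnegrE ?(ltW (wt_den _))//.
  by have := sqr_ge0 (`|x| - 1); rewrite sqrrB real_normK ?num_real// expr1n mulr1; have := sqr_ge0 x; lra.
have g : nc (gauss (x +i* y)) = expR (- (eps * x ^+ 2) + eps * y ^+ 2).
  by rewrite nc_cexp; congr expR => /=; ring.
rewrite normrM.
apply: (@le_trans _ _ ((1 + x ^+ 2) ^+ k * (C * expR (A * `|x|) * expR (- (eps * x ^+ 2) + eps * y ^+ 2)))).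
  apply: ler_pM => //.
  apply: le_trans (Re_le_nc _) _; rewrite ncM g.
  by rewrite ler_wpM2r ?expR_ge0.
have -> : (1 + x ^+ 2) ^+ k * (C * expR (A * `|x|) * expR (- (eps * x ^+ 2) + eps * y ^+ 2)) =
   (1 + x ^+ 2) ^+ k * expR (A * `|x| - eps * x ^+ 2) * (C * expR (eps * y ^+ 2)).
  by rewrite !expRD; ring.
by rewrite ler_wpM2r ?mulr_ge0 ?expR_ge0.
Qed.

Lemma schwartz_gauss F : (forall n, expgrown y n F) ->
  schwartz (fun x => F (x +i* y) * cexp (- (eps%:C * ((x +i* y) * (x +i* y))))).
Proof.
move=> gF.
have rs G : (forall n, expgrown y n G) -> rschwartz (re G).
  by move=> gG; split => [n x|k n]; [exact: derivable_re|exact: re_bound].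
split; first exact: rs.
have -> : (fun x => complex.Im (F (x +i* y) * cexp (- (eps%:C * ((x +i* y) * (x +i* y)))))) =
    re (fun z => - ci * F z).
  by apply/funext => x; rewrite /re -mulrA; move: (_ * gauss _) => [u v] /=; ring.
by apply: rs => n; apply: expgrownM => //; exact: expgrown_cst.
Qed.

End GaussianSchwartz.

Section KernelSchwartz.
Variables (R : realType) (al : R) (Hal : 0 < al < 1) (a b r : R).
Local Open Scope complex_scope.
Implicit Types (x y : R) (z w : R[i]).
Variables (Psi L : R[i] -> R[i]) (K : R).
Hypothesis K0 : 0 < K.
Hypothesis dPsi : forall x y, 0 <= y <= 1 -> cderiv Psi (x +i* y) (L (x +i* y)).
Hypothesis ReK : forall x y, 0 <= y <= 1 -> `|complex.Re (Psi (x +i* y))| <= K * (1 + `|x|).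
Hypothesis LE : forall z, z <> zal al -> L z = lamnum al a b z / D al z + ci * r%:C.
Variable eps : R.
Hypothesis eps0 : 0 < eps.

(** Apart from the Gaussian the factors are [exp (- Psi)] and a multiple of [1 / D]. Each solves a
    differential equation with coefficients in the class; for the first this rests on the explicit
    formula [LE] for the derivative of [Psi]. *)
Lemma schwartz_tker y : 0 <= y <= 1 -> y != al ->
  schwartz (fun x => tker al Psi eps (x +i* y)).
Proof.
move=> y01 yal.
have nz x : D al (x +i* y) != 0.
  apply: D_neq0 => //; last exact: line_neq_zal.
  by have /andP[? ?] := Hal; have /andP[? ?] := y01; lra.
have s0 := sal_gt0 Hal.
have sC : (sal al / 2)%:C != 0 by rewrite -nc_eq0 nc_real normr_eq0 gt_eqF// divr_gt0.
have gDV n : expgrown y n (fun z => (D al z)^-1).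
  apply: (@expgrown_riccati _ _ _ (fun z => - piC R * csinh (piC R * z))).
  - by move=> m; apply: expgrownM; [exact: expgrown_cst|exact: expgrown_csinh].
  - have [eta He far] := far_line yal.
    have [k k0 Hk] := D_lower Hal He.
    exists 0, k^-1; split; rewrite ?invr_ge0 ?(ltW k0)// => x.
    rewrite mul0r expR0 mulr1 ncV lef_pV2 ?posrE ?nc_gt0//.
    by apply: le_trans (Hk x y y01 (or_intror far)); rewrite ler_peMr ?(ltW k0)// cosh_ge1.
  - move=> x; have := cderivV (nz x) (cderiv_D al (x +i* y)).
    by congr cderiv; rewrite expr2 invfM; ring.
have gL n : expgrown y n (fun z => lamnum al a b z * (D al z)^-1 + ci * r%:C).
  apply: expgrownD; last exact: expgrown_cst.
  apply: expgrownM => //; apply: expgrownM; first exact: expgrown_cst.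
  apply: expgrownD; last exact: expgrown_cst.
  apply: expgrownM; last exact: expgrown_csinh.
  apply: expgrownD; first exact: expgrown_cst.
  by apply: expgrownM; [exact: expgrown_cst|exact: expgrown_id].
have gE n : expgrown y n (fun z => cexp (- Psi z)).
  apply: (@expgrown_ode _ _ _ (fun z => -1 * (lamnum al a b z * (D al z)^-1 + ci * r%:C))).
  - by move=> m; apply: expgrownM => //; exact: expgrown_cst.
  - exists K, (expR K); split; rewrite ?(ltW K0) ?expR_ge0// => x.
    rewrite nc_cexp -expRD ler_expR -[X in _ <= X + _](mulr1 K) -mulrDr.
    apply: le_trans (ReK x y01); rewrite -normrN; case: (Psi _) => u v /=; exact: ler_norm.
  - move=> x; have := cderiv_comp (cderivN (dPsi x y01)) (cderiv_cexp _).
    rewrite LE; last exact: line_neq_zal.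
    by congr cderiv; ring.
have := @schwartz_gauss _ y eps eps0 (fun z => cexp (- Psi z) * ((sal al / 2)%:C * (D al z)^-1)).
have -> : (fun x => tker al Psi eps (x +i* y)) = (fun x => cexp (- Psi (x +i* y)) *
   ((sal al / 2)%:C * (D al (x +i* y))^-1) * cexp (- (eps%:C * ((x +i* y) * (x +i* y))))).
  apply/funext => x; rewrite /tker /damp /kern cexpD rmorphN mulN1r; ring.
apply=> n; apply: expgrownM => //; apply: expgrownM => //; exact: expgrown_cst.
Qed.

End KernelSchwartz.

Section ComplexLimits.
Variable R : realType.
Local Open Scope complex_scope.

Lemma cvg_ncP (F : set_system R) (FF : Filter F) (f : R -> R[i]) (l : R[i]) :
  (f : R -> R[i]^o) @ F --> (l : R[i]^o) <->
  forall e : R, 0 < e -> \forall y \near F, nc (f y - l) <= e.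
Proof.
split=> [/cvgrPdist_le H e e0|H].
  have := H e%:C; rewrite ltcR => /(_ e0); apply: filterS => y.
  by rewrite -ncN opprB -lecR.
apply/cvgrPdist_le => e e0.
have [r r0 ->] : exists2 r : R, 0 < r & e = r%:C.
  case: e e0 => a b; rewrite ltcE/= => /andP[/eqP -> a0]; by exists a.
by apply: filterS (H r r0) => y; rewrite -ncN opprB -lecR.
Qed.

End ComplexLimits.

Section PoissonLn.
Variable R : realType.
Notation mu := (@lebesgue_measure R).
Notation "'rintegrable' f" := (mu.-integrable [set: R] (EFin \o f)) (at level 10, f at level 9).

Lemma poisson_ln_integrable (c : R) : 0 < c < 1 -> rintegrable (fun x => poisson c x * ln (poisson c x)).
Proof.
move=> Hc; have [k k0 Hk] := poisson_bound Hc.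
have [m m0 Hm] := ln_poisson_bound Hc.
apply: (@rintegrable_le _ _ (fun x => k * (m * 2) * wt x)).
- apply: measurable_funM; first exact: rintegrable_measurable (poisson_integrable Hc).
  apply: measurableT_comp => //; exact: rintegrable_measurable (poisson_integrable Hc).
- move=> x; rewrite normrM gtr0_norm ?poisson_gt0//.
  have x1 := norm_le_den x.
  have h : `|ln (poisson c x)| <= m * (2 * (1 + x ^+ 2)).
    by apply: le_trans (Hm x) _; rewrite ler_wpM2l// ltW.
  apply: le_trans (ler_pM (ltW (poisson_gt0 Hc x)) (normr_ge0 _) (Hk x) h) _.
  have -> : k * wt x ^+ 2 * (m * (2 * (1 + x ^+ 2))) = k * (m * 2) * wt x * ((1 + x ^+ 2) * wt x) by ring.
  by rewrite wtK mulr1.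
- exact/rintegrableZ/wt_integrable.
Qed.

End PoissonLn.

(** * The three lines estimate at the pole *)

Section UpperBound.
Variables (R : realType) (al : R) (Hal : 0 < al < 1) (a b b0 b1 r : R).
Local Open Scope complex_scope.
Notation mu := (@lebesgue_measure R).
Notation "'rintegrable' f" := (mu.-integrable [set: R] (EFin \o f)) (at level 10, f at level 9).
Implicit Types (x y : R) (z w : R[i]).
Variables (Psi L : R[i] -> R[i]) (K : R).
Hypothesis K0 : 0 < K.
Hypothesis dPsi : forall x y, 0 <= y <= 1 -> cderiv Psi (x +i* y) (L (x +i* y)).
Hypothesis LK : forall x y, 0 <= y <= 1 -> nc (L (x +i* y)) <= K * (1 + `|x|).
Hypothesis ReK : forall x y, 0 <= y <= 1 -> `|complex.Re (Psi (x +i* y))| <= K * (1 + `|x|).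
Hypothesis PsiK : forall x y, 0 <= y <= 1 -> nc (Psi (x +i* y)) <= K * (1 + x ^+ 2).
Hypothesis Psi0 : forall x, complex.Re (Psi (x +i* 0)) = a * ln (poisson al x) + b0.
Hypothesis Psi1 : forall x, complex.Re (Psi (x +i* 1)) = b * ln (poisson (1 - al) x) + b1.
Hypothesis LE : forall z, z <> zal al -> L z = lamnum al a b z / D al z + ci * r%:C.

Let al0 : 0 < al. Proof. by case/andP: Hal. Qed.
Let al1 : al < 1. Proof. by case/andP: Hal. Qed.
Let y00 : 0 <= (0 : R) <= 1. Proof. by rewrite lexx ler01. Qed.
Let y11 : 0 <= (1 : R) <= 1. Proof. by rewrite lexx ler01. Qed.
Let n0 : 0 != al. Proof. by rewrite lt_eqF. Qed.
Let n1 : 1 != al. Proof. by rewrite gt_eqF. Qed.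

Let Psi_kern y : 0 <= y <= 1 -> y != al -> cintegrable (fun x => Psi (x +i* y) * kern al (x +i* y)).
Proof.
move=> y01 yal.
have [eta He far] := far_line yal.
have [k k0 Hk] := kern_bound Hal He.
apply: (@cintegrable_le _ _ (fun x => K * k * wt x)).
- apply: cmeasurableM; last exact: cmeasurable_kern.
  by apply: rcont_measurable => x; apply: ccont_x; apply: cderiv_cont; exact: dPsi.
- move=> x; have [hk _] := Hk x y y01 (or_intror far).
  have := ler_pM (nc_ge0 _) (nc_ge0 _) (PsiK x y01) hk; rewrite -ncM => /le_trans; apply.
  have -> : K * (1 + x ^+ 2) * (k * wt x ^+ 2) = K * k * wt x * ((1 + x ^+ 2) * wt x) by ring.
  by rewrite wtK mulr1.
- exact/rintegrableZ/wt_integrable.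
Qed.

Lemma Re_Psi_zal : complex.Re (Psi (zal al)) =
  a * \int[mu]_x (poisson al x * ln (poisson al x)) +
  b * \int[mu]_x (poisson (1 - al) x * ln (poisson (1 - al) x)) + ((1 - al) * b0 + al * b1).
Proof.
have Hc := Hal' Hal.
have He : 0 < (2^-1 : R) <= 2^-1 by rewrite lexx invr_gt0 ltr0n.
have [k k0 Hk] := kern_bound Hal He.
rewrite -(@kernel_cauchy R al Hal Psi 0 1 (lexx 0) al0 al1 (lexx 1)); last first.
- apply: (@vertical_pointwise _ _ _ _ (K * k)); [exact: ler01|exact: mulr_gt0|].
  move=> x y y01 x1.
  have far : 2^-1 <= `|x| by lra.
  have [hk _] := Hk x y y01 (or_introl far).
  have := ler_pM (nc_ge0 _) (nc_ge0 _) (PsiK x y01) hk; rewrite -ncM => /le_trans; apply.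
  have -> : K * (1 + x ^+ 2) * (k * wt x ^+ 2) = K * k * wt x * ((1 + x ^+ 2) * wt x) by ring.
  by rewrite wtK mulr1.
- exact: Psi_kern.
- exact: Psi_kern.
- by move=> x y y01; exists (L (x +i* y)); exact: dPsi.
rewrite Re_sub /cintegral/=.
have e0 x : complex.Re (Psi (x +i* 0) * kern al (x +i* 0)) =
    a * (poisson al x * ln (poisson al x)) + b0 * poisson al x.
  by rewrite kern0// Re_mul Psi0 /=; ring.
have e1 x : complex.Re (Psi (x +i* 1) * kern al (x +i* 1)) =
    (- b) * (poisson (1 - al) x * ln (poisson (1 - al) x)) + (- b1) * poisson (1 - al) x.
  by rewrite kern1// Re_mul Psi1 /=; ring.
have lin (c d e : R) : 0 < c < 1 ->
    \int[mu]_x (d * (poisson c x * ln (poisson c x)) + e * poisson c x) =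
    d * \int[mu]_x (poisson c x * ln (poisson c x)) + e * (1 - c).
  move=> H; have i := poisson_ln_integrable H; have j := poisson_integrable H.
  rewrite RintegralD//; [|exact: rintegrableZ|exact: rintegrableZ].
  by congr (_ + _); [exact: RintegralZl|rewrite -(integral_poisson H); exact: RintegralZl].
under eq_Rintegral do rewrite e0.
under [X in _ - X]eq_Rintegral do rewrite e1.
rewrite (lin _ _ _ Hal).
rewrite (lin _ _ _ Hc); ring.
Qed.

Variables (h : R[i] -> R[i]) (N : R) (h0 h1 : R -> R[i]).
Hypothesis dh : forall x y, 0 < y < 1 -> exists l, cderiv h (x +i* y) l.
Hypothesis ih : forall y, 0 < y < 1 -> rintegrable (fun x => nc (h (x +i* y)) * wt x).
Hypothesis hN : forall y, 0 < y < 1 -> \int[mu]_x (nc (h (x +i* y)) * wt x) <= N.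
Hypothesis lim0 : tempered_cvg (hline h) 0^'+ h0.
Hypothesis lim1 : tempered_cvg (hline h) 1^'- h1.
Hypothesis mh0 : cmeasurable h0.
Hypothesis mh1 : cmeasurable h1.
Let g0 x := poisson al x * (nc (h0 x) * expR (- (a * ln (poisson al x) + b0))).
Let g1 x := poisson (1 - al) x * (nc (h1 x) * expR (- (b * ln (poisson (1 - al) x) + b1))).
Hypothesis ig0 : rintegrable g0.
Hypothesis ig1 : rintegrable g1.
Hypothesis Ig0 : \int[mu]_x g0 x <= 1 - al.
Hypothesis Ig1 : \int[mu]_x g1 x <= al.

Let damped_bound eps : 0 < eps ->
  nc (h (zal al)) * expR (- complex.Re (Psi (zal al))) <= expR eps.
Proof.
move=> eps0.
have Hc := Hal' Hal.
pose T := tker al Psi eps.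
have E : cintegral (fun x => h0 x * T (x +i* 0)) - cintegral (fun x => h1 x * T (x +i* 1))
    = h (zal al) * damp Psi eps (-1) (zal al).
  apply: (@boundary_cauchy _ _ Hal Psi L K K0 dPsi LK ReK eps eps0 h N dh ih hN) => e e0.
    have S := schwartz_tker Hal K0 dPsi ReK LE eps0 y00 n0.
    have /cvg_ncP/(_ e e0)[d /= d0 Hd] := lim0 S.
    exists d => // y /andP[y0 yd]; apply: Hd => //=.
    by rewrite sub0r normrN gtr0_norm.
  have S := schwartz_tker Hal K0 dPsi ReK LE eps0 y11 n1.
  have /cvg_ncP/(_ e e0)[d /= d0 Hd] := lim1 S.
  exists d => // y /andP[y0 yd]; apply: Hd => //=.
  by rewrite gtr0_norm ?subr_gt0// ltrBlDl -ltrBlDr.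
have T0 x : nc (h0 x * T (x +i* 0)) <= g0 x.
  have -> : nc (h0 x * T (x +i* 0)) = poisson al x * (nc (h0 x) *
      expR (-1 * (a * ln (poisson al x) + b0) - eps * (x ^+ 2 - 0 ^+ 2))).
    rewrite ncM /T /tker (ncM (damp _ _ _ _)) nc_damp Psi0 kern0// nc_real gtr0_norm ?poisson_gt0//; ring.
  rewrite ler_wpM2l ?(ltW (poisson_gt0 Hal x))// ler_wpM2l ?nc_ge0// ler_expR expr0n/= subr0 mulN1r gerBl.
  by rewrite mulr_ge0 ?sqr_ge0// ltW.
(* The modulus of [exp (- eps * z ^ 2)] is [exp (eps * (y ^ 2 - x ^ 2))]: at most 1 on the lower
   line, at most [expR eps] on the upper one. *)
have T1 x : nc (h1 x * T (x +i* 1)) <= expR eps * g1 x.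
  rewrite ncM /T /tker (ncM (damp _ _ _ _)) nc_damp Psi1 kern1// nc_real normrN gtr0_norm ?poisson_gt0//.
  have -> : expR eps * g1 x = nc (h1 x) * (expR (eps - (b * ln (poisson (1 - al) x) + b1)) * poisson (1 - al) x).
    by rewrite /g1 expRD; ring.
  rewrite ler_wpM2l ?nc_ge0// ler_wpM2r ?(ltW (poisson_gt0 Hc x))// ler_expR.
  have : 0 <= eps * x ^+ 2 by rewrite mulr_ge0 ?sqr_ge0// ltW.
  by rewrite expr1n mulrBr mulr1; lra.
have mT y : 0 <= y <= 1 -> y != al -> cmeasurable (fun x => T (x +i* y)).
  exact: (cmeasurable_tker Hal dPsi).
have i0 : cintegrable (fun x => h0 x * T (x +i* 0)).
  by apply: cintegrable_le T0 ig0; apply: cmeasurableM => //; exact: mT.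
have i1 : cintegrable (fun x => h1 x * T (x +i* 1)).
  by apply: cintegrable_le T1 (rintegrableZ _ ig1); apply: cmeasurableM => //; exact: mT.
have B0 : nc (cintegral (fun x => h0 x * T (x +i* 0))) <= 1 - al.
  apply: le_trans (nc_cintegral i0) _; apply: le_trans Ig0.
  by apply: le_rint => //; exact: cintegrable_nc.
have B1 : nc (cintegral (fun x => h1 x * T (x +i* 1))) <= expR eps * al.
  apply: le_trans (nc_cintegral i1) _.
  apply: (@le_trans _ _ (expR eps * \int[mu]_x g1 x)); last by rewrite ler_wpM2l ?expR_ge0.
  rewrite -RintegralZl//; apply: le_rint => //; first exact: cintegrable_nc.
  exact: rintegrableZ.
have H : nc (h (zal al)) * nc (damp Psi eps (-1) (zal al)) <= (1 - al) + expR eps * al.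
  by rewrite -ncM -E (le_trans (ncB _ _))// lerD.
apply: (@le_trans _ _ (nc (h (zal al)) * nc (damp Psi eps (-1) (zal al)))).
  rewrite ler_wpM2l ?nc_ge0// nc_damp ler_expR mulN1r expr0n/= sub0r mulrN opprK lerDl.
  by rewrite mulr_ge0 ?sqr_ge0// ltW.
apply: (le_trans H).
have e1 : 1 <= expR eps by rewrite -expR0 ler_expR ltW.
have : (1 - al) * 1 <= (1 - al) * expR eps by rewrite ler_wpM2l// subr_ge0 ltW.
by rewrite mulr1 mulrBl mul1r [al * _]mulrC; lra.
Qed.

Lemma three_lines_zal : nc (h (zal al)) <= expR (complex.Re (Psi (zal al))).
Proof.
rewrite -[leRHS]mul1r -ler_pdivrMr ?expR_gt0// -expRN.
set u := _ * _; have [//|u1] := leP u 1.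
have u0 : 0 < u by lra.
(* For [u > 1] this choice of [eps] would bound [u] by its own square root. *)
have := @damped_bound (ln u / 2); rewrite divr_gt0 ?ln_gt0// => /(_ isT).
rewrite -/u -[leLHS](lnK u0) ler_expR.
by have := ln_gt0 u1; lra.
Qed.

End UpperBound.

(** * Lebesgue norms against a density *)

Section DensityNorm.
Variable R : realType.
Local Open Scope complex_scope.
Notation mu := (@lebesgue_measure R).
Notation "'rintegrable' f" := (mu.-integrable [set: R] (EFin \o f)) (at level 10, f at level 9).

(** A real number, equal to 0 at [+oo], so that finite and infinite exponents share the same
    formulas. *)
Definition inv_exponent (p : \bar R) : R := fine p^-1%E.

Lemma inv_exponentP (p : \bar R) : (1 <= p)%E ->
  (p = +oo%E /\ inv_exponent p = 0) \/ exists r : R, [/\ p = r%:E, 1 <= r & inv_exponent p = r^-1].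
Proof.
case: p => [r| |//]; rewrite /inv_exponent.
  rewrite lee_fin => r1; right; exists r; split => //.
  by rewrite inver gt_eqF// (lt_le_trans ltr01).
by left.
Qed.

Lemma inveE (p : \bar R) : (1 <= p)%E -> (p^-1)%E = (inv_exponent p)%:E.
Proof.
move=> p1; rewrite /inv_exponent fineK//.
by case: (inv_exponentP p1) => [[-> _]//|[r [-> r1 _]]]; rewrite inver gt_eqF// (lt_le_trans ltr01).
Qed.

Lemma inv_exponent_01 p : (1 <= p)%E -> 0 <= inv_exponent p <= 1.
Proof.
move=> /inv_exponentP[[_ ->]|[r [_ r1 ->]]]; first by rewrite lexx ler01.
have r0 : 0 < r by apply: lt_le_trans r1.
by rewrite invr_ge0 (ltW r0) invf_le1.
Qed.

(** At [+oo] the norm is defined by cases on the total measure; this selects the essential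
    supremum. *)
Lemma lebesgue_setT_gt0 : (0 < mu [set: R])%E.
Proof.
have m : ([set: R] : set (measurableTypeR R)) = [set` `]-oo, +oo[ : interval R].
  by apply/seteqP; split => // x _ /=; rewrite in_itv.
by have := lebesgue_measure_itv (`]-oo, +oo[ : interval R); rewrite -m /= => ->; exact: lt0y.
Qed.

Lemma ge0_rintegrable (g : R -> R) m : measurable_fun [set: R] g -> (forall x, 0 <= g x) ->
  (\int[mu]_x (g x)%:E <= m%:E)%E -> rintegrable g /\ \int[mu]_x g x <= m.
Proof.
move=> mg g0 gm.
have ig : rintegrable g.
  apply/integrableP; split; first exact/measurable_EFinP.
  under eq_integral do rewrite /= ger0_norm//.
  exact: le_lt_trans gm (ltry _).
by split => //; rewrite -lee_fin -rintegral_EFin.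
Qed.

(** Convexity of the exponential. The tangent at [a * u] lies below [expR] at [u] and at 0;
    averaging with weights [a] and [1 - a] cancels the linear terms. *)
Lemma young_expR (a u : R) : 0 <= a <= 1 -> expR (a * u) <= a * expR u + (1 - a).
Proof.
move=> /andP[a0 a1].
have s0 := expR_gt0 (a * u).
have h1 := ler_wpM2l (ltW s0) (expR_ge1Dx ((1 - a) * u)).
have h2 := ler_wpM2l (ltW s0) (expR_ge1Dx (- (a * u))).
rewrite -expRD in h1; rewrite -expRD subrr expR0 in h2.
have e1 : a * u + (1 - a) * u = u by ring.
rewrite e1 in h1.
have b0 : 0 <= 1 - a by rewrite subr_ge0.
have h3 := ler_wpM2l a0 h1.
have h4 := ler_wpM2l b0 h2.
rewrite mulr1 in h4.
have := lerD h3 h4; apply: le_trans.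
by rewrite le_eqVlt; apply/orP; left; apply/eqP; ring.
Qed.

Lemma cLnorm_fin (r : R) f : 1 <= r ->
  cLnorm r%:E f = ((\int[mu]_x (nc (f x) `^ r)%:E) `^ r^-1)%E.
Proof.
move=> r1; rewrite /cLnorm [@Lnorm]unlock /=; congr (_ `^ _)%E; apply: eq_integral => x _.
by rewrite /= ger0_norm ?nc_ge0.
Qed.

Variable (P : R -> R) (m : R).
Hypothesis P0 : forall x, 0 < P x.
Hypothesis iP : rintegrable P.
Hypothesis m0 : 0 < m.
Hypothesis Pm : \int[mu]_x P x = m.

Let mP : measurable_fun [set: R] P. Proof. exact: rintegrable_measurable. Qed.

(* Integrate [t ^ (1 / p) <= t / p + 1 - 1 / p] against [P], with
   [t = (m / P) (|f| / A) ^ p]. *)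
Lemma young_Lnorm p f (A : R) : (1 <= p)%E -> cmeasurable f -> 0 < A -> (cLnorm p f <= A%:E)%E ->
  let g x := P x * (nc (f x) * expR (- (inv_exponent p * ln (P x) + (ln A - inv_exponent p * ln m)))) in
  rintegrable g /\ \int[mu]_x g x <= m.
Proof.
move=> p1 mf A0 fA g.
have mnf := cmeasurable_nc mf.
have mg : measurable_fun [set: R] g.
  apply: measurable_funM => //; apply: measurable_funM => //.
  apply: measurableT_comp => //; apply: measurableT_comp => //.
  apply: measurable_funD => //; apply: measurable_funM => //.
  by apply: measurableT_comp.
have g0 x : 0 <= g x by rewrite !mulr_ge0 ?nc_ge0 ?expR_ge0// ltW.
have [[pE aE]|[r [pE r1 aE]]] := inv_exponentP p1.
  (* Infinite exponent: the function [nc (f x)] is almost everywhere at most [A], hence [g] at most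
     [P]. *)
  apply: ge0_rintegrable => //; rewrite -Pm -rintegral_EFin//.
  apply: ae_ge0_le_integral => //.
  - by move=> x _; rewrite lee_fin.
  - exact/measurable_EFinP.
  - by move=> x _; rewrite lee_fin ltW.
  - exact/measurable_EFinP.
  have fA' : \forall x \ae mu, ((nc (f x))%:E <= A%:E)%E.
    apply/ess_sup_inf.ess_supP; move: fA; rewrite pE /cLnorm unlock lebesgue_setT_gt0.
    apply: le_trans; apply: ess_sup_inf.le_ess_sup; apply: nearW => x /=.
    by rewrite lee_fin ler_norm.
  apply: (@filterS _ _ (ae_filter_ringOfSetsType mu)) fA' => x; rewrite !lee_fin /g aE !mul0r add0r subr0 => h _.
  by rewrite expRN lnK// ler_piMr ?(ltW (P0 x))// ler_pdivrMr// mul1r.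
have r0 : 0 < r by apply: lt_le_trans r1.
set a := inv_exponent p in g mg g0 aE *.
have ar : a * r = 1 by rewrite aE mulVf// gt_eqF.
have a01 : 0 <= a <= 1 := inv_exponent_01 p1.
have nr x : (0 <= (nc (f x) `^ r)%:E)%E by rewrite lee_fin powR_ge0.
have mr : measurable_fun [set: R] (fun x => nc (f x) `^ r) by apply: measurableT_comp (measurable_powR r) _.
have [ir Ir] : rintegrable (fun x => nc (f x) `^ r) /\ \int[mu]_x (nc (f x) `^ r) <= A `^ r.
  apply: ge0_rintegrable => //.
  move: fA; rewrite pE cLnorm_fin//.
  set I := (\int[mu]_x _)%E; have I0 : (0 <= I)%E by apply: integral_ge0 => x _.
  move=> h; have := gt0_ler_poweR (ltW r0) _ _ h.
  rewrite -poweRrM mulVf ?gt_eqF// poweRe1// poweR_EFin; apply.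
    by rewrite in_itv/= leey andbT; exact: poweR_ge0.
  by rewrite in_itv/= leey andbT lee_fin ltW.
have Ar : 0 < A `^ r by exact: powR_gt0.
have gle x : g x <= a * m / A `^ r * nc (f x) `^ r + (1 - a) * P x.
  have [f0|f0] := eqVneq (nc (f x)) 0.
    rewrite /g f0 mul0r mulr0 addr_ge0 ?mulr_ge0 ?powR_ge0 ?subr_ge0 ?invr_ge0 ?(ltW Ar) ?(ltW (P0 x)) ?(ltW m0)//; by case/andP: a01.
  have n0 : 0 < nc (f x) by rewrite lt_def f0 nc_ge0.
  (* The logarithm of [(m / P) * (nc (f x) / A) ^ r], defined away from the zeros of [f], which were
     handled first. *)
  pose u := r * ln (nc (f x)) - r * ln A + ln m - ln (P x).
  have e1 : nc (f x) * expR (- (a * ln (P x) + (ln A - a * ln m))) = expR (a * u).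
    rewrite -{1}(lnK n0) -expRD; congr expR.
    have -> : a * u = (a * r) * ln (nc (f x)) - (a * r) * ln A + a * ln m - a * ln (P x) by rewrite /u; ring.
    by rewrite ar; ring.
  have e2 : P x * expR u = m / A `^ r * nc (f x) `^ r.
    have -> : P x * expR u = expR (ln (P x) + u) by rewrite expRD lnK ?posrE.
    rewrite /powR (negbTE f0) gt_eqF// -expRN -{1}(lnK m0) -!expRD; congr expR; rewrite /u; ring.
  rewrite /g e1; apply: le_trans (ler_wpM2l (ltW (P0 x)) (young_expR u a01)) _.
  rewrite mulrDr mulrCA e2 le_eqVlt; apply/orP; left; apply/eqP; ring.
have iu : rintegrable (fun x => a * m / A `^ r * nc (f x) `^ r + (1 - a) * P x).
  by apply: rintegrableD; exact: rintegrableZ.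
have ig : rintegrable g.
  by apply: rintegrable_le iu => // x; rewrite ger0_norm.
split => //; apply: (le_trans (le_rint ig iu gle)).
rewrite RintegralD//; [|exact: rintegrableZ|exact: rintegrableZ].
rewrite (RintegralZl _ _ ir)// (RintegralZl _ _ iP)// Pm.
have am : 0 <= a * m / A `^ r.
  by rewrite !mulr_ge0 ?invr_ge0 ?(ltW Ar) ?(ltW m0)//; case/andP: a01.
apply: le_trans (lerD (ler_wpM2l am Ir) (lexx _)) _.
rewrite mulfVK ?gt_eqF// le_eqVlt; apply/orP; left; apply/eqP; ring.
Qed.

(** The bounding function is [c * (P / m) ^ (1 / p)], whose norm is exactly [c] because [P / m] has
    integral 1. With [c = 1] this is the equality case of [young_Lnorm]. *)
Lemma extremal_Lnorm p f (c : R) : (1 <= p)%E -> cmeasurable f -> 0 < c ->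
  (forall x, nc (f x) <= c * expR (inv_exponent p * (ln (P x) - ln m))) -> (cLnorm p f <= c%:E)%E.
Proof.
move=> p1 mf c0 fc.
have [[pE aE]|[r [pE r1 aE]]] := inv_exponentP p1.
  rewrite pE /cLnorm unlock lebesgue_setT_gt0; apply/ess_sup_inf.ess_supP/nearW => x /=.
  by rewrite lee_fin ger0_norm ?nc_ge0//; have := fc x; rewrite aE mul0r expR0 mulr1.
have r0 : 0 < r by apply: lt_le_trans r1.
have mr : measurable_fun [set: R] (fun x => nc (f x) `^ r).
  by apply: measurableT_comp (measurable_powR r) _; exact: cmeasurable_nc.
have cr : 0 < c `^ r by exact: powR_gt0.
have rP : rintegrable (fun x => c `^ r / m * P x) by exact: rintegrableZ.
have h : (\int[mu]_x (nc (f x) `^ r)%:E <= (c `^ r)%:E)%E.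
  have -> : c `^ r = \int[mu]_x (c `^ r / m * P x).
    by rewrite (RintegralZl _ _ iP)// Pm mulfVK// gt_eqF.
  rewrite -rintegral_EFin//; apply: ge0_le_integral => //.
  - by move=> x _; rewrite lee_fin powR_ge0.
  - exact/measurable_EFinP.
  - apply/measurable_EFinP; exact: rintegrable_measurable rP.
  - move=> x _; rewrite lee_fin.
    apply: (@le_trans _ _ ((c * expR (inv_exponent p * (ln (P x) - ln m))) `^ r)).
      by apply: ge0_ler_powR (fc x); rewrite ?nnegrE ?nc_ge0 ?mulr_ge0 ?expR_ge0 ?(ltW r0) ?(ltW c0).
    rewrite powRM ?expR_ge0 ?(ltW c0)// -mulrA ler_wpM2l ?(ltW cr)//.
    rewrite -expRM aE mulrAC mulVf ?gt_eqF// mul1r expRD expRN !lnK ?posrE//.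
    by rewrite mulrC.
rewrite pE cLnorm_fin//.
have -> : c%:E = ((c `^ r)%:E `^ r^-1)%E.
  by rewrite poweR_EFin -powRrM mulfV ?gt_eqF// powRr1// ltW.
apply: gt0_ler_poweR => //; first by rewrite invr_ge0 ltW.
  by rewrite in_itv/= leey andbT; apply: integral_ge0 => x _; rewrite lee_fin powR_ge0.
by rewrite in_itv/= leey andbT lee_fin ltW.
Qed.

End DensityNorm.

(** * Translations *)

Section Translation.
Variable R : realType.
Local Open Scope complex_scope.
Notation mu := (@lebesgue_measure R).
Notation "'rintegrable' f" := (mu.-integrable [set: R] (EFin \o f)) (at level 10, f at level 9).
Implicit Types c : R.

Let measurable_shift c : measurable_fun [set: R] (fun x : R => x + c).
Proof. exact: measurable_funD. Qed.

Let sh c (x : measurableTypeR R) : measurableTypeR R := x + c.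

(** Lebesgue measure is characterised by its values on half-open intervals, and translation
    preserves their lengths. *)
Lemma lebesgue_measure_shift c (A : set R) : measurable A -> pushforward mu (sh c) A = mu A.
Proof.
move=> mA; apply/esym/lebesgue_measure_unique => //=; first exact: measurable_shift.
move=> _ _ [[a b]] _ <-.
rewrite /pushforward.
have -> : sh c @^-1` [set` `](a, b).1, (a, b).2]] = [set` `]a - c, b - c]].
  by apply/seteqP; split => x /=; rewrite /sh !in_itv/= ltrBlDr lerBrDr.
rewrite !lebesgue_measure_itv/= !lte_fin ltrD2r.
by case: ifP => // _; rewrite -!EFinB; congr (_%:E); ring.
Qed.

Lemma ge0_integral_shift c (f : R -> \bar R) : measurable_fun [set: R] f ->
  (forall x, (0 <= f x)%E) -> (\int[mu]_x f (x + c)%R = \int[mu]_x f x)%E.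
Proof.
move=> mf f0.
transitivity (\int[pushforward mu (sh c)]_x f x)%E.
  by rewrite ge0_integral_pushforward//; exact: measurable_shift.
apply: eq_measure_integral => //=; first exact: measurable_shift.
by move=> mc A mA _; exact: lebesgue_measure_shift.
Qed.

Lemma rintegrable_shift c (f : R -> R) : rintegrable f -> rintegrable (fun x => f (x + c)).
Proof.
move=> fi; have mf := rintegrable_measurable fi.
apply/integrableP; split.
  apply/measurable_EFinP; exact: measurableT_comp mf (measurable_shift c).
rewrite (@ge0_integral_shift c (fun x => `|(f x)%:E|%E))//.
  by move/integrableP: fi => [].
by apply/measurable_EFinP; exact: measurableT_comp mf.
Qed.

Lemma Rintegral_shift c (f : R -> R) : measurable_fun [set: R] f ->
  \int[mu]_x f (x + c) = \int[mu]_x f x.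
Proof.
move=> mf; rewrite /Rintegral; congr fine.
have mE : measurable_fun [set: R] (fun x => (f x)%:E) by exact/measurable_EFinP.
rewrite integralE [RHS]integralE; congr (_ - _)%E.
  rewrite -[RHS](ge0_integral_shift c (measurable_funepos mE) (fun x => funepos_ge0 _ x)).
  by apply: eq_integral => x _; rewrite !funeposE.
rewrite -[RHS](ge0_integral_shift c (measurable_funeneg mE) (fun x => funeneg_ge0 _ x)).
by apply: eq_integral => x _; rewrite !funenegE.
Qed.

Lemma cintegral_shift c (f : R -> R[i]) : cmeasurable f ->
  cintegral (fun x => f (x + c)) = cintegral f.
Proof.
move=> [m1 m2]; apply: complex_eqE => /=.
  exact: (@Rintegral_shift c (fun x => complex.Re (f x))).
exact: (@Rintegral_shift c (fun x => complex.Im (f x))).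
Qed.

Lemma cmeasurable_shift c (f : R -> R[i]) : cmeasurable f -> cmeasurable (fun x => f (x + c)).
Proof.
move=> [m1 m2]; split.
  exact: (@measurableT_comp _ _ _ _ _ _ (fun x => complex.Re (f x)) _ (fun x : R => x + c)).
exact: (@measurableT_comp _ _ _ _ _ _ (fun x => complex.Im (f x)) _ (fun x : R => x + c)).
Qed.

Lemma derivable_shift c (f : R -> R) (x : R) : derivable f (x + c) 1 ->
  derivable (fun t => f (t + c)) x 1.
Proof.
rewrite /derivable.
suff -> : (fun h : R => h^-1 *: (((fun t => f (t + c)) \o shift x) (h *: 1) - f (x + c))) =
  (fun h : R => h^-1 *: ((f \o shift (x + c)) (h *: 1) - f (x + c))) by [].
by apply/funext => h /=; rewrite addrA.
Qed.

Lemma derive1_shift c (f : R -> R) (x : R) : derive1 (fun t => f (t + c)) x = derive1 f (x + c).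
Proof.
rewrite /derive1.
suff -> : (fun h : R => h^-1 *: (f (h + x + c) - f (x + c))) =
  (fun h : R => h^-1 *: (f (h + (x + c)) - f (x + c))) by [].
by apply/funext => h; rewrite addrA.
Qed.

Lemma derive1n_shift c n (f : R -> R) : derive1n n (fun t => f (t + c)) = (fun x => derive1n n f (x + c)).
Proof.
elim: n f => [|n IH] f; first by rewrite !derive1n0.
rewrite derive1Sn -[in RHS]/(derive1n n.+1 f) derive1Sn -IH; congr derive1n.
by apply/funext => x; exact: derive1_shift.
Qed.

Let poly_shift k c (g : R -> R) : (forall j : nat, exists M : R, forall x, `|x ^+ j * g x| <= M) ->
  exists M : R, forall x, `|(x - c) ^+ k * g x| <= M.
Proof.
elim: k g => [|k IH] g Hg.
  by have [M HM] := Hg 0%N; exists M => x; have := HM x; rewrite !expr0.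
have [M1 H1] : exists M : R, forall x, `|(x - c) ^+ k * (x * g x)| <= M.
  apply: (IH (fun x => x * g x)) => j; have [M HM] := Hg j.+1; exists M => x.
  by have := HM x; rewrite exprSr mulrA.
have [M2 H2] := IH g Hg.
exists (M1 + `|c| * M2) => x.
(* One factor [x - c] is split off: its [x] is absorbed into the function, which still has all its
   moments bounded. *)
have -> : (x - c) ^+ k.+1 * g x = (x - c) ^+ k * (x * g x) - c * ((x - c) ^+ k * g x).
  by rewrite exprS; ring.
by rewrite (le_trans (ler_normB _ _))// lerD// normrM ler_wpM2l.
Qed.

Lemma rschwartz_shift c (f : R -> R) : rschwartz f -> rschwartz (fun x => f (x + c)).
Proof.
move=> [df bf]; split => [n x|k n]; rewrite derive1n_shift.
  exact: derivable_shift.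
have [M HM] := @poly_shift k c (derive1n n f) (fun j => bf j n).
by exists M => x; have := HM (x + c); rewrite addrK.
Qed.

Lemma schwartz_shift c (f : R -> R[i]) : schwartz f -> schwartz (fun x => f (x + c)).
Proof. by move=> [f1 f2]; split; [exact: (rschwartz_shift c f1)|exact: (rschwartz_shift c f2)]. Qed.

Lemma rschwartz_measurable (f : R -> R) : rschwartz f -> measurable_fun [set: R] f.
Proof.
move=> [df _]; apply: continuous_measurable_fun => x.
by apply: differentiable_continuous; apply/derivable1_diffP; exact: df 0%N x.
Qed.

(** The translation passes to the test function, which stays Schwartz. It lets the estimate at [zal]
    reach every point of the line. *)
Lemma tempered_cvg_shift c (u : R -> R -> R[i]) (F : set_system R) (FF : Filter F) (v : R -> R[i]) :
  (\forall y \near F, cmeasurable (u y)) -> cmeasurable v ->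
  tempered_cvg u F v -> tempered_cvg (fun y x => u y (x + c)) F (fun x => v (x + c)).
Proof.
move=> mu_ mv uv phi sphi.
have sphi' := schwartz_shift (- c) sphi.
have mphi' : cmeasurable (fun x => phi (x - c)).
  by split; apply: rschwartz_measurable; case: sphi'.
have E (w : R -> R[i]) : cmeasurable w ->
    cintegral (fun x => w (x + c) * phi x) = cintegral (fun x => w x * phi (x - c)).
  move=> mw; rewrite -(cintegral_shift c (cmeasurableM mw mphi')).
  by apply: eq_cintegral => x; rewrite addrK.
rewrite E//; apply/cvg_ncP => e e0.
have /cvg_ncP/(_ e e0) := uv _ sphi'.
by apply: filterS2 mu_ => y my; rewrite E.
Qed.

End Translation.

(** * The sharp constant *)

Section Upper.
Variable R : realType.
Local Open Scope complex_scope.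
Notation mu := (@lebesgue_measure R).
Notation "'rintegrable' f" := (mu.-integrable [set: R] (EFin \o f)) (at level 10, f at level 9).
Implicit Types (x y : R) (z w : R[i]).

(** An infimum below [K] provides a decomposition on each line; its weights [1 / (1 - y)] and
    [1 / y] are at least 1, so each norm is bounded by the same [K] for all [y]. *)
Lemma Lnorm_bound_lt p q (h : R[i] -> R[i]) : (Hpq_norm p q h < +oo)%E ->
  exists2 K : R, 0 < K & forall y, 0 < y < 1 -> exists f g : R -> R[i],
    [/\ cmeasurable f, cmeasurable g, (cLnorm p f <= K%:E)%E, (cLnorm q g <= K%:E)%E &
        forall x, f x + g x = h (x +i* y)].
Proof.
move=> hfin.
have [K K0 HK] : exists2 K : R, 0 < K & (Hpq_norm p q h < K%:E)%E.
  case: (Hpq_norm p q h) hfin => [r _| |_]; last by exists 1 => //; exact: ltNyr.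
    exists (`|r| + 1); first by rewrite ltr_pwDr.
    by rewrite lte_fin (le_lt_trans (ler_norm r))// ltrDl.
  by rewrite ltxx.
exists K => // y y01; have [y0 y1] := andP y01.
have : (split_norm p q y (hline h y) < K%:E)%E.
  by apply: le_lt_trans HK; apply: ereal_sup_ubound; exists y.
move=> /ereal_inf_lt[_ [f [g [[mf _] [mg _] E ->]]] lt].
have f0 := Lnorm_ge0 mu p (fun x => (nc (f x))%:E).
have g0 := Lnorm_ge0 mu q (fun x => (nc (g x))%:E).
rewrite -/(cLnorm p f) in f0; rewrite -/(cLnorm q g) in g0.
have c1 : (1 <= ((1 - y)^-1)%:E)%E by rewrite lee_fin invf_ge1 ?subr_gt0// gerBl ltW.
have c2 : (1 <= (y^-1)%:E)%E by rewrite lee_fin invf_ge1// ltW.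
have big (c u : \bar R) : (1 <= c)%E -> (0 <= u)%E -> (u <= c * u)%E.
  by move=> c1' u0; rewrite -{1}[u]mul1e; exact: lee_wpmul2r.
have n1 : (0 <= (1 - y)^-1%:E * cLnorm p f)%E by rewrite (le_trans f0)// big.
have n2 : (0 <= y^-1%:E * cLnorm q g)%E by rewrite (le_trans g0)// big.
exists f, g; split => //.
  by rewrite (le_trans (big _ _ c1 f0))// (le_trans _ (ltW lt))// leeDl.
by rewrite (le_trans (big _ _ c2 g0))// (le_trans _ (ltW lt))// leeDr.
Qed.

(* As the weight is at most [1], the factor [D ^ (- 1 / p)] in [young_Lnorm] is
   at least [1]. *)
Lemma weighted_norm (D : R -> R) p (K : R) : (1 <= p)%E -> 0 < K -> (forall x, 0 < D x <= 1) ->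
  rintegrable D -> 0 < \int[mu]_x D x -> exists N : R, forall f, cmeasurable f ->
  (cLnorm p f <= K%:E)%E -> rintegrable (fun x => nc (f x) * D x) /\ \int[mu]_x (nc (f x) * D x) <= N.
Proof.
move=> p1 K0 D01 iD m0; set m := \int[mu]_x D x in m0 *.
have D0 x : 0 < D x by case/andP: (D01 x).
set a := inv_exponent p.
have [a0 a1] : 0 <= a /\ a <= 1 by apply/andP; exact: inv_exponent_01.
exists (expR (ln K - a * ln m) * m) => f mf fK.
have [ig Ig] := young_Lnorm D0 iD m0 erefl p1 mf K0 fK.
set g := (fun x => _) in ig Ig.
have le x : nc (f x) * D x <= expR (ln K - a * ln m) * g x.
  have -> : expR (ln K - a * ln m) * g x = nc (f x) * D x * expR (- (a * ln (D x))).
    have -> : - (a * ln (D x)) = (ln K - a * ln m) - (a * ln (D x) + (ln K - a * ln m)) by ring.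
    by rewrite (expRD (ln K - a * ln m)) /g -/a; move: (expR (ln K - _)) (expR (- _)) => u v; ring.
  rewrite ler_peMr ?mulr_ge0 ?nc_ge0 ?(ltW (D0 x))// -expR0 ler_expR oppr_ge0.
  by rewrite mulr_ge0_le0// ln_le0//; case/andP: (D01 x).
have igZ : rintegrable (fun x => expR (ln K - a * ln m) * g x) by exact: rintegrableZ.
have iD' : rintegrable (fun x => nc (f x) * D x).
  apply: rintegrable_le igZ => [|x].
    by apply: measurable_funM; [exact: cmeasurable_nc|exact: rintegrable_measurable].
  by rewrite ger0_norm ?mulr_ge0 ?nc_ge0 ?(ltW (D0 x)).
split => //; apply: le_trans (le_rint iD' igZ le) _.
by rewrite RintegralZl// ler_wpM2l ?expR_ge0.
Qed.

Lemma weighted_strip p q (h : R[i] -> R[i]) (D : R -> R) : (1 <= p)%E -> (1 <= q)%E ->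
  (Hpq_norm p q h < +oo)%E -> (forall y, 0 < y < 1 -> cmeasurable (fun x => h (x +i* y))) ->
  (forall x, 0 < D x <= 1) -> rintegrable D -> 0 < \int[mu]_x D x ->
  exists N : R, forall y, 0 < y < 1 -> rintegrable (fun x => nc (h (x +i* y)) * D x) /\
    \int[mu]_x (nc (h (x +i* y)) * D x) <= N.
Proof.
move=> p1 q1 /Lnorm_bound_lt[K K0 HK] mh D01 iD m0.
have [N1 H1] := weighted_norm p1 K0 D01 iD m0.
have [N2 H2] := weighted_norm q1 K0 D01 iD m0.
exists (N1 + N2) => y y01; have [f [g [mf mg fK gK fg]]] := HK y y01.
have [i1 I1] := H1 f mf fK; have [i2 I2] := H2 g mg gK.
have i12 := rintegrableD i1 i2.
have D0 x : 0 <= D x by case/andP: (D01 x) => /ltW.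
have le x : nc (h (x +i* y)) * D x <= nc (f x) * D x + nc (g x) * D x.
  by rewrite -mulrDl ler_wpM2r// -fg ncD.
have i : rintegrable (fun x => nc (h (x +i* y)) * D x).
  apply: rintegrable_le i12 => [|x].
    by apply: measurable_funM; [exact: cmeasurable_nc (mh y y01)|exact: rintegrable_measurable iD].
  by rewrite ger0_norm ?mulr_ge0 ?nc_ge0.
split => //; apply: le_trans (le_rint i i12 le) _.
by rewrite RintegralD// lerD.
Qed.

(** A multiple of [wt] dominates the Poisson kernel at [1 / 2], whose mass is known to be
    [1 / 2]. *)
Lemma integral_wt_gt0 : 0 < \int[mu]_x wt x.
Proof.
have Hc : 0 < (2^-1 : R) < 1 by rewrite invr_gt0 ltr0n invf_lt1// ltr1n.
have [k k0 Hk] := poisson_bound Hc.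
have h : 1 - 2^-1 <= k * \int[mu]_x wt x.
  rewrite -(integral_poisson Hc) -RintegralZl//; last exact: wt_integrable.
  apply: le_rint; [exact: poisson_integrable|exact/rintegrableZ/wt_integrable|].
  move=> x; apply: le_trans (Hk x) _.
  by rewrite ler_wpM2l ?(ltW k0)// wt_sqr_le.
rewrite -(pmulr_rgt0 _ k0); apply: lt_le_trans h.
by rewrite subr_gt0; case/andP: Hc.
Qed.

(** The right side of the theorem with the logarithms of quotients expanded: the kernels have masses
    [1 - al] and [al], hence the subtracted terms. *)
Definition log_const (al : R) (p q : \bar R) : R :=
  inv_exponent p * (\int[mu]_x (poisson al x * ln (poisson al x)) - (1 - al) * ln (1 - al)) +
  inv_exponent q * (\int[mu]_x (poisson (1 - al) x * ln (poisson (1 - al) x)) - al * ln al).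

(** [A] and [B] are upper bounds rather than the norms themselves, so that they may tend to 0 in
    [nonzero_boundary], and [al] is free so that any point of the strip can be reached. *)
Lemma strip_upper p q (h : R[i] -> R[i]) (h0 h1 : R -> R[i]) (A B x0 al : R) :
  (1 <= p)%E -> (1 <= q)%E -> in_Hpq p q h -> boundary_values p q h h0 h1 ->
  0 < A -> (cLnorm p h0 <= A%:E)%E -> 0 < B -> (cLnorm q h1 <= B%:E)%E -> 0 < al < 1 ->
  nc (h (x0 +i* al)) <= expR (log_const al p q + (1 - al) * ln A + al * ln B).
Proof.
move=> p1 q1 [hol hfin] [[mh0 _] [mh1 _] lim0 lim1] A0 h0A B0 h1B Hal.
have Hc := Hal' Hal.
have al0 : 0 < al by case/andP: Hal.
have al1 : 0 < 1 - al by case/andP: Hc.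
set a := inv_exponent p; set b := inv_exponent q.
pose b0 := ln A - a * ln (1 - al).
pose b1 := ln B - b * ln al.
have [Psi [L [K [r [K0 [[dPsi LK ReK PsiK] [Psi0 Psi1 LE]]]]]]] := exponent_exists Hal a b b0 b1.
have dh x y : 0 < y < 1 -> exists l, cderiv h (x +i* y) l.
  by move=> y01; apply: derivable_cderiv; exact: hol.
have mh y : 0 < y < 1 -> cmeasurable (fun x => h (x +i* y)).
  move=> y01; apply: rcont_measurable => x; apply: ccont_x.
  by have [l /cderiv_cont] := dh x y y01.
(* Brings the point [x0 +i* al] to [zal]; the weight [wt (x - x0)] for [h] below is the weight [wt]
   for [k]. *)
pose k z := h (z + x0%:C).
have kE x y : k (x +i* y) = h ((x + x0) +i* y) by rewrite /k addc_x.
have dk x y : 0 < y < 1 -> exists l, cderiv k (x +i* y) l.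
  move=> y01; have [l dl] := dh (x + x0) y y01; exists (l * 1).
  have := cderivD (cderiv_id (x +i* y)) (cderiv_cst x0%:C (x +i* y)); rewrite addr0 => d1.
  by apply: (cderiv_comp d1); rewrite addc_x.
have wi : rintegrable (fun x => wt (x - x0)) := rintegrable_shift (- x0) (wt_integrable R).
have wS : \int[mu]_x wt (x - x0) = \int[mu]_x wt x.
  by apply: (@Rintegral_shift _ (- x0) (@wt R)); exact: rintegrable_measurable (wt_integrable R).
have [N HN] : exists N : R, forall y, 0 < y < 1 ->
    rintegrable (fun x => nc (h (x +i* y)) * wt (x - x0)) /\
    \int[mu]_x (nc (h (x +i* y)) * wt (x - x0)) <= N.
  apply: (@weighted_strip p q h (fun x => wt (x - x0)) p1 q1 hfin mh) => //.
    by move=> x; rewrite wt_gt0 wt_le1.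
  by rewrite wS integral_wt_gt0.
have wE y : (fun x => nc (k (x +i* y)) * wt x) =
    (fun x => (fun t => nc (h (t +i* y)) * wt (t - x0)) (x + x0)).
  by apply/funext => x; rewrite kE addrK.
have ik y : 0 < y < 1 -> rintegrable (fun x => nc (k (x +i* y)) * wt x).
  by move=> y01; rewrite wE; exact: (@rintegrable_shift _ x0 (fun t => nc (h (t +i* y)) * wt (t - x0)) (HN y y01).1).
have kN y : 0 < y < 1 -> \int[mu]_x (nc (k (x +i* y)) * wt x) <= N.
  move=> y01; rewrite wE (@Rintegral_shift _ x0 (fun t => nc (h (t +i* y)) * wt (t - x0))).
    exact: (HN y y01).2.
  exact: rintegrable_measurable (HN y y01).1.
have kl : hline k = (fun y x => hline h y (x + x0)).
  by apply/funext => y; apply/funext => x; exact: kE.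
have klim0 : tempered_cvg (hline k) 0^'+ (fun x => h0 (x + x0)).
  rewrite kl; apply: tempered_cvg_shift lim0 => //.
  near=> y; apply: mh; apply/andP; split; near: y; [exact: nbhs_right_gt|exact: nbhs_right_lt].
have klim1 : tempered_cvg (hline k) 1^'- (fun x => h1 (x + x0)).
  rewrite kl; apply: tempered_cvg_shift lim1 => //.
  near=> y; apply: mh; apply/andP; split; near: y; [exact: nbhs_left_gt|exact: nbhs_left_lt].
(* The density is translated instead of the boundary value: [young_Lnorm] applies to [u] itself with
   [poisson c (x - x0)], and only the resulting integral is shifted back. *)
have dens (c : R) (Hcc : 0 < c < 1) (s : \bar R) (u : R -> R[i]) (E d : R) :
    (1 <= s)%E -> cmeasurable u -> 0 < E -> (cLnorm s u <= E%:E)%E ->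
    d = ln E - inv_exponent s * ln (1 - c) ->
    let g x := poisson c x * (nc (u (x + x0)) * expR (- (inv_exponent s * ln (poisson c x) + d))) in
    rintegrable g /\ \int[mu]_x g x <= 1 - c.
  move=> s1 mu_ E0 uE dE g.
  have ip : rintegrable (fun x => poisson c (x - x0)) := rintegrable_shift (- x0) (poisson_integrable Hcc).
  have Ip : \int[mu]_x poisson c (x - x0) = 1 - c.
    rewrite -(integral_poisson Hcc); apply: (@Rintegral_shift _ (- x0) (poisson c)).
    exact: rintegrable_measurable (poisson_integrable Hcc).
  have c1 : 0 < 1 - c by rewrite subr_gt0; case/andP: Hcc.
  have [iG IG] := young_Lnorm (fun x => poisson_gt0 Hcc (x - x0)) ip c1 Ip s1 mu_ E0 uE.
  set G := (fun x => _) in iG IG.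
  have gE : g = (fun x => G (x + x0)) by apply/funext => x; rewrite /g /G addrK dE.
  rewrite gE; split; first exact: rintegrable_shift.
  by rewrite Rintegral_shift//; exact: rintegrable_measurable.
have [i0 I0] := dens al Hal p h0 A b0 p1 mh0 A0 h0A erefl.
have b1E : b1 = ln B - inv_exponent q * ln (1 - (1 - al)) by rewrite subKr.
have [i1 I1] := dens (1 - al) Hc q h1 B b1 q1 mh1 B0 h1B b1E.
rewrite subKr in I1.
have := three_lines_zal Hal K0 dPsi LK ReK Psi0 Psi1 LE dk ik kN klim0 klim1
  (cmeasurable_shift x0 mh0) (cmeasurable_shift x0 mh1) i0 i1 I0 I1.
rewrite (Re_Psi_zal Hal K0 dPsi PsiK Psi0 Psi1) kE add0r.
congr (_ <= expR _); rewrite /log_const -/a -/b /b0 /b1; ring.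
Unshelve. all: by end_near.
Qed.

End Upper.

(** * Tools for the lower bound *)

Section Lower.
Variable R : realType.
Local Open Scope complex_scope.
Notation mu := (@lebesgue_measure R).
Implicit Types (x y : R) (z w : R[i]).

Lemma cLnorm_ge0 p (f : R -> R[i]) : (0 <= cLnorm p f)%E.
Proof. exact: Lnorm_ge0. Qed.

(** [extremal_Lnorm] with the density [wt]: as [wt] and [1 / p] are at most 1, [wt] is at most
    [wt ^ (1 / p)]. *)
Lemma cLnorm_wt p (C : R) : (1 <= p)%E -> 0 < C -> exists2 C' : R, 0 < C' &
  forall f, cmeasurable f -> (forall x, nc (f x) <= C * wt x) -> (cLnorm p f <= C'%:E)%E.
Proof.
move=> p1 C0; set a := inv_exponent p; set m := \int[mu]_x wt x.
have [a0 a1] : 0 <= a /\ a <= 1 by apply/andP; exact: inv_exponent_01.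
have c0 : 0 < C * expR (a * ln m) by rewrite mulr_gt0 ?expR_gt0.
exists (C * expR (a * ln m)) => // f mf fC.
apply: (@extremal_Lnorm _ (@wt R) m (@wt_gt0 R) (@wt_integrable R) (integral_wt_gt0 R) erefl) => // x.
apply: le_trans (fC x) _; rewrite -mulrA -expRD.
have -> : a * ln m + inv_exponent p * (ln (wt x) - ln m) = a * ln (wt x) by rewrite -/a; ring.
rewrite ler_wpM2l ?(ltW C0)// -{1}[wt x]lnK ?posrE ?wt_gt0// ler_expR.
by rewrite ler_niMl// ln_le0// wt_le1.
Qed.

Lemma cLnorm0 p : (1 <= p)%E -> cLnorm p (fun=> 0 : R[i]) = 0%E.
Proof.
move=> p1; rewrite /cLnorm.
have -> : (fun _ : R => (nc (0 : R[i]))%:E) = cst 0%E by apply/funext => x; rewrite Normc.normc0.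
by rewrite Lnorm0// gt_eqF// (lt_le_trans lte01).
Qed.

(** One summand of the splitting is 0: the second for [y] up to [1 / 2], the first beyond, so that
    the factor in front of the other is at most 2. *)
Lemma decay_in_Hpq p q (h : R[i] -> R[i]) (C : R) : (1 <= p)%E -> (1 <= q)%E -> 0 < C ->
  (forall y, 0 < y < 1 -> cmeasurable (fun x => h (x +i* y))) ->
  (forall x y, 0 < y < 1 -> nc (h (x +i* y)) <= C * wt x) -> (Hpq_norm p q h < +oo)%E.
Proof.
move=> p1 q1 C0 mh hC.
have [C1 C10 H1] := cLnorm_wt p1 C0; have [C2 C20 H2] := cLnorm_wt q1 C0.
apply: (@le_lt_trans _ _ ((2 * C1 + 2 * C2)%:E)); last exact: ltry.
apply: ub_ereal_sup => _ [y /= y01 <-]; have [y0 y1] := andP y01.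
have n1 := H1 _ (mh y y01) (fun x => hC x y y01).
have n2 := H2 _ (mh y y01) (fun x => hC x y y01).
have fin (s : \bar R) (u : R -> R[i]) (E : R) : cmeasurable u -> (cLnorm s u <= E%:E)%E -> in_cLp s u.
  by move=> mu_ uE; split => //; exact: le_lt_trans uE (ltry _).
have z s : (1 <= s)%E -> in_cLp s (fun=> 0 : R[i]).
  by move=> s1; split; [exact: cmeasurable_cst|rewrite cLnorm0].
have inv2 (u : R) : 2^-1 <= u -> u^-1 <= 2.
  by move=> hu; rewrite -[leRHS]invrK lef_pV2 ?posrE ?invr_gt0// (lt_le_trans _ hu)// invr_gt0.
have [yl|/ltW yr] := leP y 2^-1.
- pose v : \bar R := ((1 - y)^-1%:E * cLnorm p (hline h y) + y^-1%:E * cLnorm q (fun=> 0%R : R[i]))%E.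
  apply: (@le_trans _ _ v).
    apply: ereal_inf_lbound; exists (hline h y), (fun=> 0); split => //.
    + exact: fin (mh y y01) n1.
    + exact: z.
    + by move=> x; rewrite addr0.
  rewrite /v cLnorm0// mule0 adde0.
  apply: (@le_trans _ _ (2%:E * C1%:E)%E).
    apply: lee_pmul => //; rewrite ?lee_fin ?invr_ge0 ?subr_ge0 ?(ltW y1) ?cLnorm_ge0//.
    by apply: inv2; lra.
  by rewrite -EFinM lee_fin lerDl mulr_ge0// ltW.
- pose v : \bar R := ((1 - y)^-1%:E * cLnorm p (fun=> 0%R : R[i]) + y^-1%:E * cLnorm q (hline h y))%E.
  apply: (@le_trans _ _ v).
    apply: ereal_inf_lbound; exists (fun=> 0), (hline h y); split => //.
    + exact: z.
    + exact: fin (mh y y01) n2.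
    + by move=> x; rewrite add0r.
  rewrite /v cLnorm0// mule0 add0e.
  apply: (@le_trans _ _ (2%:E * C2%:E)%E).
    by apply: lee_pmul => //; rewrite ?lee_fin ?invr_ge0 ?(ltW y0) ?cLnorm_ge0// inv2.
  by rewrite -EFinM lee_fin lerDr mulr_ge0// ltW.
Qed.

Lemma schwartz_bounded (phi : R -> R[i]) : schwartz phi ->
  cmeasurable phi /\ exists2 M : R, 0 <= M & forall x, nc (phi x) <= M.
Proof.
move=> [s1 s2]; split; first by split; exact: rschwartz_measurable.
have [[_ b1] [_ b2]] := (s1, s2).
have [M1 H1] := b1 0%N 0%N; have [M2 H2] := b2 0%N 0%N.
have B x : nc (phi x) <= M1 + M2.
  rewrite (le_trans (nc_le_ReIm _))// lerD//.
    by have := H1 x; rewrite expr0 mul1r derive1n0.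
  by have := H2 x; rewrite expr0 mul1r derive1n0.
by exists (M1 + M2) => //; exact: le_trans (nc_ge0 _) (B 0).
Qed.

Lemma lipschitz_tempered (h : R[i] -> R[i]) (C y0 : R) (F : set_system R) (FF : Filter F) :
  0 < C -> (forall y, 0 <= y <= 1 -> cmeasurable (fun x => h (x +i* y))) ->
  (forall x y, 0 <= y <= 1 -> nc (h (x +i* y)) <= C * wt x) -> 0 <= y0 <= 1 ->
  (forall x y, 0 <= y <= 1 -> nc (h (x +i* y) - h (x +i* y0)) <= C * `|y - y0| * wt x) ->
  (\forall y \near F, 0 <= y <= 1) -> (forall e : R, 0 < e -> \forall y \near F, `|y - y0| <= e) ->
  tempered_cvg (hline h) F (fun x => h (x +i* y0)).
Proof.
move=> C0 mh hC y01 lip F01 Fy phi /schwartz_bounded[mphi [M M0 phiM]].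
apply/cvg_ncP => e e0.
pose W := \int[mu]_x wt x.
have W0 : 0 < W := integral_wt_gt0 R.
pose B := C * M * W + 1.
have B0 : 0 < B by rewrite ltr_wpDl// !mulr_ge0// ltW.
have i y : 0 <= y <= 1 -> cintegrable (fun x => h (x +i* y) * phi x).
  move=> yy; apply: (@cintegrable_le _ _ (fun x => C * M * wt x)).
  - exact: cmeasurableM (mh y yy) mphi.
  - move=> x; rewrite ncM mulrAC; apply: ler_pM; rewrite ?nc_ge0//; exact: hC.
  - exact/rintegrableZ/wt_integrable.
have eB : 0 < e / B by rewrite divr_gt0.
apply: filterS2 F01 (Fy _ eB) => y yy yd.
rewrite /hline -(cintegralB (i y yy) (i y0 y01)).
apply: le_trans (nc_cintegral (cintegrableB (i y yy) (i y0 y01))) _.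
apply: (@le_trans _ _ (\int[mu]_x (C * `|y - y0| * M * wt x))).
  apply: le_rint.
  - exact/cintegrable_nc/(cintegrableB (i y yy) (i y0 y01)).
  - exact/rintegrableZ/wt_integrable.
  - by move=> x; rewrite -mulrBl ncM mulrAC; apply: ler_pM; rewrite ?nc_ge0// lip.
rewrite RintegralZl//; last exact: wt_integrable.
rewrite -/W.
apply: (@le_trans _ _ (B * `|y - y0|)); last by rewrite mulrC -ler_pdivlMr.
have -> : C * `|y - y0| * M * W = C * M * W * `|y - y0| by ring.
by rewrite ler_wpM2r// lerDl.
Qed.

(** By continuity a value exceeding the essential supremum would do so on a whole interval, which is
    not a null set. *)
Lemma ess_sup_ge_value (h : R[i] -> R[i]) x0 y : ccont h (x0 +i* y) ->
  ((nc (h (x0 +i* y)))%:E <= cLnorm +oo (hline h y))%E.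
Proof.
move=> ch; apply/lee_addgt0Pr => e e0; rewrite leNgt; apply/negP => lt.
have [d d0 Hd] := ch e e0.
have near x : `|x - x0| < d -> (cLnorm +oo (hline h y) < (nc (hline h y x))%:E)%E.
  move=> xd; have := Hd (x - x0)%:C; rewrite nc_real addc_x subrKC => /(_ xd) D.
  have lt2 : ((nc (h (x0 +i* y)))%:E <= (nc (hline h y x))%:E + e%:E)%E.
    rewrite -EFinD lee_fin -lerBlDl.
    have := ncB (h (x +i* y)) (h (x +i* y) - h (x0 +i* y)).
    by rewrite subKr /hline; lra.
  by have := lt_le_trans lt lt2; rewrite lteD2rE.
have := ess_sup_inf.ess_sup_ge mu (fun x => `|(nc (hline h y x))%:E|%E).
move=> [A [mA A0 sub]].
pose I : set R := [set` `]x0 - d, x0 + d[].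
have mI : measurable I by exact: measurable_itv.
have : (mu I <= mu A)%E.
  apply: le_measure; rewrite ?inE//.
  move=> x; rewrite /I /= in_itv/= => /andP[x1 x2]; apply: sub => /=; apply/negP; rewrite -ltNge.
  have xd : `|x - x0| < d by rewrite ltr_norml; lra.
  have := near x xd; rewrite /cLnorm unlock lebesgue_setT_gt0.
  by rewrite ger0_norm ?nc_ge0.
rewrite A0 /I lebesgue_measure_itv/= lte_fin ifT; last by lra.
by rewrite -EFinB lee_fin; lra.
Qed.

End Lower.

Section Constant.
Variables (R : realType) (al : R) (Hal : 0 < al < 1) (p q : \bar R).
Hypotheses (p1 : (1 <= p)%E) (q1 : (1 <= q)%E).
Local Open Scope complex_scope.
Notation mu := (@lebesgue_measure R).
Implicit Types (x y : R) (z w : R[i]).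

Let al0 : 0 < al. Proof. by case/andP: Hal. Qed.
Let al1 : al < 1. Proof. by case/andP: Hal. Qed.
Let Hc := Hal' Hal.

(** A zero norm would put 0 in the denominator of the quotient. It is excluded because [strip_upper]
    then holds with arbitrarily small [E], which forces [h] to vanish at the given point. *)
Lemma nonzero_boundary (h : R[i] -> R[i]) h0 h1 : in_Hpq p q h -> boundary_values p q h h0 h1 ->
  (exists2 z, strip z & h z != 0) -> cLnorm p h0 != 0%E /\ cLnorm q h1 != 0%E.
Proof.
move=> hH hb [[x t] z01 hz].
have t01 : 0 < t < 1 := z01.
have n0 : 0 < nc (h (x +i* t)) by rewrite nc_gt0.
have [t0 t1] := andP t01.
have s1 : 0 < 1 - t by rewrite subr_gt0.
have [_ f0] : in_cLp p h0 by case: hb.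
have [_ f1] : in_cLp q h1 by case: hb.
have fin (s : \bar R) (u : R -> R[i]) : (cLnorm s u < +oo)%E ->
    exists2 E : R, 0 < E & (cLnorm s u <= E%:E)%E.
  move=> ufin; have u0 := cLnorm_ge0 s u.
  have : cLnorm s u \is a fin_num by rewrite ge0_fin_numE.
  move=> /fineK <-; exists (fine (cLnorm s u) + 1); first by rewrite ltr_wpDl// fine_ge0.
  by rewrite lee_fin lerDl.
have [A A0 HA] := fin _ _ f0; have [B B0 HB] := fin _ _ f1.
have small (C : R) (s : \bar R) (u : R -> R[i]) (v : R) : 0 < v -> cLnorm s u = 0%E ->
    (forall E, 0 < E -> (cLnorm s u <= E%:E)%E -> nc (h (x +i* t)) <= expR (C + v * ln E)) -> False.
  (* Taking [expR k] for [E] turns the exponent of the bound into [ln (nc (h (x +i* t))) - 1]. *)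
  move=> v0 u0 H; pose k := (ln (nc (h (x +i* t))) - C - 1) / v.
  have := H (expR k) (expR_gt0 _); rewrite u0 lee_fin expR_ge0 => /(_ isT).
  rewrite expRK -{1}(lnK n0) ler_expR mulrC mulfVK ?gt_eqF//; lra.
split; apply/eqP => e.
- apply: (small (log_const t p q + t * ln B) _ _ _ s1 e) => E E0 HE.
  by have := strip_upper x p1 q1 hH hb E0 HE B0 HB t01; congr (_ <= expR _); ring.
- apply: (small (log_const t p q + (1 - t) * ln A) _ _ _ t0 e) => E E0 HE.
  by have := strip_upper x p1 q1 hH hb A0 HA E0 HE t01; congr (_ <= expR _); ring.
Qed.

Lemma Hconst_le : (Hconst p q al <= (expR (log_const al p q))%:E)%E.
Proof.
apply: ub_ereal_sup => _ [h [h0 [h1 [hH hnz hb ->]]]].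
have [n0 n1] := nonzero_boundary hH hb hnz.
have [_ f0] : in_cLp p h0 by case: hb.
have [_ f1] : in_cLp q h1 by case: hb.
have fin (s : \bar R) (u : R -> R[i]) : (cLnorm s u < +oo)%E -> cLnorm s u != 0%E ->
    exists2 E : R, 0 < E & cLnorm s u = E%:E.
  move=> ufin unz; have u0 := cLnorm_ge0 s u.
  have uf : cLnorm s u \is a fin_num by rewrite ge0_fin_numE.
  exists (fine (cLnorm s u)); last by rewrite fineK.
  by rewrite fine_gt0// ufin andbT lt0e unz.
have [A A0 HA] := fin _ _ f0 n0; have [B B0 HB] := fin _ _ f1 n1.
rewrite HA HB !poweR_EFin -EFinM inver gt_eqF ?mulr_gt0 ?powR_gt0//.
rewrite lee_pdivrMr ?mulr_gt0 ?powR_gt0//.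
rewrite /cLnorm unlock lebesgue_setT_gt0; apply/ess_sup_inf.ess_supP/nearW => x /=.
rewrite lee_fin ger0_norm ?nc_ge0//.
have := strip_upper x p1 q1 hH hb A0 _ B0 _ Hal; rewrite HA HB !lexx => /(_ isT isT).
by rewrite /powR !gt_eqF// /hline -!expRD addrA.
Qed.

(** With these constants [exp Psi] has modulus [(P_al / (1 - al)) ^ (1 / p)] on [y = 0] and
    [(P_(1 - al) / al) ^ (1 / q)] on [y = 1], of norm 1 each. The Gaussian gives it decay and costs
    a factor [expR eps]. *)
Lemma Hconst_ge : ((expR (log_const al p q))%:E <= Hconst p q al)%E.
Proof.
pose a := inv_exponent p; pose b := inv_exponent q.
have [Psi [L [K [r [K0 [[dPsi LK ReK PsiK] [Psi0 Psi1 LE]]]]]]] :=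
  exponent_exists Hal a b (- (a * ln (1 - al))) (- (b * ln al)).
have RePsi : complex.Re (Psi (zal al)) = log_const al p q.
  by rewrite (Re_Psi_zal Hal K0 dPsi PsiK Psi0 Psi1) /log_const -/a -/b; ring.
have main (eps : R) : 0 < eps -> ((expR (log_const al p q - eps))%:E <= Hconst p q al)%E.
  move=> eps0; pose h := damp Psi eps 1.
  pose h0 : R -> R[i] := fun x => h (x +i* 0); pose h1 : R -> R[i] := fun x => h (x +i* 1).
  have [C C0 HC] := @damp_bound _ Psi L K K0 LK ReK eps eps0 1 1 ltac:(by rewrite normr1).
  have dh x y : 0 <= y <= 1 -> cderiv h (x +i* y) (damp' Psi L eps 1 (x +i* y)).
    exact: cderiv_damp.
  have hC x y : 0 <= y <= 1 -> nc (h (x +i* y)) <= C * wt x.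
    by move=> y01; have [] := HC x y y01; rewrite expr1.
  have mh y : 0 <= y <= 1 -> cmeasurable (fun x => h (x +i* y)).
    move=> y01; apply: rcont_measurable => x; apply: ccont_x; exact: cderiv_cont (dh x y y01).
  have o01 y : 0 < y < 1 -> 0 <= y <= 1 by move=> /andP[/ltW -> /ltW ->].
  have y00 : 0 <= (0 : R) <= 1 by rewrite lexx ler01.
  have y11 : 0 <= (1 : R) <= 1 by rewrite lexx ler01.
  have lip x y1 y2 : 0 <= y1 -> y1 <= y2 -> y2 <= 1 ->
      nc (h (x +i* y2) - h (x +i* y1)) <= 2 * C * (y2 - y1) * wt x.
    move=> u1 u12 u2; rewrite mulrAC -[2 * C * wt x]mulrA; apply: (vertical_lipschitz u12) => y /andP[ya yb].
      by apply: dh; rewrite (le_trans u1 ya) (le_trans yb u2).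
    have y01 : 0 <= y <= 1 by rewrite (le_trans u1 ya) (le_trans yb u2).
    by have [_] := HC x y y01; rewrite expr1.
  have C20 : 0 < 2 * C by rewrite mulr_gt0.
  have hC2 x y : 0 <= y <= 1 -> nc (h (x +i* y)) <= 2 * C * wt x.
    move=> y01; apply: le_trans (hC x y y01) _; rewrite ler_wpM2r ?wt_ge0//.
    by rewrite mulr_natl mulr2n lerDl ltW.
  have hol : holomorphic_on_strip h.
    by move=> [x y] y01; apply: cderiv_derivable; exact: dh (o01 y y01).
  have hH : in_Hpq p q h.
    split => //; apply: (decay_in_Hpq p1 q1 C0) => [y /o01|x y /o01]; [exact: mh|exact: hC].
  have c1 : 0 < 1 - al by rewrite subr_gt0.
  have N0 : (cLnorm p h0 <= 1)%E.
    apply: (@extremal_Lnorm _ _ (1 - al) (poisson_gt0 Hal) (poisson_integrable Hal) c1 (integral_poisson Hal)) => //.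
      exact: mh.
    move=> x; rewrite mul1r nc_damp Psi0 ler_expR -/a.
    by rewrite expr0n subr0 mul1r -mulrBr gerBl mulr_ge0 ?sqr_ge0// ltW.
  have ic : \int[mu]_x poisson (1 - al) x = al by rewrite (integral_poisson Hc) subKr.
  (* Only here does the damping lose: on [y = 1] the modulus of [exp (- eps * z ^ 2)] is
     [expR (eps - eps * x ^ 2)]. At height [al] on the axis it is at least 1, to the benefit of the
     numerator. *)
  have N1 : (cLnorm q h1 <= (expR eps)%:E)%E.
    apply: (@extremal_Lnorm _ _ al (poisson_gt0 Hc) (poisson_integrable Hc) al0 ic) => //.
    - exact: mh.
    - exact: expR_gt0.
    move=> x; rewrite -expRD nc_damp Psi1 ler_expR -/b expr1n mul1r -mulrBr.
    have : 0 <= eps * x ^+ 2 by rewrite mulr_ge0 ?sqr_ge0// ltW.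
    by rewrite [eps * (_ - 1)]mulrBr mulr1; lra.
  have hb : boundary_values p q h h0 h1.
    split.
    - by split; [exact: mh|exact: le_lt_trans N0 (ltry _)].
    - by split; [exact: mh|exact: le_lt_trans N1 (ltry _)].
    - apply: (lipschitz_tempered _ C20 mh hC2 y00).
      + by move=> x y /andP[y0 y1]; rewrite subr0 ger0_norm//; have := lip x 0 y (lexx _) y0 y1; rewrite subr0.
      + near=> y; apply/andP; split; apply: ltW; near: y; [exact: nbhs_right_gt|exact: nbhs_right_lt].
      + move=> e e0; near=> y; rewrite subr0 ger0_norm.
          by apply: ltW; near: y; exact: nbhs_right_lt.
        by apply: ltW; near: y; exact: nbhs_right_gt.
    - apply: (lipschitz_tempered _ C20 mh hC2 y11).
      + move=> x y /andP[y0 y1]; rewrite -ncN opprB ler0_norm ?subr_le0// opprB.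
        exact: lip.
      + near=> y; apply/andP; split; apply: ltW; near: y; [exact: nbhs_left_gt|exact: nbhs_left_lt].
      + move=> e e0; near=> y; rewrite ler0_norm.
          rewrite opprB lerBlDr -lerBlDl; apply: ltW; near: y; apply: nbhs_left_gt.
          by rewrite gtrBl.
        by rewrite subr_le0; apply: ltW; near: y; exact: nbhs_left_lt.
  have hz : h (zal al) != 0 by exact: cexp_neq0.
  apply: (@le_trans _ _ (cLnorm +oo (hline h al) / (cLnorm p h0 `^ (1 - al) *
     cLnorm q h1 `^ al))%E); last first.
    apply: ereal_sup_ubound; exists h, h0, h1; split => //.
    by exists (zal al).
  have V : ((expR (log_const al p q))%:E <= cLnorm +oo (hline h al))%E.
    apply: le_trans (ess_sup_ge_value (cderiv_cont (dh 0 al (o01 al Hal)))).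
    rewrite lee_fin -/(zal al) nc_damp RePsi ler_expR mul1r expr0n sub0r mulrN opprK lerDl.
    by rewrite mulr_ge0 ?sqr_ge0// ltW.
  set d := (cLnorm p h0 `^ (1 - al) * cLnorm q h1 `^ al)%E.
  have dle : (d <= (expR eps)%:E)%E.
    have -> : expR eps = 1 * expR eps by rewrite mul1r.
    rewrite EFinM; apply: lee_pmul; rewrite ?poweR_ge0//.
      have := @gt0_ler_poweR _ (1 - al) (ltW c1) _ _ _ _ N0; rewrite poweR1r; apply.
        by rewrite in_itv/= leey andbT cLnorm_ge0.
      by rewrite in_itv/= leey andbT lee_fin.
    have := @gt0_ler_poweR _ al (ltW al0) _ _ _ _ N1; rewrite poweR_EFin => /(_ _ _)/le_trans; apply.
    - by rewrite in_itv/= leey andbT cLnorm_ge0.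
    - by rewrite in_itv/= leey andbT lee_fin expR_ge0.
    by rewrite lee_fin -expRM ler_expR ler_piMr ?ltW.
  have d0 : (0 <= d)%E by rewrite mule_ge0 ?poweR_ge0.
  (* The inverse of 0 is [+oo] in the extended reals, so the case [d = 0] needs no lower bound on
     the norms. *)
  have iv : ((expR (- eps))%:E <= d^-1)%E.
    case: d dle d0 => [t| |]//; rewrite !lee_fin => tle t0; rewrite inver.
    case: eqVneq => [_|tn]; first exact: leey.
    have t1 : 0 < t by rewrite lt_def tn.
    by rewrite lee_fin expRN lef_pV2 ?posrE ?expR_gt0.
  rewrite expRD EFinM; apply: lee_pmul => //; rewrite lee_fin expR_ge0//.
apply/lee_addgt0Pr => e e0.
(* Since [1 - eps <= expR (- eps)], this [eps] loses at most [e]. *)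
pose k := log_const al p q; pose eps := e / expR k.
have eps0 : 0 < eps by rewrite divr_gt0 ?expR_gt0.
apply: (@le_trans _ _ ((expR (k - eps))%:E + e%:E)%E); last by rewrite leeD2r// main.
rewrite -EFinD lee_fin -/k expRD.
have h1 := ler_wpM2l (expR_ge0 k) (expR_ge1Dx (- eps)).
have h2 : expR k * eps = e by rewrite /eps mulrC mulfVK// gt_eqF// expR_gt0.
rewrite mulrDr mulr1 mulrN h2 in h1; lra.
Unshelve. all: by end_near.
Qed.

Lemma lne_Hconst : lne (Hconst p q al) = (log_const al p q)%:E.
Proof.
have -> : Hconst p q al = (expR (log_const al p q))%:E.
  by apply/eqP; rewrite eq_le Hconst_le Hconst_ge.
by rewrite lne_EFin ?expR_gt0// expRK.
Qed.

End Constant.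

Lemma integral_poisson_entropy (R : realType) (c m : R) : 0 < c < 1 -> m = 1 - c ->
  (\int[@lebesgue_measure R]_x (poisson c x * ln (poisson c x / m))%:E)%E =
  (\int[@lebesgue_measure R]_x (poisson c x * ln (poisson c x)) - m * ln m)%R%:E.
Proof.
move=> Hc ->; have c1 : 0 < 1 - c by rewrite subr_gt0; case/andP: Hc.
have i := poisson_ln_integrable Hc; have j := poisson_integrable Hc.
have E x : poisson c x * ln (poisson c x / (1 - c)) =
    poisson c x * ln (poisson c x) - ln (1 - c) * poisson c x.
  by rewrite ln_div ?posrE ?poisson_gt0//; ring.
under eq_integral do rewrite E.
have iZ := rintegrableZ (ln (1 - c)) j.
rewrite rintegral_EFin; last exact: rintegrableB.
by rewrite RintegralB// (RintegralZl _ _ j)// integral_poisson// mulrC.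
Qed.

Theorem theorem1p3 (R : realType) (alpha : R) (halpha : 0 < alpha < 1) :
  (lne (Hconst 1 +oo alpha) =
   \int[@lebesgue_measure R]_x
     (poisson alpha x * ln (poisson alpha x / (1 - alpha)))%:E)%E
  /\
  (forall p q : \bar R, (1 <= p)%E -> (1 <= q)%E ->
   (lne (Hconst p q alpha) =
    p^-1 * (\int[@lebesgue_measure R]_x
      (poisson alpha x * ln (poisson alpha x / (1 - alpha)))%:E) +
    q^-1 * (\int[@lebesgue_measure R]_x
      (poisson (1 - alpha) x * ln (poisson (1 - alpha) x / alpha))%:E))%E).
Proof.
have main p q : (1 <= p)%E -> (1 <= q)%E -> lne (Hconst p q alpha) =
    (p^-1 * (\int[@lebesgue_measure R]_x
      (poisson alpha x * ln (poisson alpha x / (1 - alpha)))%:E) +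
    q^-1 * (\int[@lebesgue_measure R]_x
      (poisson (1 - alpha) x * ln (poisson (1 - alpha) x / alpha))%:E))%E.
  move=> p1 q1; rewrite lne_Hconst// /log_const.
  have h' : alpha = 1 - (1 - alpha) by rewrite subKr.
  rewrite (integral_poisson_entropy halpha erefl) (integral_poisson_entropy (Hal' halpha) h').
  by rewrite !inveE.
split => //.
have e1 : (1^-1 = 1 :> \bar R)%E by rewrite inver oner_eq0 invr1.
have e2 : (+oo^-1 = 0 :> \bar R)%E by [].
by rewrite main ?leey// e1 e2 mul1e mul0e adde0.
Qed.
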